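(* For every integer $n>0$, $$\mathcal{A}_n(X;q)=\left.\Theta_{e_{1^{n-1}}}e_1\right|_{t=1}.$$
   Context: **Symmetric functions.** $\Lambda$ is the graded algebra of symmetric functions in $x_1,x_2,\dots$ over $\mathbb{Q}(q,t)$, $\Lambda^{(n)}$ its degree $n$ part; $e_\lambda$ are the elementary symmetric functions, $e_{1^n}=e_1^n$ ($e_{1^0}=1$). Put $M=(1-q)(1-t)$; for $f\in\Lambda$, the plethysm $f[X/M]$ is the image of $f$ under the $\mathbb{Q}(q,t)$-algebra map $p_k\mapsto p_k/((1-q^k)(1-t^k))$ ($p_k$ the power sums). For a partition $\mu$, $\widetilde H_\mu=\sum_{\lambda\vdash|\mu|}K_{\lambda\mu}(q,1/t)\,t^{n(\mu)}s_\lambda$ is the modified Macdonald polynomial, where $K_{\lambda\mu}(q,t)$ are the Macdonald $q,t$-Kostka coefficients and $n(\mu)=\sum_i(i-1)\mu_i$; $\widetilde H_\varnothing=1$. They form a basis of $\Lambda$. Identify $\mu$ with its Ferrers diagram (row $1$, of length $\mu_1$, at the bottom); for a cell $c$, $a'_\mu(c)$ and $l'_\mu(c)$ are the numbers of cells of $\mu$ strictly to its left in its row, and strictly below it in its column. Let $\Pi_\mu=\prod_c(1-q^{a'_\mu(c)}t^{l'_\mu(c)})$, over all cells $c\neq$ the bottom-left corner, $\Pi_\varnothing=1$. Let $\mathbf{\Pi}:\Lambda\to\Lambda$ be the (invertible) linear operator with $\mathbf{\Pi}\widetilde H_\mu=\Pi_\mu\widetilde H_\mu$. **Theta operators.** For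 $f\in\Lambda^{(n)}$, $F\in\Lambda^{(m)}$: $\Theta_fF=0$ if $n\ge1$ and $m=0$; $\Theta_fF=fF$ if $n=m=0$; otherwise $\Theta_fF=\mathbf{\Pi}\big(f[X/M]\cdot\mathbf{\Pi}^{-1}F\big)$. Extend linearly in $f$ and $F$. The notation $|_{t=1}$ means evaluating the coefficients at $t=1$. **The series $\mathcal{A}_s$.** Let $R_s(X)$ be the Rogers–Szegő symmetric functions, which coincide with the row-partition modified Macdonald polynomials $R_s(X)=\widetilde H_{(s)}[X]$ (independent of $t$; $R_0=1$). The symmetric functions $\mathcal{A}_s(X;q)$, $s\ge1$, are defined by the identity of formal power series in $U$ $$\sum_{s\ge1}\mathcal{A}_s(X;q)\frac{U^s}{s!}=(q-1)\log\left(\sum_{s\ge0}R_s(X)\frac{(U/(q-1))^s}{s!}\right).$$ *)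

(* Defs.v *)
From HB Require Import structures.
From mathcomp Require Import all_boot all_order all_algebra.
From mathcomp Require Import finmap.
From mathcomp.multinomials Require Import monalg.

Set Implicit Arguments.
Unset Strict Implicit.
Unset Printing Implicit Defensive.

Import GRing.Theory.

Local Open Scope ring_scope.

(* Q(q,t) is the fraction field of Q(q)[t]. *)
Notation Qq := {fraction {poly rat}}.
Notation Qqt := {fraction {poly Qq}}.

Definition constt (c : Qq) : Qqt := tofrac c%:P.
Definition q_ : Qqt := constt (tofrac 'X).
Definition t_ : Qqt := tofrac 'X.

(* [eval_coef_t1 x y]: x is regular at t = 1, and y is its value there, as an
   element of Q(q) inside Q(q,t). The value does not depend on the chosen
   fraction n / d. *)
Definition eval_coef_t1 (x y : Qqt) : Prop :=
  exists n d : {poly Qq},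
    [/\ d.[1] != 0, x = tofrac n / tofrac d & y = constt (n.[1] / d.[1])].

(* The automorphism t |-> 1/t. The result does not depend on the chosen
   representative, and the denominator is nonzero since 1/t is transcendental
   over Q(q). *)
Definition eval_tV (p : {poly Qq}) : Qqt := (map_poly constt p).[t_^-1].
Definition invt (x : Qqt) : Qqt := eval_tV \n_(repr x) / eval_tV \d_(repr x).

(* Partitions are weakly decreasing lists of positive integers. *)
Definition is_part (la : seq nat) : bool := sorted geq la && (0%N \notin la).

Definition partitions (n : nat) : seq (seq nat) :=
  [seq [seq i <- map val (l : n.-tuple 'I_n.+1) | (0 < i)%N] |
    l : n.-tuple 'I_n.+1 in
      [pred l : n.-tuple 'I_n.+1 |
        sorted geq (map val l) && (sumn (map val l) == n)]].

Definition dominated (la mu : seq nat) : bool :=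
  (sumn la == sumn mu) &&
  [forall k : 'I_(sumn la).+1, (sumn (take k la) <= sumn (take k mu))%N].

(* z_la = prod_i i^(m_i) m_i!, for any listing la of a multiset of parts. *)
Definition zee (la : seq nat) : nat :=
  (\prod_(i <- undup la) (i ^ count_mem i la * (count_mem i la)`!))%N.

(* Row i (counted from 0, at the bottom) has cells j = 0, ..., mu_i - 1; the
   cell (i, j) has coarm j and coleg i. *)
Definition arm (mu : seq nat) (i j : nat) : nat := (nth 0 mu i - j.+1)%N.
Definition leg (mu : seq nat) (i j : nat) : nat :=
  (count (fun r => j < r) mu - i.+1)%N.
Definition nstat (mu : seq nat) : nat :=
  (\sum_(i < size mu) i * nth 0 mu i)%N.
Definition Pi_coef (mu : seq nat) : Qqt :=
  \prod_(i < size mu) \prod_(j < nth 0%N mu i | (i + j != 0)%N)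
    (1 - q_ ^+ j * t_ ^+ i).

(* Over a field of characteristic 0, Lambda is the polynomial algebra in the
   power sums; the variable of index i : nat stands for p_(i+1). *)
Notation Lambda := {malg Qqt[{cmonom nat}]}.

Definition pow (k : nat) : Lambda := << ucm k.-1 >>.

(* The multiset of parts la such that the monomial k is p_la. *)
Definition mparts (k : {cmonom nat}) : seq nat :=
  flatten [seq nseq (k i) i.+1 | i <- finsupp k].

(* The algebra morphism sending p_k to v k. *)
Definition psubst (S : comAlgType Qqt) (v : nat -> S) (f : Lambda) : S :=
  mmap (in_alg S) (fun k : {cmonom nat} => \prod_(i <- mparts k) v i) f.

(* Homogeneous components for the grading deg p_k = k. *)
Definition hcomp (n : nat) (f : Lambda) : Lambda :=
  \sum_(k <- msupp f | sumn (mparts k) == n) << f@_k *g k >>.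
Definition degree (f : Lambda) : nat :=
  (\max_(k <- msupp f) sumn (mparts k))%N.

(* e_n = sum_la (-1)^(n - l(la)) p_la / z_la,  h_n = sum_la p_la / z_la *)
Definition e_ (n : nat) : Lambda :=
  \sum_(la <- partitions n)
    ((-1) ^+ (n - size la) / (zee la)%:R : Qqt) *: \prod_(i <- la) pow i.
Definition h_ (n : nat) : Lambda :=
  \sum_(la <- partitions n) ((zee la)%:R^-1 : Qqt) *: \prod_(i <- la) pow i.
Definition e_part (la : seq nat) : Lambda := \prod_(i <- la) e_ i.

(* Jacobi-Trudi. *)
Definition schur (la : seq nat) : Lambda :=
  \det (\matrix_(i < size la, j < size la)
    (if (i <= nth 0 la i + j)%N then h_ (nth 0 la i + j - i)%N else 0)).

(* f[X/M] and f[X(1-t)] *)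
Definition pleth_divM (f : Lambda) : Lambda :=
  psubst (fun k => ((1 - q_ ^+ k) * (1 - t_ ^+ k))^-1 *: pow k) f.
Definition pleth_1t (f : Lambda) : Lambda :=
  psubst (fun k => (1 - t_ ^+ k) *: pow k) f.

(* f(x_1, ..., x_N) *)
Definition realize (N : nat) (f : Lambda) : {malg Qqt[{cmonom 'I_N}]} :=
  psubst (fun k => \sum_(i < N) << ucm i >> ^+ k) f.

(* The monomial symmetric polynomial m_la(x_1, ..., x_N). *)
Definition msym (N : nat) (la : seq nat) : {malg Qqt[{cmonom 'I_N}]} :=
  \sum_(e : {ffun 'I_N -> 'I_(sumn la).+1} |
      perm_eq [seq i <- [seq val (e j) | j <- enum 'I_N] | (0 < i)%N] la)
    \prod_(j < N) << ucm j >> ^+ e j.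

(* <p_la, p_mu> = delta z_la prod_i (1 - q^(la_i)) / (1 - t^(la_i)) *)
Definition scal_qt (f g : Lambda) : Qqt :=
  \sum_(k <- msupp f) f@_k * g@_k * (zee (mparts k))%:R *
    \prod_(i <- mparts k) ((1 - q_ ^+ i) / (1 - t_ ^+ i)).

(* Macdonald's characterization of the family P_mu(x; q, t): unitriangularity
   in the monomial basis for the dominance order, and orthogonality. *)
Definition is_macdonaldP (P : seq nat -> Lambda) : Prop :=
  (forall mu, is_part mu -> exists c : seq nat -> Qqt, forall N,
    realize N (P mu) = msym N mu +
      \sum_(la <- partitions (sumn mu) | (la != mu) && dominated la mu)
        c la *: msym N la) /\
  (forall la mu, is_part la -> is_part mu -> la != mu ->
    scal_qt (P la) (P mu) = 0).

(* The factor with J_mu = c_mu P_mu. *)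
Definition cJ (mu : seq nat) : Qqt :=
  \prod_(i < size mu) \prod_(j < nth 0%N mu i)
    (1 - q_ ^+ arm mu i j * t_ ^+ (leg mu i j).+1).

(* K la mu = K_(la,mu)(q,t) is defined by
   J_mu = sum_la K_(la,mu)(q,t) s_la[X(1-t)]. *)
Definition is_qtKostka (K : seq nat -> seq nat -> Qqt) : Prop :=
  exists2 P : seq nat -> Lambda, is_macdonaldP P &
    forall mu, is_part mu ->
      cJ mu *: P mu =
        \sum_(la <- partitions (sumn mu)) K la mu *: pleth_1t (schur la).

Definition Htilde (K : seq nat -> seq nat -> Qqt) (mu : seq nat) : Lambda :=
  \sum_(la <- partitions (sumn mu))
    (invt (K la mu) * t_ ^+ nstat mu) *: schur la.

(* Since the H mu form a basis, this determines a linear Pi. *)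
Definition is_Pi (H : seq nat -> Lambda) (Pi : Lambda -> Lambda) : Prop :=
  forall mu, is_part mu -> Pi (H mu) = Pi_coef mu *: H mu.

(* Theta_f F for f and F homogeneous of degrees n and m. *)
Definition Theta_hom (Pi PiV : Lambda -> Lambda) (n m : nat) (f F : Lambda) :
    Lambda :=
  if m == 0%N then (if n == 0%N then f * F else 0)
  else Pi (pleth_divM f * PiV F).

Definition Theta (Pi PiV : Lambda -> Lambda) (f F : Lambda) : Lambda :=
  \sum_(n < (degree f).+1) \sum_(m < (degree F).+1)
    Theta_hom Pi PiV n m (hcomp n f) (hcomp m F).

Definition eval_t1 (F G : Lambda) : Prop :=
  forall k, eval_coef_t1 F@_k G@_k.

(* The coefficient of U^n in log(sum_s f_s U^s), where f_0 = 1: only the powers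
   1 <= k <= n of sum_(s >= 1) f_s U^s, truncated in degree n, contribute. *)
Definition fps_log (f : nat -> Lambda) (n : nat) : Lambda :=
  \sum_(1 <= k < n.+1) ((-1) ^+ k.+1 / k%:R : Qqt) *:
    ((\poly_(s < n.+1) (if s == 0%N then 0 else f s)) ^+ k)`_n.

(* R_s = Htilde_(s), where the partition (0) is the empty one. *)
Definition R_ (H : seq nat -> Lambda) (s : nat) : Lambda :=
  H (if s == 0%N then [::] else [:: s]).

Definition A_ (H : seq nat -> Lambda) (n : nat) : Lambda :=
  ((q_ - 1) * n`!%:R) *:
    fps_log (fun s => ((q_ - 1) ^- s / s`!%:R) *: R_ H s) n.

(* Main.v *)
(* Since Pi fixes p_1, the left-hand side is M^(1-n) Pi(p_1^n) at t = 1, and it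
   is computed by expanding p_1^n in the H_mu and letting t tend to 1.

   The kernel h_la[X (1-t)/(1-q)] is dual to the monomials for the q,t-scalar
   product, so the two characterizing properties of P_mu make P_mu triangular
   in these products as well. Applying t -> 1/t and X -> X/(1-1/t) turns them
   into rho_la = h_la[X/(1-q)], which does not involve t: up to a scalar, H_mu
   is rho_mu plus a combination of the rho_la with la > mu, and the H_mu are
   orthogonal for a form in which p_la has norm
   z_la prod_i (1-q^(la_i)) (1-t^(-la_i)). As rho_mu involves p_la only when
   l(la) >= l(mu), with la = mu in case of equality, the Gram matrix of the
   rho_mu is diagonal to leading order in 1-t, and Gram-Schmidt shows that the
   normalized H_mu tends to rho_mu while its norm is of exact order
   (1-t)^l(mu). The coefficient Pi_mu vanishes to order l(mu) - 1, which
   cancels the remaining poles, and p_1^n contributes an explicit multiple of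
   rho_mu for each mu. Since R_s = (1-q)...(1-q^s) h_s[X/(1-q)], these
   multiples are the terms of the expanded logarithm. *)

Require Import Defs.
From HB Require Import structures.
From mathcomp Require Import all_boot all_order all_algebra.
From mathcomp Require Import finmap.
From mathcomp.multinomials Require Import monalg.
From mathcomp Require Import zify ring.

Set Implicit Arguments.
Unset Strict Implicit.
Unset Printing Implicit Defensive.

Import GRing.Theory.

Local Open Scope ring_scope.

(** * Partitions *)

(** The family [P] is never constructed: every fact on [H] is drawn from the two characterizing
    properties. The direction of the triangularity decides the argument. The monomial expansion of
    P_mu runs over la <= mu, whereas the dual expansion in the [rho la] runs over la >= mu, hence
    over partitions with at most l(mu) parts. Gram-Schmidt thus subtracts from [rho mu] multiples of
    H_la with l(la) <= l(mu): the numerator <rho_mu, H_la> is of order at least l(mu) in 1-t, the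
    norm in the denominator is of order l(la), and no pole arises; when the lengths agree, the
    leading coefficient of the numerator vanishes.

    The scalar in front of H_mu cancels from p_1^n = sum_mu (<p_1^n, H_mu> / <H_mu, H_mu>) H_mu. It
    is needed in closed form only for one row, where H_(s) enters the logarithm; there it comes from
    <h_n, h_n> = (t;q)_n / (q;q)_n for h_n = h_n[X(1-t)/(1-q)], which is the q-binomial theorem.

    The powers of 1-t balance: 1-n from M^(1-n), n from the norm of p_1^n, -l(mu) from that of H_mu,
    and l(mu)-1 from Pi_mu. *)

Lemma geq_trans : transitive geq.
Proof. by move=> y x z /= hxy hyz; apply: leq_trans hyz hxy. Qed.

Lemma geq_total : total geq.
Proof. by move=> x y; rewrite /= orbC leq_total. Qed.

Lemma geq_anti : antisymmetric geq.
Proof. by move=> x y /=; rewrite andbC => /anti_leq. Qed.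

Lemma sorted_geq_perm (la mu : seq nat) :
  sorted geq la -> sorted geq mu -> perm_eq la mu -> la = mu.
Proof. exact: sorted_eq geq_trans geq_anti la mu. Qed.

Lemma size_le_sumn (la : seq nat) : 0%N \notin la -> (size la <= sumn la)%N.
Proof.
elim: la => //= a la IH; rewrite in_cons negb_or eq_sym -lt0n => /andP[a0 /IH].
by move=> h; rewrite -add1n leq_add.
Qed.

Lemma mem_le_sumn (la : seq nat) i : i \in la -> (i <= sumn la)%N.
Proof.
elim: la => //= a la IH; rewrite in_cons => /orP[/eqP->|/IH h].
  exact: leq_addr.
exact: leq_trans h (leq_addl _ _).
Qed.

Lemma sumn_filter_gt0 (s : seq nat) : sumn [seq i <- s | (0 < i)%N] = sumn s.
Proof. by elim: s => //= -[|a] s /= ->. Qed.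

Lemma mem_partitions n la : (la \in partitions n) = is_part la && (sumn la == n).
Proof.
apply/mapP/andP => [[l] | [/andP[sla nla] /eqP sn]].
  rewrite mem_enum inE => /andP[sl /eqP sn] ->; split; last first.
    by rewrite sumn_filter_gt0 sn.
  rewrite /is_part sorted_filter ?mem_filter ?andbF //; exact: geq_trans.
have szn : (size la <= n)%N by rewrite -sn size_le_sumn.
(* The preimage of [la] is [la] padded with zeros to length n; its parts are at most n, so [inord]
   does not truncate them. *)
pose f (i : 'I_n) : 'I_n.+1 := inord (nth 0%N la i).
have E : map val [tuple f i | i < n] = la ++ nseq (n - size la) 0%N.
  apply: (@eq_from_nth _ 0%N).
    by rewrite size_map size_tuple size_cat size_nseq subnKC.
  move=> i; rewrite size_map size_tuple => lt_in.
  rewrite (nth_map ord0) ?size_tuple //.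
  rewrite [nth _ _ _](_ : _ = f (Ordinal lt_in)); last first.
    by rewrite -[i]/(val (Ordinal lt_in)) -tnth_nth tnth_mktuple.
  rewrite /f /= inordK; last first.
    rewrite ltnS -sn; case: (ltnP i (size la)) => h.
      by rewrite mem_le_sumn // mem_nth.
    by rewrite nth_default.
  rewrite nth_cat; case: ltnP => // h.
  by rewrite nth_default // nth_nseq; case: ifP.
have F : [seq i <- map val [tuple f i | i < n] | (0 < i)%N] = la.
  rewrite E filter_cat (@eq_in_filter _ _ predT) ?filter_predT.
    by rewrite filter_nseq cats0.
  by move=> i; case: i => // h; rewrite (negbTE nla) in h.
exists [tuple f i | i < n] => //.
rewrite mem_enum inE -sumn_filter_gt0 F sn eqxx andbT E.
move: sla; case: (la) => [|a l] /=.
  by move=> _; elim: (n - 0)%N => // -[].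
rewrite cat_path => -> /=.
elim: (n - _)%N (last a l) => //= k IH b; exact: IH.
Qed.

(** The number of erased zeros is recovered from the common length, so the enumeration by padded
    tuples has no repetition. *)
Lemma filter_gt0_tuple_inj n (s1 s2 : seq nat) :
  sorted geq s1 -> sorted geq s2 -> size s1 = n -> size s2 = n ->
  [seq i <- s1 | (0 < i)%N] = [seq i <- s2 | (0 < i)%N] -> s1 = s2.
Proof.
move=> so1 so2 z1 z2 E; apply: sorted_geq_perm => //.
apply/permP => p; have cnt s : count p s =
    (count p [seq i <- s | (0 < i)%N] + p 0%N * (size s - size [seq i <- s | (0 < i)%N]))%N.
  elim: s => [|a s IH] //=; first by rewrite muln0.
  rewrite IH; case: a => [|a] /=.
    by rewrite subSn ?mulnS ?size_filter ?count_size // addnCA.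
  by rewrite addnA subSS.
by rewrite (cnt s1) (cnt s2) E z1 z2.
Qed.

Lemma uniq_partitions n : uniq (partitions n).
Proof.
rewrite map_inj_in_uniq ?enum_uniq // => l1 l2.
rewrite !mem_enum !inE => /andP[s1 _] /andP[s2 _] /filter_gt0_tuple_inj E.
by apply/val_inj/(inj_map val_inj)/(E n); rewrite ?size_map ?size_tuple.
Qed.

Lemma is_part_of_mem n la : la \in partitions n -> is_part la.
Proof. by rewrite mem_partitions => /andP[]. Qed.

Lemma sumn_of_mem n la : la \in partitions n -> sumn la = n.
Proof. by rewrite mem_partitions => /andP[_ /eqP]. Qed.

Definition psort (la : seq nat) := sort geq la.

Lemma psort_perm la : perm_eq (psort la) la.
Proof. by rewrite perm_sort. Qed.

Lemma psort_part la : 0%N \notin la -> is_part (psort la).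
Proof.
move=> h; rewrite /is_part mem_sort h andbT; apply: sort_sorted; exact: geq_total.
Qed.

Lemma psort_mem n la : 0%N \notin la -> sumn la = n -> psort la \in partitions n.
Proof.
by move=> h E; rewrite mem_partitions psort_part //= (perm_sumn (psort_perm _)) E.
Qed.

Lemma perm_part la mu : is_part la -> is_part mu -> perm_eq la mu -> la = mu.
Proof. by case/andP=> h1 _ /andP[h2 _]; apply: sorted_geq_perm. Qed.

Lemma perm_partitions_rem n k : (0 < k <= n)%N ->
  perm_eq [seq rem k la | la <- partitions n & k \in la] (partitions (n - k)).
Proof.
case/andP => k0 kn; apply: uniq_perm; rewrite ?uniq_partitions //.
  rewrite map_inj_in_uniq ?filter_uniq ?uniq_partitions // => l1 l2.
  rewrite !mem_filter => /andP[k1 /is_part_of_mem p1] /andP[k2 /is_part_of_mem p2] E.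
  apply: perm_part => //.
  by rewrite (perm_trans (perm_to_rem k1)) // E perm_sym perm_to_rem.
move=> nu; apply/mapP/idP => [[la]|nuP].
  rewrite mem_filter mem_partitions => /andP[kla /andP[/andP[sl zl] /eqP sn]] ->.
  rewrite mem_partitions -andbA; apply/and3P; split.
  - by apply: (subseq_sorted geq_trans _ sl); exact: rem_subseq.
  - by apply: contra zl; apply: mem_rem.
  - by have /perm_sumn/= := perm_to_rem kla; rewrite -sn => ->; rewrite addKn.
have /andP[s z] := is_part_of_mem nuP.
have sn := sumn_of_mem nuP.
exists (psort (k :: nu)).
  rewrite mem_filter (perm_mem (psort_perm _)) mem_head.
  apply: psort_mem => /=; last by rewrite sn subnKC.
  by rewrite in_cons negb_or z andbT eq_sym -lt0n.
apply: sorted_geq_perm => //.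
  apply: (subseq_sorted geq_trans (rem_subseq _ _)).
  apply: sort_sorted; exact: geq_total.
have kk : k \in psort (k :: nu) by rewrite (perm_mem (psort_perm _)) mem_head.
rewrite -(perm_cons k).
by rewrite perm_sym (perm_trans _ (psort_perm _)) // perm_sym perm_to_rem.
Qed.

Lemma perm_zee la mu : perm_eq la mu -> zee la = zee mu.
Proof.
move=> pm; rewrite /zee (perm_big (undup mu)) /=; last exact: perm_undup (perm_mem pm).
by apply: eq_bigr => i _; rewrite (permP pm).
Qed.

Lemma zee_cons k la : zee (k :: la) = (k * (count_mem k la).+1 * zee la)%N.
Proof.
rewrite /zee (perm_big (k :: rem k (undup la))) /=; last first.
  apply: uniq_perm; first exact: (undup_uniq (k :: la)).
    by rewrite /= rem_uniq ?undup_uniq // mem_rem_uniq ?undup_uniq // inE eqxx.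
  move=> i; rewrite -/(undup (k :: la)) mem_undup !in_cons.
  by rewrite mem_rem_uniq ?undup_uniq // !inE mem_undup; case: (i == k).
rewrite big_cons eqxx add1n.
rewrite (@eq_big_seq _ _ _ _ _ _ (fun i => i ^ count_mem i la * (count_mem i la)`!)%N).
  2: by move=> i; rewrite mem_rem_uniq ?undup_uniq // inE eq_sym => /andP[/negbTE-> _].
set X := (\prod_(i <- rem _ _) _)%N.
have [kl|kl] := boolP (k \in la).
  have ku : k \in undup la by rewrite mem_undup.
  rewrite (perm_big _ (perm_to_rem ku)) /=.
  by rewrite big_cons -/X expnS factS; nia.
have /count_memPn-> := kl; rewrite /= expn1 muln1.
rewrite /X rem_id ?mem_undup //; ring.
Qed.

Lemma zee_gt0 la : 0%N \notin la -> (0 < zee la)%N.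
Proof.
elim: la => [|k la IH]; first by rewrite /zee big_nil.
rewrite in_cons negb_or eq_sym -lt0n => /andP[k0 /IH h].
by rewrite zee_cons !muln_gt0 k0 h.
Qed.

Lemma sumn_count n la : 0%N \notin la -> (sumn la <= n)%N ->
  sumn la = (\sum_(1 <= k < n.+1) k * count_mem k la)%N.
Proof.
elim: la => [|a la IH] /=; first by rewrite big1 // => i _; rewrite muln0.
rewrite in_cons negb_or eq_sym -lt0n => /andP[a0 zla] h.
rewrite IH ?(leq_trans (leq_addl _ _) h) //.
under [RHS]eq_bigr do rewrite mulnDr.
rewrite big_split /=; congr (_ + _)%N.
rewrite (bigD1_seq a) ?iota_uniq //=; last first.
  by rewrite mem_index_iota a0 ltnS (leq_trans (leq_addr _ _) h).
rewrite eqxx muln1 big1 ?addn0 // => i; rewrite eq_sym => /negbTE->.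
by rewrite muln0.
Qed.

Section PartSum.
Variables (F : fieldType) (V : lmodType F).

Definition psum (n : nat) (f : seq nat -> V) : V :=
  \sum_(la <- partitions n) (zee la)%:R^-1 *: f la.

(** Weight the term of la by n = sum_k k m_k(la): each k m_k(la) / z_la is 1 / z of the partition
    with one k removed. This recursion gives Newton's identities, the powers of a series and the
    q-binomial theorem below. *)
Lemma psum_newton (natF : forall n, n.+1%:R != 0 :> F) n (f : seq nat -> V) :
  (forall la mu, perm_eq la mu -> f la = f mu) ->
  n%:R *: psum n f =
    \sum_(1 <= k < n.+1) psum (n - k) (fun nu => f (k :: nu)).
Proof.
move=> fP.
have E k : (0 < k <= n)%N -> psum (n - k) (fun nu => f (k :: nu)) =
    \sum_(la <- partitions n)
      (k * count_mem k la)%:R *: ((zee la)%:R^-1 *: f la).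
  move=> hk; rewrite /psum -(perm_big _ (perm_partitions_rem hk)) big_map.
  rewrite big_filter [RHS](bigID (fun la => k \in la)) /= [X in _ + X]big1 ?addr0.
    2: by move=> la /count_memPn ->; rewrite muln0 scale0r.
  rewrite big_seq_cond [RHS]big_seq_cond; apply: eq_bigr => la /andP[laP kla].
  have z0 : 0%N \notin la by have /andP[] := is_part_of_mem laP.
  have pm := perm_to_rem kla.
  rewrite (fP _ _ pm) scalerA (perm_zee pm) zee_cons (permP pm) /= eqxx add1n.
  congr (_ *: _).
  have zr : 0%N \notin rem k la by apply: contra z0; apply: mem_rem.
  have := zee_gt0 zr; case: (zee _) => // z _.
  set c := (k * _)%N; have : (0 < c)%N by rewrite muln_gt0; case/andP: hk => ->.
  case: c => // c _; rewrite natrM invfM mulrA divff ?mul1r //.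
rewrite (@eq_big_nat _ _ _ _ _ _ (fun k => \sum_(la <- partitions n)
      (k * count_mem k la)%:R *: ((zee la)%:R^-1 *: f la))) => [|k hk].
  rewrite exchange_big /= scaler_sumr; apply: eq_big_seq => la laP.
  rewrite -scaler_suml -natr_sum -{1}(sumn_of_mem laP) (@sumn_count n) //.
    by have /andP[] := is_part_of_mem laP.
  by rewrite (sumn_of_mem laP).
exact: E.
Qed.

Lemma psum0 (f : seq nat -> V) : psum 0 f = f [::].
Proof.
rewrite /psum (perm_big [:: [::]]) /=.
  by rewrite big_seq1 /zee big_nil invr1 scale1r.
apply: uniq_perm => // [|la]; first exact: uniq_partitions.
rewrite mem_partitions inE; apply/andP/eqP => [[/andP[_ z] /eqP s] | -> //].
by have := size_le_sumn z; rewrite s leqn0 size_eq0 => /eqP.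
Qed.

End PartSum.

(** * Power sum monomials *)

Definition pmon (la : seq nat) : {cmonom nat} :=
  \big[mmul/mone]_(i <- la) ucm i.-1.

Lemma count_mparts (m : {cmonom nat}) j :
  count_mem j (mparts m) = if (0 < j)%N then m j.-1 else 0%N.
Proof.
rewrite /mparts count_flatten -map_comp sumnE big_map.
under eq_bigr => i _ do rewrite /= count_nseq /=.
case: j => [|j] /=; first by rewrite big1.
under eq_bigr => i _ do rewrite eqSS.
case: (mdomP m j) => [jm|jm].
  rewrite (bigD1_seq j) //= ?fset_uniq // eqxx mul1n big1 ?addn0 //.
  by move=> i /negbTE->.
rewrite big_seq big1 // => i im; case: eqP => // ij; by rewrite -ij im in jm.
Qed.

Lemma mparts_neq0 m : 0%N \notin mparts m.
Proof. by apply/count_memPn; rewrite count_mparts. Qed.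

Lemma pmonE la i : pmon la i = count (fun j => j.-1 == i) la.
Proof.
elim: la => [|k la IH]; first by rewrite /pmon big_nil cm1.
by rewrite /pmon big_cons cmM -/(pmon la) IH cmU.
Qed.

Lemma mparts_pmon la : 0%N \notin la -> perm_eq (mparts (pmon la)) la.
Proof.
move=> z; apply/allP => j _ /=; rewrite count_mparts; apply/eqP.
case: j => [|j] /=; first by move/count_memPn: z ->.
rewrite pmonE; apply: eq_in_count => -[|i] //= hi.
by rewrite hi in z.
Qed.

Lemma pmon_mparts m : pmon (mparts m) = m.
Proof.
apply/eqP/cmP => i; rewrite pmonE -[in RHS](_ : i.+1.-1 = i) //.
rewrite -[RHS](count_mparts m i.+1); apply: eq_in_count => -[|j] //=.
by rewrite (negbTE (mparts_neq0 m)).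
Qed.

Lemma perm_pmon la mu : perm_eq la mu -> pmon la = pmon mu.
Proof. by move=> h; apply/perm_big. Qed.

Lemma pmon_inj la mu : 0%N \notin la -> 0%N \notin mu ->
  pmon la = pmon mu -> perm_eq la mu.
Proof.
move=> h1 h2 E; rewrite (perm_trans _ (mparts_pmon h2)) // -E perm_sym.
exact: mparts_pmon.
Qed.

Lemma pmon_cons k la : pmon (k :: la) = mmul (ucm k.-1) (pmon la).
Proof. by rewrite /pmon big_cons. Qed.

Lemma mpartsM m1 m2 : perm_eq (mparts (mmul m1 m2)) (mparts m1 ++ mparts m2).
Proof.
apply/allP => j _ /=; rewrite count_cat !count_mparts cmM.
by case: j.
Qed.

Lemma mparts1 : mparts mone = [::].
Proof. by rewrite /mparts mdom1 (size0nil (cardfs0 _)). Qed.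

Section Eval.
Variables (S : comRingType) (v : nat -> S).

Definition evalmon (m : {cmonom nat}) : S := \prod_(i <- mparts m) v i.

Lemma evalmon_mmorphism : mmorphism evalmon.
Proof.
split=> [m1 m2|]; last by rewrite /evalmon mparts1 big_nil.
by rewrite /evalmon (perm_big _ (mpartsM m1 m2)) big_cat.
Qed.

HB.instance Definition _ :=
  isMultiplicative.Build {cmonom nat} S evalmon evalmon_mmorphism.

Lemma evalmon_pmon la : 0%N \notin la -> evalmon (pmon la) = \prod_(i <- la) v i.
Proof. by move=> z; rewrite /evalmon (perm_big _ (mparts_pmon z)). Qed.

Variables (R : comRingType) (f : {rmorphism R -> S}).

Definition evalp : {malg R[{cmonom nat}]} -> S := mmap f evalmon.

HB.instance Definition _ := GRing.RMorphism.copy evalp (mmap f evalmon).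

Lemma evalpZ c x : evalp (c *: x) = f c * evalp x.
Proof. exact: mmapZ. Qed.

Lemma evalp_pmon la : 0%N \notin la -> evalp << pmon la >> = \prod_(i <- la) v i.
Proof. by move=> z; rewrite /evalp mmapU /= rmorph1 mul1r evalmon_pmon. Qed.

End Eval.

Lemma cmalgU1M (K : conomType) (R : comRingType) (k1 k2 : K) :
  << k1 >> * << k2 >> = << mmul k1 k2 >> :> {malg R[K]}.
Proof. by apply: (etrans (fgmulUU _ _ _ _)); rewrite mulr1. Qed.

Lemma cmul_malgC (K : conomType) (R : comRingType) c (g : {malg R[K]}) :
  c%:MP * g = c *: g.
Proof. exact: mul_malgC. Qed.

Definition ppow (R : comRingType) (k : nat) : {malg R[{cmonom nat}]} := << ucm k.-1 >>.
Arguments ppow {R} k.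

Lemma ppow_prod (R : comRingType) la :
  \prod_(i <- la) ppow i = << pmon la >> :> {malg R[{cmonom nat}]}.
Proof.
elim: la => [|k la IH]; first by rewrite big_nil /pmon big_nil.
by rewrite big_cons IH pmon_cons; exact: cmalgU1M.
Qed.

Lemma malgUZ (K : choiceType) (R : ringType) (c : R) (k : K) :
  << c *g k >> = c *: << k >> :> {malg R[K]}.
Proof. by apply/malgP => j; rewrite mcoeffZ !mcoeffU mulrnAr mulr1. Qed.

(** * Rational functions at t = 1 and under t -> 1/t *)

Section EvalAtOne.
Variable F : fieldType.
Implicit Types (x y : {fraction {poly F}}) (a b c : F).

Local Notation cst := (fun c : F => tofrac c%:P : {fraction {poly F}}).

Definition ev1 x c : Prop :=
  exists n d : {poly F},
    [/\ d.[1] != 0, x = tofrac n / tofrac d & c = n.[1] / d.[1]].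

Lemma horner1_neq0 (d : {poly F}) : d.[1] != 0 -> tofrac d != 0.
Proof. by rewrite tofrac_eq0; apply: contraNneq => ->; rewrite horner0. Qed.

Lemma ev1_tofrac n : ev1 (tofrac n) n.[1].
Proof. by exists n, 1; rewrite hornerC oner_neq0 tofrac1 !divr1. Qed.

Lemma ev1_cst c : ev1 (cst c) c.
Proof. by have := ev1_tofrac c%:P; rewrite hornerC. Qed.

Lemma ev1D x y a b : ev1 x a -> ev1 y b -> ev1 (x + y) (a + b).
Proof.
move=> [n [d [d0 -> ->]]] [n' [d' [d0' -> ->]]].
exists (n * d' + n' * d), (d * d').
rewrite !(hornerM, hornerD) mulf_neq0 // !tofracD !tofracM; split=> //.
  by rewrite addf_div ?horner1_neq0.
by rewrite addf_div.
Qed.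

Lemma ev1M x y a b : ev1 x a -> ev1 y b -> ev1 (x * y) (a * b).
Proof.
move=> [n [d [d0 -> ->]]] [n' [d' [d0' -> ->]]].
exists (n * n'), (d * d').
rewrite !hornerM mulf_neq0 // !tofracM; split=> //; by rewrite mulf_div.
Qed.

Lemma ev1V x a : a != 0 -> ev1 x a -> ev1 x^-1 a^-1.
Proof.
move=> a0 [n [d [d0 -> ea]]]; exists d, n; split; last by rewrite ea invf_div.
  by apply: contraNneq a0 => n0; rewrite ea n0 mul0r.
by rewrite invf_div.
Qed.

Lemma ev1_1 : ev1 1 1.
Proof. by have := ev1_cst 1; rewrite tofrac1. Qed.

Lemma ev1N x a : ev1 x a -> ev1 (- x) (- a).
Proof.
by move=> h; have := ev1M (ev1_cst (- 1)) h; rewrite polyCN tofracN tofrac1 !mulN1r.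
Qed.

Lemma ev1_unique x a b : ev1 x a -> ev1 x b -> a = b.
Proof.
move=> [n [d [d0 -> ->]]] [n' [d' [d0' /eqP + ->]]].
rewrite eqr_div ?horner1_neq0 // -!tofracM tofrac_eq => /eqP E.
by apply/eqP; rewrite eqr_div // -!hornerM E.
Qed.

End EvalAtOne.

Section Inversion.
Variable F : fieldType.

Local Notation K := {fraction {poly F}}.

Definition cstf (c : F) : K := tofrac c%:P.

HB.instance Definition _ := GRing.RMorphism.copy cstf (@FracField.tofrac {poly F} \o polyC).

Definition evalV (p : {poly F}) : K := (map_poly cstf p).[(tofrac 'X)^-1].

Lemma evalV_is_zmod_morphism : zmod_morphism evalV.
Proof. by move=> p r; rewrite /evalV rmorphB hornerD hornerN. Qed.

Lemma evalV_is_monoid_morphism : monoid_morphism evalV.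
Proof.
by split=> [|p r]; rewrite /evalV ?rmorph1 ?hornerC // rmorphM hornerM.
Qed.

HB.instance Definition _ := GRing.isZmodMorphism.Build {poly F} K evalV evalV_is_zmod_morphism.
HB.instance Definition _ := GRing.isMonoidMorphism.Build {poly F} K evalV evalV_is_monoid_morphism.

Lemma tofracX_neq0 : tofrac 'X != 0 :> K.
Proof. by rewrite tofrac_eq0 polyX_eq0. Qed.

Lemma evalVX : evalV 'X = (tofrac 'X)^-1.
Proof. by rewrite /evalV map_polyX hornerX. Qed.

Lemma evalVC c : evalV c%:P = cstf c.
Proof. by rewrite /evalV map_polyC hornerC. Qed.

(* Multiplying by [t ^ deg p] turns [p (1/t)] into the reversed polynomial,
   whose constant coefficient is the leading coefficient of [p]. *)
Lemma evalV_eq0 p : (evalV p == 0) = (p == 0).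
Proof.
apply/idP/eqP => [h|->]; last by rewrite rmorph0.
apply/eqP; rewrite -size_poly_eq0; apply/eqP.
case E : (size p) => [|d] //; exfalso.
have : evalV p * tofrac 'X ^+ d = tofrac (\poly_(i < d.+1) p`_(d - i)).
  rewrite /evalV horner_coef size_map_poly E mulr_suml.
  rewrite poly_def rmorph_sum /= (reindex_inj rev_ord_inj) /=; apply: eq_bigr => i _.
  rewrite coef_map subSS -mul_polyC rmorphM rmorphXn /= -mulrA; congr (_ * _).
  rewrite exprVn.
  have id : (i <= d)%N by rewrite -ltnS.
  have X0 := tofracX_neq0.
  apply: (mulfI (expf_neq0 (d - i)%N X0)).
  by rewrite mulrA mulfV ?expf_neq0 // mul1r -exprD subnK.
rewrite (eqP h) mul0r => /esym/eqP; rewrite tofrac_eq0 => /eqP/polyP/(_ 0%N).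
rewrite coef_poly coef0 subn0 /= => /eqP.
by rewrite -[d]/(d.+1.-1) -E -lead_coefE lead_coef_eq0 -size_poly_eq0 E.
Qed.

Definition inversion (x : K) : K := evalV \n_(repr x) / evalV \d_(repr x).

Lemma fracE (x : K) : x = tofrac \n_(repr x) / tofrac \d_(repr x).
Proof.
have d0 := denom_ratioP (repr x).
rewrite -[LHS]reprK; apply: (mulIf (x := tofrac \d_(repr x))); rewrite ?tofrac_eq0 //.
rewrite divfK ?tofrac_eq0 //; apply/eqP; rewrite piE /FracField.equivf.
rewrite /FracField.mulf !numden_Ratio ?mulf_neq0 ?oner_eq0 //.
by rewrite !mulr1 mulrC.
Qed.

(** [repr] picks an unspecified fraction; cross-multiplication shows that any other one gives the
    same value, as [evalV] kills no nonzero denominator. *)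
Lemma inversion_frac n d : d != 0 -> inversion (tofrac n / tofrac d) = evalV n / evalV d.
Proof.
move=> d0; rewrite /inversion; set x := tofrac n / tofrac d.
have d0' := denom_ratioP (repr x).
have /eqP := fracE x; rewrite {1}/x eqr_div ?tofrac_eq0 // -!tofracM tofrac_eq => /eqP E.
by apply/eqP; rewrite eqr_div ?evalV_eq0 // -!rmorphM -E.
Qed.

Lemma inversion_is_zmod_morphism : zmod_morphism inversion.
Proof.
move=> x y; rewrite [x]fracE [y]fracE.
set n := \n_(repr x); set d := \d_(repr x); set n' := \n_(repr y); set d' := \d_(repr y).
have d0 : d != 0 by exact: denom_ratioP.
have d0' : d' != 0 by exact: denom_ratioP.
rewrite -mulNr addf_div ?tofrac_eq0 // -tofracN -!tofracM -tofracD.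
rewrite !inversion_frac ?mulf_neq0 // -mulNr addf_div ?evalV_eq0 //.
by rewrite rmorphD !rmorphM rmorphN.
Qed.

Lemma inversion_is_monoid_morphism : monoid_morphism inversion.
Proof.
split=> [|x y].
  have := inversion_frac 1 (oner_neq0 {poly F}).
  by rewrite tofrac1 divr1 rmorph1 divr1.
rewrite [x]fracE [y]fracE.
set n := \n_(repr x); set d := \d_(repr x); set n' := \n_(repr y); set d' := \d_(repr y).
have d0 : d != 0 by exact: denom_ratioP.
have d0' : d' != 0 by exact: denom_ratioP.
by rewrite mulf_div -!tofracM !inversion_frac ?mulf_neq0 // mulf_div !rmorphM.
Qed.

HB.instance Definition _ := GRing.isZmodMorphism.Build K K inversion inversion_is_zmod_morphism.
HB.instance Definition _ := GRing.isMonoidMorphism.Build K K inversion inversion_is_monoid_morphism.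

Lemma inversion_tofrac p : inversion (tofrac p) = evalV p.
Proof. by have := inversion_frac p (oner_neq0 _); rewrite tofrac1 rmorph1 !divr1. Qed.

Lemma inversion_cst c : inversion (cstf c) = cstf c.
Proof. by rewrite inversion_tofrac evalVC. Qed.

Lemma inversionX : inversion (tofrac 'X) = (tofrac 'X)^-1.
Proof. by rewrite inversion_tofrac evalVX. Qed.

End Inversion.

(** * Weighted complete symmetric functions *)

(* An algebra with a basis of products of generators p_k: [coef la f] is the
   coefficient of p_la in f, and [der k] is the derivation d/dp_k. *)
Record psalgebra (K : fieldType) (L : comAlgType K) := PSAlgebra {
  psum_gen : nat -> L;
  coef : seq nat -> L -> K;
  der : nat -> L -> L;
  natr_neq0 : forall n, n.+1%:R != 0 :> K;
  coef_linear : forall la, linear_for *%R (coef la);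
  coef_mon : forall la mu, 0%N \notin la -> 0%N \notin mu ->
    coef la (\prod_(i <- mu) psum_gen i) = (perm_eq la mu)%:R;
  mon_ind : forall P : L -> Prop, P 0 ->
    (forall f g, P f -> P g -> P (f + g)) ->
    (forall c la, 0%N \notin la -> P (c *: \prod_(i <- la) psum_gen i)) ->
    forall f, P f;
  der_linear : forall k, linear (der k);
  coef_der : forall k la f, (0 < k)%N -> 0%N \notin la ->
    coef la (der k f) = (count_mem k la).+1%:R * coef (k :: la) f
}.

Section PSTheory.
Variables (K : fieldType) (L : comAlgType K) (A : psalgebra L).
Implicit Types (f g : L) (la mu : seq nat) (w : nat -> K).

Definition psum_mon la : L := \prod_(i <- la) psum_gen A i.
Notation pmn := psum_mon.
Notation co := (coef A).

HB.instance Definition _ la :=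
  GRing.isLinear.Build K L K *%R (coef A la) (coef_linear A la).
HB.instance Definition _ k :=
  GRing.isLinear.Build K L L *:%R (der A k) (der_linear A k).

Lemma coZ la c f : co la (c *: f) = c * co la f.
Proof. exact: (linearZ_LR (coef A la)). Qed.

Lemma derZ k c f : der A k (c *: f) = c *: der A k f.
Proof. exact: (linearZ_LR (der A k)). Qed.

Lemma co_pmn la mu : 0%N \notin la -> 0%N \notin mu ->
  co la (pmn mu) = (perm_eq la mu)%:R.
Proof. exact: coef_mon. Qed.

Lemma pmn_ind (P : L -> Prop) : P 0 ->
    (forall f g, P f -> P g -> P (f + g)) ->
    (forall c la, 0%N \notin la -> P (c *: pmn la)) ->
    forall f, P f.
Proof. exact: mon_ind. Qed.

Lemma pmn_cons k la : pmn (k :: la) = psum_gen A k * pmn la.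
Proof. by rewrite /pmn big_cons. Qed.

Lemma pmn_cat la mu : pmn (la ++ mu) = pmn la * pmn mu.
Proof. by rewrite /pmn big_cat. Qed.

Lemma perm_pmn la mu : perm_eq la mu -> pmn la = pmn mu.
Proof. exact: perm_big. Qed.

Lemma perm_co la mu f : 0%N \notin la -> perm_eq la mu -> co la f = co mu f.
Proof.
move=> z pm; have z' : 0%N \notin mu by rewrite -(perm_mem pm).
elim/pmn_ind: f => [|f g hf hg|c nu zn]; first by rewrite !linear0.
  by rewrite !linearD /= hf hg.
by rewrite !coZ !co_pmn // (permPl pm).
Qed.

Lemma co_expand (h : L) : exists s,
  [/\ uniq s, all is_part s & h = \sum_(la <- s) co la h *: pmn la].
Proof.
elim/pmn_ind: h => [|a b [s [us ps Ea]] [s' [us' ps' Eb]]|c la z].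
  - by exists [::]; rewrite big_nil.
  - have ext (x : L) r r' : uniq r -> uniq r' -> {subset r <= r'} -> all is_part r' ->
        x = \sum_(la <- r) co la x *: pmn la -> x = \sum_(la <- r') co la x *: pmn la.
      move=> ur ur' sub pr' Ex; rewrite (bigID (fun la => la \in r)) /=.
      rewrite [X in _ + X]big_seq_cond [X in _ + X]big1 ?addr0 => [|la /andP[lar' lar]].
        rewrite -big_filter (perm_big r) //=; apply: uniq_perm; rewrite ?filter_uniq //.
        move=> la; rewrite mem_filter; case lar: (la \in r) => //=; exact: sub.
      suff -> : co la x = 0 by rewrite scale0r.
      rewrite {1}Ex linear_sum /= big_seq big1 // => mu mur.
      have pl := allP pr' _ lar'; have pm := allP pr' _ (sub _ mur).
      have [/andP[_ zl] /andP[_ zm]] := (pl, pm).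
      rewrite coZ co_pmn //.
      have [El|ne] := eqVneq la mu; first by rewrite El mur in lar.
      suff -> : perm_eq la mu = false by rewrite mulr0.
      by apply: contraNF ne => /(perm_part pl pm) ->.
    exists (undup (s ++ s')); split; first exact: undup_uniq.
      by apply/allP => la; rewrite mem_undup mem_cat => /orP[/(allP ps)|/(allP ps')].
    have pu : all is_part (undup (s ++ s')).
      by apply/allP => la; rewrite mem_undup mem_cat => /orP[/(allP ps)|/(allP ps')].
    rewrite {1}(ext a s (undup (s ++ s'))) ?undup_uniq //; last first.
      by move=> la h; rewrite mem_undup mem_cat h.
    rewrite {1}(ext b s' (undup (s ++ s'))) ?undup_uniq //; last first.
      by move=> la h; rewrite mem_undup mem_cat h orbT.
    rewrite -big_split /=; apply: eq_bigr => la _.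
    by rewrite linearD /= scalerDl.
  exists [:: psort la]; split => //=; first by rewrite psort_part.
  have zp : 0%N \notin psort la by rewrite (perm_mem (psort_perm _)).
  rewrite big_seq1 coZ co_pmn // psort_perm mulr1.
  by rewrite (perm_pmn (psort_perm la)).
Qed.

Lemma co_eq f g : (forall la, is_part la -> co la f = co la g) -> f = g.
Proof.
move=> H; apply/eqP; rewrite -subr_eq0; apply/eqP.
have {}H la : 0%N \notin la -> co la (f - g) = 0.
  move=> z; rewrite (perm_co _ z (mu := psort la)) 1?perm_sym ?psort_perm //.
  by rewrite linearB /= H ?subrr //; exact: psort_part.
have [s [us ps ->]] := co_expand (f - g).
rewrite big_seq big1 // => la las.
by rewrite H ?scale0r //; have /andP[] := allP ps _ las.
Qed.

(** The interface describes [der] by coefficients only. This determines it on monomials as m_k(la)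
    times p_la with one k removed, and the Leibniz rule follows by bilinearity from m_k(la ++ mu) =
    m_k(la) + m_k(mu). *)
Lemma derM k f g : (0 < k)%N -> der A k (f * g) = der A k f * g + f * der A k g.
Proof.
move=> k0; have derU la : 0%N \notin la ->
    der A k (pmn la) = (count_mem k la)%:R *: pmn (rem k la).
  move=> z; apply: co_eq => mu /andP[_ zm].
  rewrite coef_der // coZ !co_pmn ?in_cons ?negb_or ?zm ?andbT -?lt0n //.
  - case: (boolP (k \in la)) => kla; last first.
      rewrite (count_memPn kla) mul0r; case E : (perm_eq _ _); rewrite ?mulr0 //.
      by move: kla; rewrite -(perm_mem E) mem_head.
    rewrite (permPr (perm_to_rem kla)) perm_cons.
    case E : (perm_eq _ _); rewrite ?mulr0 // !mulr1.
    by rewrite (permP E) (permP (perm_to_rem kla)) /= eqxx add1n.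
  - by apply: contra z; apply: mem_rem.
  - by rewrite eq_sym -lt0n k0.
elim/pmn_ind: f => [|f1 f2 h1 h2|c la zl].
- by rewrite mul0r !linear0 !mul0r addr0.
- by rewrite mulrDl !linearD /= h1 h2 !mulrDl addrACA.
elim/pmn_ind: g => [|g1 g2 h1 h2|d mu zm].
- by rewrite mulr0 !linear0 !mulr0 addr0.
- by rewrite mulrDr !linearD /= h1 h2 !mulrDr addrACA.
rewrite -scalerAl -scalerAr -pmn_cat !derZ !derU ?mem_cat ?negb_or ?zl //.
rewrite count_cat natrD -!scalerAl -!scalerAr !scalerDl !scalerDr -!pmn_cat.
(* If k occurs in [a], removing it from [a ++ b] may be done inside [a], up to order; if not, both
   coefficients are 0. *)
have H (a b : seq nat) : (count_mem k a)%:R *: pmn (rem k (a ++ b)) =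
     (count_mem k a)%:R *: pmn (rem k a ++ b).
  case: (boolP (k \in a)) => ka; last by rewrite (count_memPn ka) !scale0r.
  congr (_ *: _); apply: perm_pmn; rewrite -(perm_cons k) -cat_cons.
  rewrite perm_sym (perm_trans _ (perm_to_rem _)) ?mem_cat ?ka //.
  by rewrite perm_cat2r perm_sym perm_to_rem.
rewrite [(count_mem k la)%:R *: (d *: _)]scalerA [_ * d]mulrC -[(d * _) *: _]scalerA -(H la mu).
congr (_ + c *: (d *: _)).
have pC (x y : seq nat) : perm_eq (x ++ y) (y ++ x) by rewrite perm_catC.
rewrite (perm_pmn (pC la (rem k mu))) -H; congr (_ *: _); apply: perm_pmn.
have [kin|kin] := boolP (k \in la ++ mu); last first.
  have kin' : k \notin mu ++ la by rewrite mem_cat orbC -mem_cat.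
  by rewrite !rem_id.
have kin' : k \in mu ++ la by rewrite mem_cat orbC -mem_cat.
rewrite -(perm_cons k) perm_sym (perm_trans _ (perm_to_rem kin)) //.
by rewrite perm_sym (perm_trans _ (perm_to_rem kin')).
Qed.

Lemma der1 k : (0 < k)%N -> der A k 1 = 0.
Proof.
move=> k0; have := derM 1 1 k0; rewrite !mul1r mulr1 => /eqP.
by rewrite -subr_eq0 opprD addNKr oppr_eq0 => /eqP.
Qed.

Lemma der_prod (I : eqType) (r : seq I) (F : I -> L) k : (0 < k)%N -> uniq r ->
  der A k (\prod_(i <- r) F i) =
  \sum_(j <- r) \prod_(i <- r) (if i == j then der A k (F i) else F i).
Proof.
move=> k0; elim: r => [|a r IH] /=; first by rewrite !big_nil der1.
case/andP=> ar ur; rewrite !big_cons derM // IH // eqxx.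
have ne i : i \in r -> (i == a) = false by move=> ir; apply: contraNF ar => /eqP<-.
congr (_ + _); first by congr (_ * _); apply: eq_big_seq => i /ne ->.
rewrite mulr_sumr; apply: eq_big_seq => j jr; rewrite big_cons.
by rewrite eq_sym ne.
Qed.

End PSTheory.

Section Weighted.
Variables (K : fieldType) (L : comAlgType K) (A : psalgebra L).
Implicit Types (f g : L) (la mu : seq nat).
Notation co := (coef A).
Notation pmn := (psum_mon A).

Lemma coD la f g : co la (f + g) = co la f + co la g.
Proof. exact: linearD. Qed.

Lemma coB la f g : co la (f - g) = co la f - co la g.
Proof. exact: linearB. Qed.

Lemma co0 la : co la 0 = 0.
Proof. exact: linear0. Qed.

Lemma co_sum la (I : Type) (r : seq I) (P : pred I) (F : I -> L) :
  co la (\sum_(i <- r | P i) F i) = \sum_(i <- r | P i) co la (F i).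
Proof. exact: (linear_sum (coef A la)). Qed.

Lemma natr_eq0 n : (n%:R == 0 :> K) = (n == 0%N).
Proof. by case: n => [|n]; rewrite ?eqxx // (negbTE (natr_neq0 A n)). Qed.

Lemma coM_neq0 m f g : 0%N \notin m -> co m (f * g) != 0 ->
  exists m1 m2 : seq nat, [/\ 0%N \notin m1, 0%N \notin m2, co m1 f != 0, co m2 g != 0
    & perm_eq m (m1 ++ m2)].
Proof.
move=> zm; have [s [us ps Ef]] := co_expand A f.
have [s' [us' ps' Eg]] := co_expand A g.
case: (boolP (has (fun m1 => has (fun m2 => [&& co m1 f != 0, co m2 g != 0 &
   perm_eq m (m1 ++ m2)]) s') s)) => [/hasP[m1 m1s /hasP[m2 m2s /and3P[h1 h2 h3]]] _|/hasPn H].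
  have /andP[_ z1] := allP ps _ m1s; have /andP[_ z2] := allP ps' _ m2s.
  by exists m1, m2.
rewrite {1}Ef {1}Eg mulr_suml co_sum big_seq big1 ?eqxx // => m1 m1s.
have z1 : 0%N \notin m1 by have /andP[] := allP ps _ m1s.
rewrite mulr_sumr co_sum big_seq big1 // => m2 m2s.
have z2 : 0%N \notin m2 by have /andP[] := allP ps' _ m2s.
have /hasPn/(_ m2 m2s) := H _ m1s; rewrite !negb_and !negbK => h.
have z12 : 0%N \notin m1 ++ m2 by rewrite mem_cat negb_or z1.
rewrite -scalerAl -scalerAr -pmn_cat !coZ co_pmn //.
by case/or3P: h => [/eqP->|/eqP->|/negbTE->]; rewrite !(mulr0, mul0r).
Qed.

Lemma co_pcons k la f : (0 < k)%N -> 0%N \notin la ->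
  co (k :: la) (psum_gen A k * f) = co la f.
Proof.
move=> k0 zl; elim/(pmn_ind (A := A)): f => [|f g hf hg|c mu zm].
- by rewrite mulr0 !co0.
- by rewrite mulrDr !coD hf hg.
rewrite -scalerAr -pmn_cons !coZ !co_pmn ?perm_cons ?in_cons ?negb_or ?zl ?zm ?andbT //.
- by rewrite eq_sym -lt0n.
- by rewrite eq_sym -lt0n.
Qed.

Variable w : nat -> K.

(* With w k = (1 - t^k)/(1 - q^k), [hw n] is h_n[X (1-t)/(1-q)]. *)
Definition wt la : K := \prod_(i <- la) w i.
Definition hw n : L := psum n (fun la => wt la *: pmn la).
Definition hwp la : L := \prod_(i <- la) hw i.

Lemma wt_cons k la : wt (k :: la) = w k * wt la.
Proof. by rewrite /wt big_cons. Qed.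

Lemma perm_wt la mu : perm_eq la mu -> wt la = wt mu.
Proof. exact: perm_big. Qed.

Lemma hwp_cons k la : hwp (k :: la) = hw k * hwp la.
Proof. by rewrite /hwp big_cons. Qed.

Lemma perm_hwp la mu : perm_eq la mu -> hwp la = hwp mu.
Proof. exact: perm_big. Qed.

Lemma hw0 : hw 0 = 1.
Proof. by rewrite /hw psum0 /wt /pmn !big_nil scale1r. Qed.

Lemma hw_newton n :
  n%:R *: hw n = \sum_(1 <= k < n.+1) w k *: (psum_gen A k * hw (n - k)).
Proof.
rewrite /hw psum_newton; last 1 [exact: natr_neq0 A|]; last first.
  by move=> la mu pm; rewrite (perm_wt pm) (perm_pmn A pm).
apply: eq_bigr => k _; rewrite /psum mulr_sumr scaler_sumr; apply: eq_bigr => la _.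
by rewrite wt_cons pmn_cons -!scalerAr !scalerA !mulrA [w k * _]mulrC.
Qed.

Lemma co_hw la n : 0%N \notin la ->
  co la (hw n) = if sumn la == n then wt la / (zee la)%:R else 0.
Proof.
move=> z; rewrite /hw /psum co_sum.
have pp := psort_perm la.
have Eco nu : nu \in partitions n ->
    co la ((zee nu)%:R^-1 *: (wt nu *: pmn nu)) =
    if nu == psort la then wt la / (zee la)%:R else 0.
  move=> nuP; have pn := is_part_of_mem nuP; have /andP[_ zn] := pn.
  rewrite !coZ co_pmn //; case: eqP => [->|ne].
    by rewrite perm_sym pp mulr1 (perm_wt pp) (perm_zee pp) mulrC.
  case E : (perm_eq _ _); rewrite ?mulr0 //; case: ne.
  apply: perm_part => //; first exact: psort_part.
  by rewrite perm_sym (perm_trans pp).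
rewrite (eq_big_seq _ Eco) -big_mkcond /=; case: eqP => [sn|sn].
  rewrite -big_filter (perm_big [:: psort la]) ?big_seq1 //.
  apply: uniq_perm => //; first by rewrite filter_uniq ?uniq_partitions.
  move=> nu; rewrite mem_filter inE; case: eqP => // ->.
  by rewrite psort_mem.
rewrite big_seq_cond big1 // => nu /andP[/sumn_of_mem h /eqP E].
by case: sn; rewrite -(perm_sumn pp) -E.
Qed.

(** With sum_n h_n z^n = exp(sum_k w_k p_k z^k / k), the derivation d/dp_k multiplies the series by
    w_k z^k / k. The proof reads this on coefficients, through [zee_cons]. *)
Lemma der_hw k n : (0 < k)%N ->
  der A k (hw n) = if (k <= n)%N then (w k / k%:R) *: hw (n - k) else 0.
Proof.
move=> k0; apply: (co_eq (A := A)) => la /andP[_ z].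
rewrite coef_der // co_hw; last by rewrite in_cons negb_or eq_sym -lt0n k0.
rewrite /= (fun_if (co la)) co0 coZ co_hw //.
case: (leqP k n) => kn; last first.
  case: eqP => [E|]; last by rewrite mulr0.
  by move: kn; rewrite -E ltnNge leq_addr.
have -> : (sumn la == n - k)%N = (k + sumn la == n)%N by apply/eqP/eqP; lia.
case: eqP => _; last by rewrite !mulr0.
rewrite wt_cons zee_cons !natrM.
have := zee_gt0 z; set x := zee la; rewrite lt0n -natr_eq0 => x0.
have c0 := natr_neq0 A (count_mem k la).
have k0' : k%:R != 0 :> K by rewrite natr_eq0 -lt0n.
move: (x%:R : K) x0 (k%:R : K) k0' (_.+1%:R : K) c0 => a a0 b b0 c c0.
by field; rewrite a0 b0 c0.
Qed.

Lemma hw_support m n : 0%N \notin m -> co m (hw n) != 0 -> sumn m = n.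
Proof. by move=> z; rewrite co_hw //; case: (sumn m =P n) => // _; rewrite eqxx. Qed.

(** A factor [hw k] with k > 0 contributes at least one part to a monomial, and exactly one only
    through p_k. *)
Lemma hwp_support la m : 0%N \notin la -> 0%N \notin m -> co m (hwp la) != 0 ->
  [/\ sumn m = sumn la, (size la <= size m)%N & size m = size la -> perm_eq m la].
Proof.
elim: la m => [|k la IH] m.
  move=> _ zm; rewrite /hwp big_nil -[1]hw0 => /(hw_support zm) s0.
  have := size_le_sumn zm; rewrite s0 leqn0 size_eq0 => /eqP -> //.
rewrite in_cons negb_or eq_sym -lt0n => /andP[k0 zl] zm.
rewrite hwp_cons => /(coM_neq0 zm)[m1 [m2 [z1 z2 h1 h2 pm]]].
have s1 := hw_support z1 h1; have [s2 l2 e2] := IH m2 zl z2 h2.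
rewrite (perm_sumn pm) (perm_size pm) sumn_cat size_cat s1 s2.
have sz1 : (0 < size m1)%N by case: (m1) s1 k0 => //= <-.
split => //=; first by rewrite -add1n leq_add.
have sum_eq (a b c : nat) : (0 < a)%N -> (c <= b)%N -> (a + b)%N = c.+1 ->
  a = 1%N /\ b = c by lia.
move=> E; have [+ /e2 pm2] := sum_eq _ _ _ sz1 l2 E.
case: (m1) s1 pm => [|a [|//]] //=; rewrite addn0 => -> pm _.
by rewrite (perm_trans pm) //= perm_cons.
Qed.

Lemma co_hwp_lead la : 0%N \notin la ->
  co la (hwp la) = \prod_(i <- la) (w i / i%:R).
Proof.
elim: la => [|k la IH].
  move=> _; have -> : hwp [::] = hw 0 by rewrite hw0 /hwp big_nil.
  by rewrite co_hw //= /wt /zee !big_nil divr1.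
rewrite in_cons negb_or eq_sym -lt0n => /andP[k0 zl].
have z : 0%N \notin k :: la by rewrite in_cons negb_or eq_sym -lt0n k0.
(* Once its term (w_k / k) p_k is split off, [hw k] has only monomials with at least two parts; with
   the l(la) or more parts of the other factors, these are too long to give p_(k :: la). *)
rewrite hwp_cons big_cons -[hw k](subrK ((w k / k%:R) *: psum_gen A k)) mulrDl coD.
rewrite -scalerAl coZ co_pcons // IH // [X in X + _](_ : _ = 0) ?add0r //.
apply/eqP/negPn/negP => /(coM_neq0 z)[m1 [m2 [z1 z2 h1 h2 pm]]].
have [s2 l2 _] := hwp_support zl z2 h2.
have := perm_size pm; rewrite size_cat /= => sz.
have s1 : sumn m1 = k.
  by have /eqP := perm_sumn pm; rewrite sumn_cat s2 /= eqn_add2r => /eqP.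
have : (size m1 <= 1)%N by rewrite -(leq_add2r (size m2)) -sz add1n ltnS.
case: (m1) s1 h1 => [|a [|//]] /=; first by move=> E; rewrite -E in k0.
rewrite addn0 => -> /eqP + _; apply.
have zk : 0%N \notin [:: k] by rewrite inE eq_sym -lt0n.
have Ek : psum_gen A k = pmn [:: k] by rewrite pmn_cons [pmn [::]]big_nil mulr1.
rewrite coB coZ co_hw //= addn0 eqxx Ek co_pmn // perm_refl mulr1.
rewrite wt_cons /wt big_nil mulr1 zee_cons /zee big_nil /= !muln1.
exact: subrr.
Qed.

Hypothesis w_neq0 : forall k, (0 < k)%N -> w k != 0.

Definition in_hspan (d : nat) f :=
  exists a : seq nat -> K, f = \sum_(la <- partitions d) a la *: hwp la.

Lemma in_hspan_hwp la : 0%N \notin la -> in_hspan (sumn la) (hwp la).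
Proof.
move=> z; exists (fun mu => (mu == psort la)%:R).
rewrite (bigD1_seq (psort la)) ?uniq_partitions ?psort_mem //= eqxx scale1r.
rewrite big1 ?addr0 => [|mu /negbTE->]; last by rewrite scale0r.
by rewrite (perm_hwp (psort_perm la)).
Qed.

Lemma in_hspan0 d : in_hspan d 0.
Proof. by exists (fun=> 0); rewrite big1 // => la _; rewrite scale0r. Qed.

Lemma in_hspanD d f g : in_hspan d f -> in_hspan d g -> in_hspan d (f + g).
Proof.
move=> [a ->] [b ->]; exists (fun la => a la + b la).
by rewrite -big_split; apply: eq_bigr => la _; rewrite scalerDl.
Qed.

Lemma in_hspanZ d c f : in_hspan d f -> in_hspan d (c *: f).
Proof.
move=> [a ->]; exists (fun la => c * a la).
by rewrite scaler_sumr; apply: eq_bigr => la _; rewrite scalerA.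
Qed.

Lemma in_hspan_sum d (I : eqType) (r : seq I) (F : I -> L) :
  (forall i, i \in r -> in_hspan d (F i)) -> in_hspan d (\sum_(i <- r) F i).
Proof.
move=> h; rewrite big_seq; apply: big_ind => //; first exact: in_hspan0.
exact: in_hspanD.
Qed.

Lemma in_hspanM d d' f g : in_hspan d f -> in_hspan d' g -> in_hspan (d + d') (f * g).
Proof.
move=> [a ->] [b ->]; rewrite mulr_suml; apply: in_hspan_sum => la laP.
rewrite mulr_sumr; apply: in_hspan_sum => mu muP.
rewrite -scalerAl -scalerAr; do 2 apply: in_hspanZ.
rewrite /hwp -big_cat -/(hwp (la ++ mu)) -(sumn_of_mem laP) -(sumn_of_mem muP) -sumn_cat.
apply: in_hspan_hwp; rewrite mem_cat negb_or.
by case/andP: (is_part_of_mem laP) => _ ->; case/andP: (is_part_of_mem muP) => _ ->.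
Qed.

(** Newton's identity solved for w_k p_k: the other terms involve p_j with j < k only, and w_k is
    invertible. *)
Lemma in_hspan_psum k : (0 < k)%N -> in_hspan k (psum_gen A k).
Proof.
elim/ltn_ind: k => k IH k0; have := hw_newton k.
rewrite big_nat_recr //= subnn hw0 mulr1 => /eqP.
rewrite addrC -subr_eq => /eqP E.
have -> : psum_gen A k = (w k)^-1 *: (w k *: psum_gen A k).
  by rewrite scalerA mulVf ?scale1r // w_neq0.
rewrite -E; apply/in_hspanZ/in_hspanD.
  apply: in_hspanZ; have -> : hw k = hwp [:: k] by rewrite /hwp big_seq1.
  by rewrite -[X in in_hspan X](addn0 k); apply: (@in_hspan_hwp [:: k]); rewrite inE eq_sym -lt0n.
rewrite -scaleN1r; apply/in_hspanZ/in_hspan_sum => j.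
rewrite mem_index_iota => /andP[j0 jk]; apply: in_hspanZ.
rewrite -[X in in_hspan X](subnKC (ltnW jk)); apply: in_hspanM; first exact: IH.
have -> : hw (k - j)%N = hwp [:: (k - j)%N] by rewrite /hwp big_seq1.
rewrite -[X in in_hspan X](addn0 (k - j)%N); apply: (@in_hspan_hwp [:: (k - j)%N]).
by rewrite inE eq_sym subn_eq0 -ltnNge.
Qed.

Lemma in_hspan_pmn la : 0%N \notin la -> in_hspan (sumn la) (pmn la).
Proof.
elim: la => [|k la IH].
  by move=> z; have := in_hspan_hwp z; rewrite /hwp /pmn !big_nil.
rewrite in_cons negb_or eq_sym -lt0n => /andP[k0 zl].
by rewrite pmn_cons; apply: in_hspanM; [exact: in_hspan_psum|exact: IH].
Qed.

End Weighted.

(** * Dominance order and triangularity *)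

Lemma dominatedP la mu : reflect
  (sumn la = sumn mu /\ forall k, (k <= sumn la)%N -> (sumn (take k la) <= sumn (take k mu))%N)
  (dominated la mu).
Proof.
apply: (iffP andP) => -[/eqP E h]; split => //.
  by move=> k kn; have := forallP h (Ordinal (kn : (k < (sumn la).+1)%N)).
by apply/forallP => k; apply: h; rewrite -ltnS.
Qed.

Lemma dominated_sumn la mu : dominated la mu -> sumn la = sumn mu.
Proof. by case/dominatedP. Qed.

Lemma dominated_refl la : dominated la la.
Proof. by apply/dominatedP. Qed.

Lemma dominated_trans la mu nu : dominated la mu -> dominated mu nu -> dominated la nu.
Proof.
move=> /dominatedP[e1 h1] /dominatedP[e2 h2]; apply/dominatedP; split.
  by rewrite e1.
by move=> k kn; apply: leq_trans (h1 k kn) (h2 k _); rewrite -e1.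
Qed.

Lemma sumn_take_le k (la : seq nat) : (sumn (take k la) <= sumn la)%N.
Proof. by rewrite -{2}(cat_take_drop k la) sumn_cat leq_addr. Qed.

(** The first l(la) parts of [la] exhaust the sum, so by dominance those of [mu] do as well, and
    [mu] has no further positive part. *)
Lemma dominated_size la mu : is_part la -> is_part mu -> dominated la mu ->
  (size mu <= size la)%N.
Proof.
move=> /andP[_ zl] /andP[_ zm] /dominatedP[E h].
have := h (size la) (size_le_sumn zl); rewrite take_size E => le1.
have {}le1 : sumn (drop (size la) mu) = 0%N.
  have /(congr1 sumn) := cat_take_drop (size la) mu; rewrite sumn_cat => E2.
  by apply/eqP; rewrite -leqn0 -(leq_add2l (sumn (take (size la) mu))) E2 addn0.
rewrite leqNgt; apply/negP => lt.
have : (0 < size (drop (size la) mu))%N by rewrite size_drop subn_gt0.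
have : 0%N \notin drop (size la) mu by apply: contra zm; apply: mem_drop.
by case: (drop _ _) le1 => //= -[|].
Qed.

(** A numerical rank that increases strictly along dominance; the inductions on this partial order
    run on it. *)
Definition domrank (la : seq nat) := (\sum_(k < (sumn la).+1) sumn (take k la))%N.

Lemma domrank_lt la mu : is_part la -> is_part mu -> dominated la mu -> la != mu ->
  (domrank la < domrank mu)%N.
Proof.
move=> pl pm /dominatedP[E h]; apply: contraNltn.
rewrite /domrank -E => le.
have le1 (k : 'I_(sumn la).+1) : true ->
    (sumn (take k la) <= sumn (take k mu) ?= iff (sumn (take k la) == sumn (take k mu)))%N.
  by move=> _; split => //; apply: h; rewrite -ltnS.
have [_ eqs] := leqif_sum le1.
have : (\sum_(k < (sumn la).+1) sumn (take k la) == \sum_(k < (sumn la).+1) sumn (take k mu))%N.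
  by rewrite eqn_leq le andbT leq_sum // => k _; apply: h; rewrite -ltnS.
rewrite eqs => /forallP eqk.
have {}eqk k : sumn (take k la) = sumn (take k mu).
  case: (leqP k (sumn la)) => kn; first exact/eqP/(eqk (Ordinal (kn : (k < (sumn la).+1)%N))).
  have [/andP[_ zl] /andP[_ zm]] := (pl, pm).
  rewrite !take_oversize //; first by rewrite ltnW // (leq_trans _ kn) // ltnS E size_le_sumn.
  by rewrite ltnW // (leq_trans _ kn) // ltnS size_le_sumn.
have eqn k : nth 0%N la k = nth 0%N mu k.
  have tk (s : seq nat) : sumn (take k.+1 s) = (sumn (take k s) + nth 0%N s k)%N.
    elim: s k {eqk} => [|a s IH] [|k] //=; first by rewrite take0 addn0.
    by rewrite IH addnA.
  by have := eqk k.+1; rewrite !tk eqk => /addnI.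
have sz (s1 s2 : seq nat) : is_part s1 -> (forall k, nth 0%N s1 k = nth 0%N s2 k) ->
    (size s1 <= size s2)%N.
  move=> /andP[_ z] e; rewrite leqNgt; apply/negP => lt; have := e (size s2).
  rewrite [RHS]nth_default // => e0; move/negP: z; apply.
  by rewrite -e0 mem_nth.
apply/eqP/(@eq_from_nth _ 0%N) => //; apply/eqP.
by rewrite eqn_leq !sz.
Qed.

(** * Macdonald polynomials expanded in the basis dual to the monomials *)

Section Duality.
Variables (K : fieldType) (L : comAlgType K) (A : psalgebra L) (w : nat -> K).
Hypothesis w_neq0 : forall k, (0 < k)%N -> w k != 0.
Notation co := (coef A).
Notation pmn := (psum_mon A).
Notation hw := (hw A w).
Notation hwp := (hwp A w).
Notation wt := (wt w).

Variable sc : L -> L -> K.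
Hypothesis sc_linear : forall f, linear_for *%R (sc f).
Hypothesis sc_pmn : forall f (la : seq nat), 0%N \notin la ->
  sc f (pmn la) = co la f * (zee la)%:R / wt la.

HB.instance Definition _ f := GRing.isLinear.Build K L K *%R (sc f) (sc_linear f).

Lemma scDr f g h : sc f (g + h) = sc f g + sc f h.
Proof. exact: linearD. Qed.

Lemma scZr f c g : sc f (c *: g) = c * sc f g.
Proof. exact: (linearZ_LR (sc f)). Qed.

Lemma sc0r f : sc f 0 = 0.
Proof. exact: linear0. Qed.

Lemma sc_suml (I : Type) (r : seq I) (F : I -> L) (a : I -> K) g :
  sc (\sum_(i <- r) a i *: F i) g = \sum_(i <- r) a i * sc (F i) g.
Proof.
elim/(pmn_ind (A := A)): g => [|g1 g2 h1 h2|c la z].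
- by rewrite sc0r big1 // => i _; rewrite sc0r mulr0.
- rewrite scDr h1 h2 -big_split; apply: eq_bigr => i _ /=.
  by rewrite scDr mulrDr.
rewrite scZr sc_pmn // co_sum !mulr_suml mulr_sumr; apply: eq_bigr => i _.
by rewrite scZr sc_pmn // coZ; ring.
Qed.

Lemma wt_neq0 la : 0%N \notin la -> wt la != 0.
Proof.
move=> z; rewrite /wt prodf_seq_neq0; apply/allP => i il; apply: w_neq0.
by rewrite lt0n; apply: contraNneq z => <-.
Qed.

Lemma zee_natr_neq0 la : 0%N \notin la -> (zee la)%:R != 0 :> K.
Proof. by move/zee_gt0; rewrite (natr_eq0 A) -lt0n. Qed.

Section Kernel.
Variables (N : nat) (vcoef : ('I_N -> nat) -> L -> K).
Hypothesis vcoef_linear : forall al, linear_for *%R (vcoef al).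
Hypothesis vcoef1 : forall al, vcoef al 1 = [forall i, al i == 0%N]%:R.
Hypothesis vcoef_psum : forall al k f, (0 < k)%N ->
  vcoef al (psum_gen A k * f) = \sum_(j < N)
    if (k <= al j)%N then vcoef (fun i => if i == j then (al i - k)%N else al i) f else 0.

HB.instance Definition _ al := GRing.isLinear.Build K L K *%R (vcoef al) (vcoef_linear al).

(* [hw] is the reproducing kernel of [sc]: multiplication by [p_k] is adjoint
   to the derivation [der k], which shifts the index of [hw] by [k]. *)
Lemma kernelE al f : vcoef al f = sc (\prod_(j < N) hw (al j)) f.
Proof.
elim/(pmn_ind (A := A)): f => [|g1 g2 h1 h2|c la z].
- by rewrite sc0r; exact: linear0.
- by rewrite scDr -h1 -h2; exact: linearD.
rewrite scZr -(_ : vcoef al (pmn la) = sc (\prod_(j < N) hw (al j)) (pmn la)).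
  exact: (linearZ_LR (vcoef al)).
rewrite {c} sc_pmn //; elim: la al z => [|k la IH] al.
  move=> z; have p1 : pmn [::] = 1 by exact: big_nil.
  rewrite p1 vcoef1 /wt /zee !big_nil divr1 mulr1; case: forallP => /= [h|h].
    rewrite (eq_bigr (fun=> 1)) => [|i _]; last by rewrite (eqP (h i)) hw0.
    by rewrite big1 // -p1 co_pmn.
  apply/esym/eqP/negPn/negP => ne; apply: h => j.
  rewrite (bigD1 j) //= in ne.
  have [m1 [m2 [z1 _ h1 _ pm]]] := coM_neq0 z ne.
  have := perm_size pm; rewrite size_cat; case: (m1) h1 => //= h1 _.
  by have <- := hw_support z h1.
rewrite in_cons negb_or eq_sym -lt0n => /andP[k0 zl].
have -> : co (k :: la) (\prod_(j < N) hw (al j)) * (zee (k :: la))%:R / wt (k :: la)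
  = co la (der A k (\prod_(j < N) hw (al j))) * (k%:R / w k) * ((zee la)%:R / wt la).
  rewrite coef_der // zee_cons wt_cons !natrM; have := w_neq0 k0; have := wt_neq0 zl.
  move: (wt la) (w k) => x y x0 y0; field; by rewrite x0.
rewrite pmn_cons vcoef_psum // der_prod ?index_enum_uniq //.
rewrite co_sum !mulr_suml; apply: eq_bigr => j _.
rewrite (bigD1 j) //= eqxx der_hw //.
case: ifP => kj; last by rewrite mul0r co0 !mul0r.
rewrite IH // (bigD1 j) //= eqxx -scalerAl coZ.
rewrite (eq_bigr (fun i => if i == j then der A k (hw (al i)) else hw (al i))); last first.
  by move=> i /negbTE->.
have k0' : k%:R != 0 :> K by rewrite (natr_eq0 A) -lt0n.
rewrite mulrA; congr (_ * _ / _); rewrite mulrAC mulf_div [w k * _]mulrC.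
by rewrite mulfV ?mul1r // mulf_neq0 // w_neq0.
Qed.

End Kernel.

Variable P : seq nat -> L.
Hypothesis P_triangular : forall mu, is_part mu -> exists c : seq nat -> K,
  forall nu, is_part nu -> sc (hwp nu) (P mu) =
    if nu == mu then 1 else if dominated nu mu then c nu else 0.
Hypothesis P_orthogonal : forall la mu, is_part la -> is_part mu -> la != mu ->
  sc (P la) (P mu) = 0.

(** p_la is a combination of products [hwp nu] of its own degree, each of which pairs to zero with
    P_mu. The form is diagonal on the p_la with nonzero norms, so this pairing detects the
    coefficient. *)
Lemma P_homogeneous mu la : is_part mu -> is_part la -> sumn la != sumn mu ->
  co la (P mu) = 0.
Proof.
move=> pm pl ne; have /andP[_ zl] := pl.
have scs f : sc (pmn la) f = co la f * (zee la)%:R / wt la.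
  elim/(pmn_ind (A := A)): f => [|g1 g2 h1 h2|c nu z].
  - by rewrite sc0r co0 !mul0r.
  - by rewrite scDr coD h1 h2 !mulrDl.
  rewrite scZr coZ sc_pmn // !co_pmn // perm_sym; case E : (perm_eq _ _).
    by rewrite (perm_zee E) (perm_wt w E); ring.
  by rewrite !(mul0r, mulr0).
have : sc (pmn la) (P mu) = 0.
  have [a ->] := in_hspan_pmn A w_neq0 zl; rewrite sc_suml big_seq big1 // => nu nuP.
  have [c cP] := P_triangular pm; rewrite cP; last exact: is_part_of_mem nuP.
  case: eqP => [E|_]; first by rewrite -E (sumn_of_mem nuP) eqxx in ne.
  case: ifP => [/dominated_sumn E|]; last by rewrite mulr0.
  by rewrite -E (sumn_of_mem nuP) eqxx in ne.
rewrite scs => /eqP; rewrite -mulrA mulf_eq0 => /orP[/eqP //|].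
by rewrite mulf_eq0 invr_eq0 (negbTE (zee_natr_neq0 zl)) (negbTE (wt_neq0 zl)).
Qed.

Lemma P_expand mu : is_part mu -> in_hspan A w (sumn mu) (P mu).
Proof.
move=> pm; have [s [us ps E]] := co_expand A (P mu).
rewrite E; apply: in_hspan_sum => la las.
have [<-|ne] := eqVneq (sumn la) (sumn mu).
  apply: in_hspanZ; apply: (in_hspan_pmn A w_neq0).
  by have /andP[] := allP ps _ las.
rewrite P_homogeneous ?scale0r //; last exact: (allP ps _ las).
exact: in_hspan0.
Qed.

(** Pairing the sum with P_nu leaves only the terms la <= nu. If nu lies outside the upward closed
    set [S], so do these la, and induction from the bottom of the order leaves a_nu alone in a
    vanishing sum. *)
Lemma coefficients_vanish n (a : seq nat -> K) (S : pred (seq nat)) :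
  (forall la nu, dominated la nu -> S la -> S nu) ->
  (forall nu, nu \in partitions n -> ~~ S nu ->
     sc (\sum_(la <- partitions n) a la *: hwp la) (P nu) = 0) ->
  forall nu, nu \in partitions n -> ~~ S nu -> a nu = 0.
Proof.
move=> up H nu; have [r] := ubnP (domrank nu); elim: r nu => // r IH nu.
rewrite ltnS => rk nuP nS; have pn := is_part_of_mem nuP.
have := H nu nuP nS; rewrite sc_suml; have [c cP] := P_triangular pn.
rewrite (bigD1_seq nu) ?uniq_partitions //= cP // eqxx mulr1.
rewrite big_seq_cond big1 ?addr0 // => la /andP[laP ne].
have pl := is_part_of_mem laP.
rewrite cP // (negbTE ne); case: ifP => dom; last by rewrite mulr0.
rewrite IH ?mul0r //.
  by apply: leq_trans rk; apply: domrank_lt.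
by apply: contra nS; apply: up.
Qed.

(** P_mu is orthogonal to P_nu for every nu not above mu, which kills the coefficients outside la >=
    mu. In <P_mu, P_mu> this meets the opposite triangularity of the pairings, and only la = mu
    remains. *)
Lemma P_hwp_triangular mu : is_part mu -> exists a : seq nat -> K,
  [/\ P mu = \sum_(la <- partitions (sumn mu)) a la *: hwp la,
      a mu = sc (P mu) (P mu), a mu != 0 &
      forall la, la \in partitions (sumn mu) -> ~~ dominated mu la -> a la = 0].
Proof.
move=> pm; have [a E] := P_expand pm; exists a.
have muP : mu \in partitions (sumn mu) by rewrite mem_partitions pm /=.
have V la : la \in partitions (sumn mu) -> ~~ dominated mu la -> a la = 0.
  apply: (@coefficients_vanish _ _ (dominated mu)).
    by move=> la' nu d1 d2; apply: dominated_trans d2 d1.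
  move=> nu nuP nd; rewrite -E; apply: P_orthogonal => //; first exact: is_part_of_mem nuP.
  by apply: contraNneq nd => ->; exact: dominated_refl.
have norm : sc (P mu) (P mu) = a mu.
  have [c cP] := P_triangular pm.
  rewrite {1}E sc_suml (bigD1_seq mu) ?uniq_partitions //= cP // eqxx mulr1.
  rewrite big_seq_cond big1 ?addr0 // => la /andP[laP ne].
  have pl := is_part_of_mem laP; rewrite cP // (negbTE ne).
  case: ifP => d; last by rewrite mulr0.
  have [d'|/V->] := boolP (dominated mu la); rewrite ?mul0r //.
  have := ltn_trans (domrank_lt pm pl d' _) (domrank_lt pl pm d ne).
  by rewrite eq_sym ne ltnn => /(_ isT).
(* If <P_mu, P_mu> = 0, then P_mu is orthogonal to every P_nu of its degree, itself included;
   [coefficients_vanish] with [S] empty gives P_mu = 0, against the value 1 of its pairing with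
   [hwp mu]. *)
split => //; apply/eqP => a0; rewrite a0 in norm.
have aN la : la \in partitions (sumn mu) -> a la = 0.
  move=> laP; apply: (@coefficients_vanish (sumn mu) a pred0) => // nu nuP _.
  rewrite -E; have [<-//|ne] := eqVneq mu nu.
  by apply: P_orthogonal => //; exact: is_part_of_mem nuP.
have P0 : P mu = 0 by rewrite E big_seq big1 // => la /aN ->; rewrite scale0r.
have [c /(_ mu pm)] := P_triangular pm; rewrite eqxx P0 sc0r => /esym/eqP.
by rewrite oner_eq0.
Qed.

End Duality.

(** * Transport of triangularity and orthogonality through t -> 1/t and a plethysm *)

Section Transport.
Variables (K : fieldType) (L : comAlgType K) (A : psalgebra L).
Notation co := (coef A).
Notation pmn := (psum_mon A).

Variables (w u v : nat -> K) (iota : {rmorphism K -> K}) (phi : L -> L).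
Hypothesis w_neq0 : forall k, (0 < k)%N -> w k != 0.
Hypothesis u_neq0 : forall k, (0 < k)%N -> u k != 0.
Hypothesis iota_w : forall k, (0 < k)%N -> iota (w k) * u k = v k.
Hypothesis phiD : forall f g, phi (f + g) = phi f + phi g.
Hypothesis phiM : forall f g, phi (f * g) = phi f * phi g.
Hypothesis phi1 : phi 1 = 1.
Hypothesis phiZ : forall c f, phi (c *: f) = iota c *: phi f.
Hypothesis phi_psum : forall k, (0 < k)%N -> phi (psum_gen A k) = u k *: psum_gen A k.

Lemma phi0 : phi 0 = 0.
Proof. by have := phiZ 0 0; rewrite scaler0 rmorph0 scale0r. Qed.

Lemma phi_sum (I : Type) (r : seq I) (F : I -> L) :
  phi (\sum_(i <- r) F i) = \sum_(i <- r) phi (F i).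
Proof. exact: (big_morph phi phiD phi0). Qed.

Lemma phi_prod (I : Type) (r : seq I) (F : I -> L) :
  phi (\prod_(i <- r) F i) = \prod_(i <- r) phi (F i).
Proof. exact: (big_morph phi phiM phi1). Qed.

Lemma phi_pmn la : 0%N \notin la -> phi (pmn la) = wt u la *: pmn la.
Proof.
elim: la => [|k la IH]; first by rewrite /wt [pmn [::]]big_nil phi1 big_nil scale1r.
rewrite in_cons negb_or eq_sym -lt0n => /andP[k0 /IH E].
by rewrite pmn_cons phiM phi_psum // E wt_cons -scalerAl -scalerAr scalerA.
Qed.

Lemma co_phi la f : 0%N \notin la -> co la (phi f) = iota (co la f) * wt u la.
Proof.
move=> z; elim/(pmn_ind (A := A)): f => [|g1 g2 h1 h2|c mu zm].
- by rewrite phi0 !co0 rmorph0 mul0r.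
- by rewrite phiD !coD h1 h2 rmorphD mulrDl.
rewrite phiZ phi_pmn // !coZ co_pmn // rmorphM rmorph_nat.
case E : (perm_eq _ _); last by rewrite !(mulr0, mul0r).
by rewrite (perm_wt u E) !mulr1.
Qed.

Lemma iota_wt la : 0%N \notin la -> iota (wt w la) * wt u la = wt v la.
Proof.
move=> z; rewrite rmorph_prod -big_split; apply: eq_big_seq => i il /=.
by rewrite iota_w // lt0n; apply: contraNneq z => <-.
Qed.

Lemma phi_hw n : phi (hw A w n) = hw A v n.
Proof.
rewrite /hw /psum phi_sum; apply: eq_big_seq => la /is_part_of_mem/andP[_ z].
by rewrite !phiZ phi_pmn // !scalerA fmorphV rmorph_nat -mulrA iota_wt.
Qed.

Lemma phi_hwp la : phi (hwp A w la) = hwp A v la.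
Proof. by rewrite /hwp phi_prod; apply: eq_bigr => i _; rewrite phi_hw. Qed.

Variable sc : L -> L -> K.
Hypothesis sc_linear : forall f, linear_for *%R (sc f).
Hypothesis sc_pmn : forall f (la : seq nat), 0%N \notin la ->
  sc f (pmn la) = co la f * (zee la)%:R / wt w la.

Definition form (star_weight : seq nat -> K) n f g : K :=
  \sum_(la <- partitions n) co la f * co la g * star_weight la.

Lemma sc_form n f g : (forall la, is_part la -> sumn la != n -> co la f = 0) ->
  sc f g = form (fun la => (zee la)%:R / wt w la) n f g.
Proof.
move=> hf; elim/(pmn_ind (A := A)): g => [|g1 g2 h1 h2|c mu z].
- rewrite (sc0r sc_linear) /form big1 // => la _; by rewrite co0 mulr0 mul0r.
- rewrite (scDr sc_linear) h1 h2 /form -big_split; apply: eq_bigr => la _ /=.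
  by rewrite coD mulrDr mulrDl.
have pp := psort_perm mu.
rewrite (scZr sc_linear) sc_pmn // /form.
have zp : 0%N \notin psort mu by rewrite (perm_mem pp).
rewrite -(perm_co A f zp pp) -(perm_wt w pp) -(perm_zee pp).
have Eco nu : nu \in partitions n ->
    co nu f * co nu (c *: pmn mu) * ((zee nu)%:R / wt w nu) =
    if nu == psort mu then c * (co nu f * (zee nu)%:R / wt w nu) else 0.
  move=> nuP; have pn := is_part_of_mem nuP; have /andP[_ zn] := pn.
  rewrite coZ co_pmn //; case: eqP => [->|ne]; first by rewrite pp mulr1; ring.
  case E : (perm_eq _ _); last by rewrite !(mulr0, mul0r).
  case: ne; apply: perm_part => //; first exact: psort_part.
  by rewrite (perm_trans E) // perm_sym.
rewrite (eq_big_seq _ Eco) -big_mkcond /=.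
have [sn|sn] := eqVneq (sumn mu) n.
  rewrite -big_filter (perm_big [:: psort mu]) ?big_seq1 //.
  apply: uniq_perm => //; first by rewrite filter_uniq ?uniq_partitions.
  move=> nu; rewrite mem_filter inE; case: eqP => // ->.
  by rewrite psort_mem.
rewrite hf ?psort_part ?(perm_sumn pp) // !mul0r mulr0 big_seq_cond big1 //.
move=> nu /andP[/sumn_of_mem h /eqP E].
by case/eqP: sn; rewrite -(perm_sumn pp) -E.
Qed.

(** Each coefficient of [phi f] carries a factor u_la, so the norm of p_la becomes z_la /
    (iota(w_la) u_la^2), which is z_la / (u_la v_la) because iota(w) u = v. *)
Lemma iota_sc n f g : (forall la, is_part la -> sumn la != n -> co la f = 0) ->
  iota (sc f g) =
  form (fun la => (zee la)%:R / (wt u la * wt v la)) n (phi f) (phi g).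
Proof.
move=> hf; rewrite (sc_form _ hf) /form rmorph_sum; apply: eq_big_seq => la laP.
have /andP[_ z] := is_part_of_mem laP.
rewrite !co_phi // !rmorphM fmorphV rmorph_nat -iota_wt //.
have := wt_neq0 w_neq0 z; rewrite -(fmorph_eq0 iota).
have := wt_neq0 u_neq0 z; move: (wt u la) (iota (wt w la)) => x y x0 y0 /=.
by field; rewrite x0.
Qed.

Variable P : seq nat -> L.
Hypothesis P_triangular : forall mu, is_part mu -> exists c : seq nat -> K,
  forall nu, is_part nu -> sc (hwp A w nu) (P mu) =
    if nu == mu then 1 else if dominated nu mu then c nu else 0.
Hypothesis P_orthogonal : forall la mu, is_part la -> is_part mu -> la != mu ->
  sc (P la) (P mu) = 0.

Variables (s : seq nat -> K) (H : seq nat -> L).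
Hypothesis s_neq0 : forall mu, is_part mu -> s mu != 0.
Hypothesis H_def : forall mu, is_part mu -> H mu = s mu *: phi (P mu).

Lemma H_orthogonal la mu : is_part la -> is_part mu -> la != mu ->
  form (fun la => (zee la)%:R / (wt u la * wt v la)) (sumn la) (H la) (H mu) = 0.
Proof.
move=> pl pm ne; rewrite !H_def //.
have E : form (fun la => (zee la)%:R / (wt u la * wt v la)) (sumn la) (phi (P la)) (phi (P mu)) = 0.
  rewrite -iota_sc; first by rewrite P_orthogonal // rmorph0.
  move=> nu pn; exact: (P_homogeneous w_neq0 sc_linear sc_pmn P_triangular).
rewrite /form (eq_bigr (fun nu => (s la * s mu) * (co nu (phi (P la)) * co nu (phi (P mu)) *
   ((zee nu)%:R / (wt u nu * wt v nu))))).
  by rewrite -mulr_sumr [X in _ * X]E mulr0.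
by move=> nu _; rewrite !coZ; ring.
Qed.

Lemma H_triangular mu : is_part mu -> exists b : seq nat -> K,
  [/\ H mu = \sum_(la <- partitions (sumn mu)) b la *: hwp A v la,
      b mu = s mu * iota (sc (P mu) (P mu)), b mu != 0 &
      forall la, la \in partitions (sumn mu) -> ~~ dominated mu la -> b la = 0].
Proof.
move=> pm; have [a [E aE a0 aN]] :=
  P_hwp_triangular w_neq0 sc_linear sc_pmn P_triangular P_orthogonal pm.
exists (fun la => s mu * iota (a la)); split.
- rewrite H_def // E phi_sum scaler_sumr; apply: eq_bigr => la _.
  by rewrite phiZ phi_hwp scalerA.
- by rewrite aE.
- by rewrite mulf_neq0 ?s_neq0 // fmorph_eq0.
- by move=> la laP /aN ->//; rewrite rmorph0 mulr0.
Qed.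

End Transport.

(** * Gram-Schmidt near t = 1 *)

(* [ev x a]: x is regular at t = 1, with value a, a constant of K. *)
Record evaluation (K : fieldType) := Evaluation {
  ev :> K -> K -> Prop;
  evD : forall x y a b, ev x a -> ev y b -> ev (x + y) (a + b);
  evN : forall x a, ev x a -> ev (- x) (- a);
  evM : forall x y a b, ev x a -> ev y b -> ev (x * y) (a * b);
  evV : forall x a, a != 0 -> ev x a -> ev x^-1 a^-1;
  ev_1 : ev 1 1;
  ev_const : forall x a, ev x a -> ev a a;
  ev_uniq : forall x a b, ev x a -> ev x b -> a = b
}.

Section EvTheory.
Variables (K : fieldType) (ev : evaluation K).

Lemma evB x y a b : ev x a -> ev y b -> ev (x - y) (a - b).
Proof. by move=> hx hy; apply: evD => //; apply: evN. Qed.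

Lemma ev0 : ev 0 0.
Proof. by rewrite -(subrr 1); apply: evB; exact: ev_1. Qed.

Lemma ev_sum (I : eqType) (r : seq I) (P : pred I) (f g : I -> K) :
  (forall i, i \in r -> P i -> ev (f i) (g i)) ->
  ev (\sum_(i <- r | P i) f i) (\sum_(i <- r | P i) g i).
Proof.
move=> h; rewrite big_seq_cond [X in ev _ X]big_seq_cond.
apply: (big_ind2 ev) => [|x a y b|i /andP[ir Pi]]; [exact: ev0|exact: evD|exact: h].
Qed.

Lemma ev_prod (I : eqType) (r : seq I) (P : pred I) (f g : I -> K) :
  (forall i, i \in r -> P i -> ev (f i) (g i)) ->
  ev (\prod_(i <- r | P i) f i) (\prod_(i <- r | P i) g i).
Proof.
move=> h; rewrite big_seq_cond [X in ev _ X]big_seq_cond.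
apply: (big_ind2 ev) => [|x a y b|i /andP[ir Pi]]; [exact: ev_1|exact: evM|exact: h].
Qed.

Lemma evX x a n : ev x a -> ev (x ^+ n) (a ^+ n).
Proof. by move=> h; elim: n => [|n IH]; [exact: ev_1|rewrite !exprS; apply: evM]. Qed.

Lemma ev_nat n : ev n%:R n%:R.
Proof. by elim: n => [|n IH]; [exact: ev0|rewrite -addn1 natrD; apply: evD => //; exact: ev_1]. Qed.

Lemma ev_div x y a b : b != 0 -> ev x a -> ev y b -> ev (x / y) (a / b).
Proof. by move=> b0 hx hy; apply: evM => //; apply: evV. Qed.

Lemma ev_neq0 x a : a != 0 -> ev x a -> x != 0.
Proof.
by move=> a0 h; apply: contraNneq a0 => x0; apply/eqP/(ev_uniq h); rewrite x0; exact: ev0.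
Qed.

End EvTheory.

(** Used with [e] = 1-t, a = n-1 and b = l(la)-1: the prefactor has order 1-n in [e], the
    coefficient of p_1^n along H_la has order n - l(la), and Pi_la has order l(la)-1. *)
Lemma pole_cancel (K : fieldType) (v e d x c N p : K) a b :
  v != 0 -> e != 0 -> x != 0 ->
  (v / e) ^+ a * (c * (N * (e * d / v) ^+ a.+1) / (e ^+ b.+1 * x)) * (e ^+ b * p) =
  N * d ^+ a.+1 / v * c * p / x.
Proof.
move=> v0 e0 x0.
have E : (v / e) ^+ a * (e * d / v) ^+ a.+1 = d ^+ a.+1 * e / v.
  rewrite exprS mulrCA -exprMn (_ : v / e * (e * d / v) = d); last by field; rewrite v0.
  by rewrite exprS; field.
have eb : e ^+ b != 0 by rewrite expf_neq0.
transitivity (N * ((v / e) ^+ a * (e * d / v) ^+ a.+1) * c * (e ^+ b * p) / (e ^+ b.+1 * x)).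
  by ring.
by rewrite E !exprS; move: (d ^+ a) (e ^+ b) eb => da eb eb0; field; rewrite ?(v0, e0, x0, eb0).
Qed.

Section GramSchmidt.
Variables (K : fieldType) (L : comAlgType K) (A : psalgebra L) (ev : evaluation K).
Notation co := (coef A).
Notation pmn := (psum_mon A).

Variables (v d e : nat -> K) (eps : K).
Hypothesis v_const : forall k, (0 < k)%N -> ev (v k) (v k).
Hypothesis v_neq0 : forall k, (0 < k)%N -> v k != 0.
Hypothesis d_ev : forall k, (0 < k)%N -> ev (d k) (e k).
Hypothesis e_neq0 : forall k, (0 < k)%N -> e k != 0.
Hypothesis eps_neq0 : eps != 0.
Hypothesis eps_ev : ev eps 0.

Notation rho := (hwp A v).

Lemma neq0_part (la : seq nat) i : 0%N \notin la -> i \in la -> (0 < i)%N.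
Proof. by move=> z il; rewrite lt0n; apply: contraNneq z => <-. Qed.

Lemma wt_const la : 0%N \notin la -> ev (wt v la) (wt v la).
Proof.
by move=> z; apply: ev_prod => i il _; apply: v_const; apply: neq0_part il.
Qed.

Definition const_coef (f : L) := forall la, 0%N \notin la -> ev (co la f) (co la f).

Lemma const_coefM f g : const_coef f -> const_coef g -> const_coef (f * g).
Proof.
move=> hf hg la z; have [s [us ps Ef]] := co_expand A f.
have [s' [us' ps' Eg]] := co_expand A g.
rewrite {1 2}Ef {1 2}Eg mulr_suml co_sum; apply: ev_sum => m1 m1s _.
have /andP[_ z1] := allP ps _ m1s.
rewrite mulr_sumr co_sum; apply: ev_sum => m2 m2s _.
have /andP[_ z2] := allP ps' _ m2s.
have z12 : 0%N \notin m1 ++ m2 by rewrite mem_cat negb_or z1.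
rewrite -scalerAl -scalerAr !coZ -pmn_cat co_pmn //.
by apply: evM; [exact: hf|apply: evM; [exact: hg|exact: ev_nat]].
Qed.

Lemma rho_const la : const_coef (rho la).
Proof.
elim: la => [|k la IH].
  move=> m zm; have -> : rho [::] = pmn [::] by rewrite /hwp [pmn _]big_nil big_nil.
  by rewrite co_pmn //; exact: ev_nat.
rewrite hwp_cons; apply: const_coefM => // m zm; rewrite co_hw //.
case: ifP => _; last exact: ev0.
by apply: ev_div; [exact: (zee_natr_neq0 A)|exact: wt_const|exact: ev_nat].
Qed.

(* p_la has norm [star_weight la], where eps = 1 - t, eps d_k = 1 - t^(-k), so
   that d_k is e_k = -k at t = 1, and v_k = 1/(1 - q^k). *)
Definition star_weight (la : seq nat) : K := (zee la)%:R * \prod_(i <- la) (eps * d i / v i).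

(** The value at t = 1 of eps^(-l(la)) <rho_la, rho_la>, to which only the monomial p_la
    contributes. *)
Definition star_norm (la : seq nat) : K :=
  co la (rho la) * co la (rho la) * ((zee la)%:R * \prod_(i <- la) (e i / v i)).

Definition star_red (la : seq nat) : K := (zee la)%:R * \prod_(i <- la) (d i / v i).

Lemma star_weightE la : star_weight la = eps ^+ size la * star_red la.
Proof.
rewrite /star_weight /star_red mulrCA; congr (_ * _).
elim: la => [|k la IH]; first by rewrite !big_nil expr0 mulr1.
by rewrite !big_cons IH /= exprS; ring.
Qed.

Lemma star_red_ev la : 0%N \notin la ->
  ev (star_red la) ((zee la)%:R * \prod_(i <- la) (e i / v i)).
Proof.
move=> z; apply: evM; first exact: ev_nat.
apply: ev_prod => i il _; have i0 := neq0_part z il.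
by apply: ev_div; [exact: v_neq0|exact: d_ev|exact: v_const].
Qed.

Lemma star_norm_neq0 la : 0%N \notin la -> star_norm la != 0.
Proof.
move=> z; have h : co la (rho la) != 0.
  rewrite co_hwp_lead // prodf_seq_neq0; apply/allP => i il /=.
  have i0 := neq0_part z il.
  by rewrite mulf_neq0 ?v_neq0 // invr_eq0 (natr_eq0 A) -lt0n.
rewrite !mulf_neq0 ?(zee_natr_neq0 A) // prodf_seq_neq0; apply/allP => i il /=.
have i0 := neq0_part z il.
by rewrite mulf_neq0 ?e_neq0 // invr_eq0 v_neq0.
Qed.

Section Degree.
Variable n : nat.

Definition star_form f g := form A star_weight n f g.

Lemma star_formDr f g h : star_form f (g + h) = star_form f g + star_form f h.
Proof.
by rewrite /star_form /form -big_split; apply: eq_bigr => la _; rewrite coD /=; ring.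
Qed.

Lemma star_formC f g : star_form f g = star_form g f.
Proof. by apply: eq_bigr => la _; rewrite [co la f * _]mulrC. Qed.

Lemma star_form_sumr (I : Type) (r : seq I) (F : I -> L) (a : I -> K) f :
  star_form f (\sum_(i <- r) a i *: F i) = \sum_(i <- r) a i * star_form f (F i).
Proof.
rewrite /star_form /form; under [RHS]eq_bigr do rewrite mulr_sumr.
rewrite exchange_big; apply: eq_bigr => la _ /=.
rewrite co_sum mulr_sumr mulr_suml; apply: eq_bigr => i _.
by rewrite coZ; ring.
Qed.

(* The form on [rho mu] and [rho ka] divided by eps^l(mu), and its value at t = 1. *)
Definition star_rho mu ka : K :=
  \sum_(m <- partitions n) if (size mu <= size m)%N then
    eps ^+ (size m - size mu) * (co m (rho mu) * co m (rho ka) * star_red m) else 0.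

Definition star_rho1 mu ka : K :=
  \sum_(m <- partitions n) if (size mu <= size m)%N then
    0 ^+ (size m - size mu) * (co m (rho mu) * co m (rho ka) *
      ((zee m)%:R * \prod_(i <- m) (e i / v i))) else 0.

(* A monomial occurring in [rho mu] has at least [size mu] parts, and only
   [pmn mu] has exactly [size mu] of them. *)
Lemma star_form_rho mu ka : mu \in partitions n ->
  star_form (rho mu) (rho ka) = eps ^+ size mu * star_rho mu ka.
Proof.
move=> /is_part_of_mem/andP[_ zm].
rewrite /star_form /form /star_rho mulr_sumr; apply: eq_big_seq => m mP.
have /andP[_ z] := is_part_of_mem mP.
case: leqP => le'; last first.
  have [->|/(hwp_support zm z)[_ + _]] := eqVneq (co m (rho mu)) 0.
    by rewrite !mul0r mulr0.
  by rewrite leqNgt le'.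
by rewrite mulrA -exprD subnKC // star_weightE mulrCA.
Qed.

Lemma star_rho_ev mu ka : ev (star_rho mu ka) (star_rho1 mu ka).
Proof.
apply: ev_sum => m mP _; have /andP[_ z] := is_part_of_mem mP.
case: ifP => _; last exact: ev0.
apply: evM; first exact: evX.
by apply: evM; [apply: evM; exact: rho_const|exact: star_red_ev].
Qed.

(** The factor 0^(l(m) - l(mu)), with 0^0 = 1, keeps only the monomials p_m with l(m) = l(mu). Among
    these [rho mu] contains p_mu alone and [rho ka] contains p_ka alone. *)
Lemma star_rho1E mu ka : mu \in partitions n -> ka \in partitions n ->
  size ka = size mu -> star_rho1 mu ka = if ka == mu then star_norm mu else 0.
Proof.
move=> muP kaP sz; have pm := is_part_of_mem muP; have pk := is_part_of_mem kaP.
have /andP[_ zm] := pm; have /andP[_ zk] := pk.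
rewrite /star_rho1 (bigD1_seq mu) ?uniq_partitions //= leqnn subnn expr0 mul1r.
rewrite [X in _ + X]big_seq_cond [X in _ + X]big1 ?addr0 => [|m /andP[mP ne]]; last first.
  have pmm := is_part_of_mem mP; have /andP[_ z] := pmm.
  case: ifP => le' //; case: (posnP (size m - size mu)) => [/eqP|]; last first.
    by move=> h; rewrite expr0n gtn_eqF //= mul0r.
  rewrite subn_eq0 => le2.
  have [->|/(hwp_support zm z)[_ _ h]] := eqVneq (co m (rho mu)) 0.
    by rewrite !mul0r mulr0.
  case/eqP: ne; apply: perm_part => //; apply: h; apply/eqP.
  by rewrite eqn_leq le' le2.
case: eqP => [->|ne] //.
have [->|/(hwp_support zk zm)[_ _ h]] := eqVneq (co mu (rho ka)) 0.
  by rewrite mulr0 mul0r.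
by case: ne; apply: perm_part => //; rewrite perm_sym; exact: h.
Qed.

Variable H : seq nat -> L.
Hypothesis H_orth : forall la mu, la \in partitions n -> mu \in partitions n ->
  la != mu -> star_form (H la) (H mu) = 0.
Hypothesis H_tri : forall mu, mu \in partitions n -> exists b : seq nat -> K,
  [/\ H mu = \sum_(la <- partitions n) b la *: rho la, b mu = 1 &
      forall la, la \in partitions n -> ~~ dominated mu la -> b la = 0].

(** Induction downwards from the top of the order, on the distance of [domrank] to its bound
    n(n+1). *)
Lemma dominance_ind (Q : seq nat -> Prop) :
  (forall mu, mu \in partitions n ->
     (forall la, la \in partitions n -> dominated mu la -> la != mu -> Q la) -> Q mu) ->
  forall mu, mu \in partitions n -> Q mu.
Proof.
move=> step mu; have bnd la : la \in partitions n -> (domrank la <= n.+1 * n)%N.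
  move=> /sumn_of_mem E; rewrite /domrank E.
  apply: (@leq_trans (\sum_(k < n.+1) n)); last by rewrite sum_nat_const card_ord.
  by apply: leq_sum => k _; rewrite -[leqRHS]E sumn_take_le.
have [r] := ubnP (n.+1 * n - domrank mu); elim: r mu => // r IH mu.
rewrite ltnS => le muP; apply: step => // la laP dom ne; apply: IH => //.
have lt : (domrank mu < domrank la)%N.
  by apply: domrank_lt dom _; rewrite 1?eq_sym ?(is_part_of_mem laP) ?(is_part_of_mem muP).
by apply: leq_trans le; apply: ltn_sub2l => //; exact: leq_trans (bnd _ laP).
Qed.

(** Inverts the unitriangular matrix of the H_mu in the [rho la]: each [rho la] with la > mu is
    replaced by its own expansion, which stays above la. *)
Lemma rho_expand mu : mu \in partitions n -> exists w : seq nat -> K,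
  H mu = rho mu + \sum_(la <- partitions n) w la *: H la /\
  forall la, la \in partitions n -> ~~ (dominated mu la && (la != mu)) -> w la = 0.
Proof.
move: mu; apply: dominance_ind => mu muP IH.
pose S la := dominated mu la && (la != mu).
pose inS f := exists w : seq nat -> K, f = \sum_(la <- partitions n) w la *: H la /\
  forall la, la \in partitions n -> ~~ S la -> w la = 0.
have inS0 : inS 0.
  by exists (fun=> 0); split => //; rewrite big1 // => la _; rewrite scale0r.
have inSD f g : inS f -> inS g -> inS (f + g).
  move=> [w [-> hw]] [w' [-> hw']]; exists (fun la => w la + w' la); split.
    by rewrite -big_split; apply: eq_bigr => la _; rewrite scalerDl.
  by move=> la laP nS; rewrite hw // hw' // addr0.
have inSZ c f : inS f -> inS (c *: f).
  move=> [w [-> hw]]; exists (fun la => c * w la); split.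
    by rewrite scaler_sumr; apply: eq_bigr => la _; rewrite scalerA.
  by move=> la laP nS; rewrite hw // mulr0.
have inSH la : la \in partitions n -> S la -> inS (H la).
  move=> laP Sla; exists (fun ka => (ka == la)%:R); split.
    rewrite (bigD1_seq la) ?uniq_partitions //= eqxx scale1r big1 ?addr0 //.
    by move=> ka /negbTE->; rewrite scale0r.
  by move=> ka _; case: eqP => // ->; rewrite Sla.
have [b [E b1 bN]] := H_tri muP.
suff [w [Ew hw]] : inS (H mu - rho mu).
  by exists w; split => //; rewrite -Ew addrC subrK.
rewrite E (bigD1_seq mu) ?uniq_partitions //= b1 scale1r addrAC subrr add0r.
rewrite big_seq_cond; apply: big_ind => // la /andP[laP ne].
have [dom|/bN->//] := boolP (dominated mu la); last by rewrite scale0r.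
apply/inSZ; have [w [Ew hw]] := IH la laP dom ne.
have -> : rho la = H la + (-1) *: \sum_(ka <- partitions n) w ka *: H ka.
  by rewrite scaleN1r [X in X - _]Ew addrK.
apply/inSD; first by apply/inSH; rewrite // /S dom.
apply/inSZ; rewrite big_seq; apply: big_ind => // ka kaP.
have [/andP[dom' ne']|/hw->//] := boolP (dominated la ka && (ka != la)); last by rewrite scale0r.
apply/inSZ/inSH => //; rewrite /S (dominated_trans dom dom') /=.
(* With ka = mu, both mu < la and la < mu would hold, against the strict growth of [domrank]. *)
apply: contraNneq ne' => Ek; rewrite Ek in dom' *.
have [pm pl] := (is_part_of_mem muP, is_part_of_mem laP).
have lt1 : (domrank mu < domrank la)%N by apply: domrank_lt; rewrite 1?eq_sym.
apply/eqP/esym/eqP; apply: contraLR lt1 => ne''; rewrite -leqNgt ltnW //.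
exact: domrank_lt.
Qed.

(** Convergence of f to [rho mu] as t tends to 1, measured in the family [rho], which does not
    involve t. *)
Definition leading mu f := exists c : seq nat -> K,
  f = \sum_(la <- partitions n) c la *: rho la /\
  forall la, la \in partitions n -> ev (c la) (la == mu)%:R.

(** The power of eps comes from the argument [rho mu] alone, so it survives when [rho la] is
    replaced by a perturbation f of it. *)
Lemma star_form_leading mu la f : mu \in partitions n -> la \in partitions n ->
  leading la f -> exists2 x, star_form (rho mu) f = eps ^+ size mu * x & ev x (star_rho1 mu la).
Proof.
move=> muP laP [c [-> cE]]; rewrite star_form_sumr.
exists (\sum_(ka <- partitions n) c ka * star_rho mu ka).
  by rewrite mulr_sumr; apply: eq_bigr => ka _; rewrite star_form_rho // mulrCA.
have -> : star_rho1 mu la = \sum_(ka <- partitions n) (ka == la)%:R * star_rho1 mu ka.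
  rewrite (bigD1_seq la) ?uniq_partitions //= eqxx mul1r big1 ?addr0 //.
  by move=> ka /negbTE->; rewrite mul0r.
by apply: ev_sum => ka kaP _; apply: evM; [exact: cE|exact: star_rho_ev].
Qed.

(** Gram-Schmidt from the top. The coefficient of H_la in H_mu - rho_mu is -<rho_mu, H_la> / <H_la,
    H_la> = -eps^(l(mu) - l(la)) y / x, where l(la) <= l(mu) since la dominates mu. If l(la) <
    l(mu), the power of eps tends to 0; if the lengths agree, y does, its limit being an
    off-diagonal entry of the leading Gram matrix. *)
Lemma H_asymptotics mu : mu \in partitions n ->
  leading mu (H mu) /\
  exists2 x, star_form (H mu) (H mu) = eps ^+ size mu * x & ev x (star_norm mu).
Proof.
move: mu; apply: dominance_ind => mu muP IH.
have pm := is_part_of_mem muP.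
have [w [EH wN]] := rho_expand muP.
have w_ev la : la \in partitions n -> ev (w la) 0.
  move=> laP; have [/andP[dom ne]|/wN->//] := boolP (dominated mu la && (la != mu)).
    2: exact: ev0.
  have pl := is_part_of_mem laP.
  have [lead [x Ex hx]] := IH la laP dom ne.
  have le : (size la <= size mu)%N by exact: dominated_size.
  have [y Ey hy] := star_form_leading muP laP lead.
  have g0 : star_norm la != 0 by apply: star_norm_neq0; case/andP: pl.
  have x0 := ev_neq0 g0 hx.
  have -> : w la = - (eps ^+ (size mu - size la) * y / x).
    have := H_orth laP muP ne; rewrite EH star_formDr star_form_sumr star_formC Ey.
    rewrite (bigD1_seq la) ?uniq_partitions //= Ex.
    rewrite big_seq_cond big1 ?addr0 => [|ka /andP[kaP nk]]; last first.
      by rewrite H_orth ?mulr0 // eq_sym.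
    rewrite -{1}(subnKC le) exprD => /eqP; rewrite addrC addr_eq0 => /eqP E.
    apply: (mulIf x0); rewrite mulNr divfK //.
    apply: (mulfI (expf_neq0 (size la) eps_neq0)).
    by rewrite mulrCA E mulrN mulrA.
  rewrite -oppr0; apply: evN.
  have [E|lt] := eqVneq (size la) (size mu).
    have := star_rho1E muP laP E; rewrite (negbTE ne) => Y0; rewrite Y0 in hy.
    rewrite E subnn expr0 mul1r -(mul0r (star_norm la)^-1); exact: ev_div.
  rewrite -(mul0r (star_rho1 mu la / star_norm la)) -mulrA; apply: evM; last exact: ev_div.
  have := evX (size mu - size la) eps_ev; rewrite [0 ^+ _]expr0n subn_eq0 leqNgt.
  by rewrite ltn_neqAle lt le.
have lead : leading mu (H mu).
  pose lead0 f := exists c : seq nat -> K,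
    f = \sum_(la <- partitions n) c la *: rho la /\
    forall la, la \in partitions n -> ev (c la) 0.
  suff [c [Ec hc]] : lead0 (\sum_(la <- partitions n) w la *: H la).
    exists (fun la => (la == mu)%:R + c la); split.
      rewrite EH Ec; under [RHS]eq_bigr do rewrite scalerDl.
      rewrite big_split; congr (_ + _) => /=.
      rewrite (bigD1_seq mu) ?uniq_partitions //= eqxx scale1r big1 ?addr0 //.
      by move=> ka /negbTE->; rewrite scale0r.
    move=> la laP; rewrite -[X in ev _ X]addr0; apply: evD; last exact: hc.
    exact: ev_nat.
  have lead00 : lead0 0.
    by exists (fun=> 0); split => [|la _]; [rewrite big1 // => la _; rewrite scale0r|exact: ev0].
  rewrite big_seq; apply: big_ind => // [f g [c [-> hc]] [c' [-> hc']]|la laP].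
    exists (fun la => c la + c' la); split => [|la laP].
      by rewrite -big_split; apply: eq_bigr => la _; rewrite scalerDl.
    by rewrite -(addr0 0); apply: evD; [exact: hc|exact: hc'].
  have [/andP[dom ne]|/wN->//] := boolP (dominated mu la && (la != mu)).
    2: by rewrite scale0r.
  have [[c [-> hc]] _] := IH la laP dom ne.
  exists (fun ka => w la * c ka); split => [|ka kaP].
    by rewrite scaler_sumr; apply: eq_bigr => ka _; rewrite scalerA.
  by rewrite -(mul0r (ka == la)%:R); apply: evM; [exact: w_ev|exact: hc].
split => //; have [x Ex hx] := star_form_leading muP muP lead.
exists x; last by rewrite star_rho1E // eqxx in hx.
(* <H_mu, H_mu> = <rho_mu, H_mu>, since H_mu - rho_mu is a combination of H_la orthogonal to
   H_mu. *)
rewrite -Ex {2}EH star_formDr star_form_sumr star_formC.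
rewrite big_seq big1 ?addr0 // => la laP.
have [/andP[dom ne]|/wN->//] := boolP (dominated mu la && (la != mu)); last by rewrite mul0r.
by rewrite H_orth ?mulr0 // eq_sym.
Qed.

Lemma leading_ev mu f m : mu \in partitions n -> 0%N \notin m -> leading mu f ->
  ev (co m f) (co m (rho mu)).
Proof.
move=> muP z [c [-> cE]].
have -> : rho mu = \sum_(la <- partitions n) (la == mu)%:R *: rho la.
  rewrite (bigD1_seq mu) ?uniq_partitions //= eqxx scale1r big1 ?addr0 //.
  by move=> ka /negbTE->; rewrite scale0r.
rewrite !co_sum; apply: ev_sum => la laP _; rewrite !coZ.
by apply: evM; [exact: cE|exact: rho_const].
Qed.

Lemma hw1 : hw A v 1 = v 1%N *: psum_gen A 1.
Proof.
by have := hw_newton A v 1; rewrite big_nat1 scale1r subnn hw0 mulr1.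
Qed.

Lemma ones_partition : nseq n 1%N \in partitions n.
Proof.
rewrite mem_partitions sumn_nseq mul1n eqxx andbT /is_part.
have -> : 0%N \notin nseq n 1%N by elim: (n).
by rewrite andbT; case: (n) => //= k; elim: k.
Qed.

Lemma zee_ones k : zee (nseq k 1%N) = k`!.
Proof.
elim: k => [|k IH]; first by rewrite /zee big_nil.
by rewrite /= zee_cons IH mul1n count_nseq /= mul1n factS.
Qed.

Lemma star_form_ones f : star_form (psum_gen A 1 ^+ n) f =
  co (nseq n 1%N) f * (n`!%:R * (eps * d 1%N / v 1%N) ^+ n).
Proof.
have Ep : psum_gen A 1 ^+ n = pmn (nseq n 1%N) by rewrite /psum_mon big_nseq iter_mulr_1.
have oP := ones_partition; have po := is_part_of_mem oP; have /andP[_ zo] := po.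
rewrite /star_form /form (bigD1_seq (nseq n 1%N)) ?uniq_partitions //=.
rewrite [X in _ + X]big_seq_cond [X in _ + X]big1 ?addr0 => [|m /andP[mP ne]].
  by rewrite Ep co_pmn // perm_refl mul1r /star_weight zee_ones big_nseq iter_mulr_1.
have pm := is_part_of_mem mP; have /andP[_ zm] := pm.
rewrite Ep co_pmn //; case E : (perm_eq _ _); last by rewrite !mul0r.
by case/eqP: ne; apply: perm_part.
Qed.

Variables (Pi : L -> L) (Pc pr pv : seq nat -> K).
Hypothesis Pi_linear : linear Pi.
Hypothesis Pi_H : forall la, la \in partitions n -> Pi (H la) = Pc la *: H la.
Hypothesis PcE : forall la, la \in partitions n -> Pc la = eps ^+ (size la).-1 * pr la.
Hypothesis pr_ev : forall la, la \in partitions n -> ev (pr la) (pv la).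
Hypothesis n_gt0 : (0 < n)%N.

HB.instance Definition _ := GRing.isLinear.Build K L L *:%R Pi Pi_linear.

Lemma PiZ c f : Pi (c *: f) = c *: Pi f.
Proof. exact: (linearZ_LR Pi). Qed.

Lemma Pi_sum (I : Type) (r : seq I) (F : I -> L) :
  Pi (\sum_(i <- r) F i) = \sum_(i <- r) Pi (F i).
Proof. exact: (linear_sum Pi). Qed.

(** As [hw 1] is v_1 p_1, p_1^n is a multiple of [rho] at the partition 1^n, and [rho_expand]
    applies there. *)
Lemma ones_expand : exists c : seq nat -> K,
  psum_gen A 1 ^+ n = \sum_(la <- partitions n) c la *: H la.
Proof.
have [w [E _]] := rho_expand ones_partition.
exists (fun la => (v 1%N ^+ n)^-1 * ((la == nseq n 1%N)%:R - w la)).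
have v1 : v 1%N ^+ n != 0 by rewrite expf_neq0 ?v_neq0.
apply: (scalerI v1); rewrite -exprZn -hw1 scaler_sumr.
have -> : hw A v 1 ^+ n = rho (nseq n 1%N) by rewrite /hwp big_nseq iter_mulr_1.
under eq_bigr do rewrite scalerA mulrA mulfV // mul1r scalerBl.
rewrite sumrB (bigD1_seq (nseq n 1%N)) ?uniq_partitions ?ones_partition //=.
rewrite eqxx scale1r big1 ?addr0 => [|ka /negbTE->]; last by rewrite scale0r.
by rewrite E addrK.
Qed.

(** The coefficient of p_1^n along H_la is <p_1^n, H_la> / <H_la, H_la>. Its numerator sees only the
    coefficient of p_1^n in H_la, which tends to that in rho_la; [pole_cancel] does the rest. *)
Lemma Pi_ones_ev m : 0%N \notin m ->
  ev (co m ((v 1%N / eps) ^+ n.-1 *: Pi (psum_gen A 1 ^+ n)))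
     (co m (\sum_(la <- partitions n)
        (n`!%:R * e 1%N ^+ n / v 1%N * co (nseq n 1%N) (rho la) * pv la / star_norm la) *: rho la)).
Proof.
move=> zm; have [c E] := ones_expand; rewrite {1}E Pi_sum scaler_sumr !co_sum.
apply: ev_sum => la laP _; rewrite PiZ Pi_H // !scalerA !coZ.
have pl := is_part_of_mem laP; have /andP[_ zl] := pl.
have [lead [x Ex hx]] := H_asymptotics laP.
apply: evM; last exact: leading_ev.
have g0 := star_norm_neq0 zl; have x0 := ev_neq0 g0 hx.
have v10 := v_neq0 (isT : (0 < 1)%N).
have zo : 0%N \notin nseq n 1%N by have /andP[] := is_part_of_mem ones_partition.
have Ec : c la = co (nseq n 1%N) (H la) * (n`!%:R * (eps * d 1%N / v 1%N) ^+ n)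
    / (eps ^+ size la * x).
  have := star_form_ones (H la); rewrite {1}E star_formC star_form_sumr.
  rewrite (bigD1_seq la) ?uniq_partitions //= Ex big_seq_cond big1 ?addr0 => [|ka /andP[kaP nk]].
    by move=> <-; rewrite mulfK // mulf_neq0 ?expf_neq0.
  by rewrite H_orth ?mulr0 // eq_sym.
have sl : (0 < size la)%N.
  by case: (la) (sumn_of_mem laP) n_gt0 => //= <-.
have -> : (v 1%N / eps) ^+ n.-1 * c la * Pc la =
   n`!%:R * d 1%N ^+ n / v 1%N * co (nseq n 1%N) (H la) * pr la / x.
  by rewrite Ec PcE // -(prednK n_gt0) -(prednK sl) /= pole_cancel.
apply: ev_div => //; apply: evM; last exact: pr_ev.
apply: evM; last exact: leading_ev.
apply: evM; last by apply: evV => //; exact: v_const.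
by apply: evM; [exact: ev_nat|apply: evX; exact: d_ev].
Qed.

End Degree.
End GramSchmidt.

(** * Logarithm and q-binomial coefficients *)

Section Log.
Variables (K : fieldType) (L : comAlgType K).
Hypothesis natK : forall n, n.+1%:R != 0 :> K.
Variable f : nat -> L.

(** The factor i on each part cancels the i^(m_i) of z_la, leaving 1 / prod_i m_i!; with k! in front
    this is the multinomial expansion of a k-th power. *)
Definition length_part k (la : seq nat) : L :=
  if size la == k then \prod_(i <- la) (i%:R *: f i) else 0.

(* Both sides satisfy the recursion obtained from [(G^(k+1))' = (k+1) G' G^k]. *)
Lemma coef_power_psum n k m : (m <= n)%N ->
  ((\poly_(s < n.+1) (if s == 0%N then 0 else f s)) ^+ k)`_m =
  (k`!)%:R *: psum m (length_part k).
Proof.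
set G := \poly_(s < n.+1) _; elim: k m => [|k IH] m mn.
  rewrite expr0 coef1 fact0 scale1r; case: m mn => [|m] mn.
    by rewrite psum0 /length_part /= big_nil.
  rewrite /psum big_seq big1 // => la laP; rewrite /length_part.
  case: eqP => [/size0nil E|]; last by rewrite scaler0.
  by have := sumn_of_mem laP; rewrite E.
case: m mn => [|m] mn.
  rewrite psum0 /length_part /= scaler0 exprS coef0M coef_poly /= mul0r //.
have E : m.+1%:R *: (G ^+ k.+1)`_m.+1 =
    k.+1%:R *: \sum_(1 <= s < m.+2) (s%:R *: f s) * (G ^+ k)`_(m.+1 - s).
  have := coef_deriv (G ^+ k.+1) m; rewrite deriv_exp /= => E.
  rewrite -[LHS]mulr_algl scaler_nat mulr_natl -E coefMn scaler_nat; congr (_ *+ _).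
  rewrite coefM big_add1 /= big_mkord; apply: eq_bigr => i _.
  have im : (i <= m)%N by rewrite -ltnS.
  rewrite coef_deriv coef_poly ltnS (leq_ltn_trans im) //= subSS scaler_nat //.
apply: (scalerI (natK m)); rewrite E scalerA mulrC -scalerA.
rewrite psum_newton //; last first.
  move=> la mu pm; rewrite /length_part (perm_size pm); case: eqP => // _.
  exact: perm_big.
rewrite factS natrM -scalerA; congr (_ *: _); rewrite scaler_sumr.
apply: eq_big_nat => s /andP[s1 sm].
rewrite IH ?(leq_trans (leq_subr _ _) mn) // -scalerAr; congr (_ *: _).
rewrite /psum mulr_sumr; apply: eq_bigr => la _; rewrite -scalerAr.
by rewrite /length_part /= eqSS; case: eqP => _; rewrite ?mulr0 // big_cons.
Qed.

(** Only k = l(la) contributes to a given la, and (-1)^(k+1) / k times the k! of the multinomial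
    expansion is (-1)^(k+1) (k-1)!. *)
Lemma log_psum n : (0 < n)%N ->
  \sum_(1 <= k < n.+1) ((-1) ^+ k.+1 / k%:R) *:
    ((\poly_(s < n.+1) (if s == 0%N then 0 else f s)) ^+ k)`_n =
  psum n (fun la => ((-1) ^+ (size la).+1 * ((size la).-1)`!%:R) *:
                    \prod_(i <- la) (i%:R *: f i)).
Proof.
move=> n0; under eq_bigr do rewrite coef_power_psum // scalerA /psum scaler_sumr.
rewrite exchange_big /=; apply: eq_big_seq => la laP.
have pl := is_part_of_mem laP; have /andP[_ zl] := pl.
have sl : (0 < size la)%N by case: (la) (sumn_of_mem laP) n0 => //= <-.
have sn : (size la < n.+1)%N by rewrite ltnS -(sumn_of_mem laP) size_le_sumn.
rewrite (bigD1_seq (size la)) ?iota_uniq ?mem_index_iota ?sl //=.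
rewrite big1 ?addr0 => [|k /negbTE nk]; last first.
  by rewrite /length_part eq_sym nk !scaler0.
rewrite /length_part eqxx !scalerA; congr (_ *: _).
case: (size la) sl => // s _ /=.
by rewrite factS natrM mulrA divfK ?natK // mulrC.
Qed.

End Log.

Section QBinomial.
Variables (K : fieldType) (q t : K).
Hypothesis natK : forall n, n.+1%:R != 0 :> K.
Hypothesis q_neq : forall k, (0 < k)%N -> 1 - q ^+ k != 0.

Definition qbin n : K := \prod_(j < n) ((1 - t * q ^+ j) / (1 - q ^+ j.+1)).
Local Notation x := (fun k => (1 - t ^+ k) / (1 - q ^+ k)).
Local Notation S := (fun n => \sum_(j < n) x (n - j)%N * qbin j).

Lemma qbinS n : (1 - q ^+ n.+1) * qbin n.+1 = (1 - t * q ^+ n) * qbin n.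
Proof.
by rewrite /qbin big_ord_recr /= mulrC -mulrA divfK ?q_neq // mulrC.
Qed.

Lemma qbin_sum n : (1 - t) * \sum_(j < n) q ^+ j * qbin j = (1 - q ^+ n) * qbin n.
Proof.
elim: n => [|n IH]; first by rewrite big_ord0 expr0 subrr mulr0 mul0r.
by rewrite big_ord_recr mulrDr IH qbinS /=; ring.
Qed.

(** Newton's identity for the power sums (1-t^k)/(1-q^k). Multiplied by 1 - q^(n+1), the terms of
    the sum split into those of [qbin_sum] and those of the same sum for n. *)
Lemma qbin_newton n : n%:R * qbin n = S n.
Proof.
elim: n => [|n IH]; first by rewrite big_ord0 mul0r.
apply: (mulfI (q_neq (ltn0Sn n))).
have -> : (1 - q ^+ n.+1) * (n.+1%:R * qbin n.+1) =
    (1 - t * q ^+ n) * (n%:R * qbin n) + (1 - q ^+ n.+1) * qbin n.+1.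
  by rewrite mulrCA qbinS -[n.+1]addn1 natrD; ring.
rewrite IH -qbin_sum mulr_sumr.
(* From 1 - q^(n+1) = q^j (1 - q^(n+1-j)) + (1 - q^j). *)
have split1 (j : 'I_n.+1) : (1 - q ^+ n.+1) * (x (n.+1 - j)%N * qbin j) =
    (1 - t ^+ (n.+1 - j)) * (q ^+ j * qbin j) + x (n.+1 - j)%N * ((1 - q ^+ j) * qbin j).
  have jn : (j <= n.+1)%N by rewrite ltnW.
  have h : 1 - q ^+ (n.+1 - j) != 0 by rewrite q_neq // subn_gt0.
  have -> : q ^+ n.+1 = q ^+ (n.+1 - j) * q ^+ j by rewrite -exprD subnK.
  by field.
rewrite [RHS]mulr_sumr (eq_bigr _ (fun j _ => split1 j)) big_split /=.
rewrite [X in _ = _ + X]big_ord_recl expr0 subrr mul0r mulr0 add0r.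
(* From 1 - t q^i = (1 - t q^n) - t q^i (1 - q^(n-i)), after lowering the index of [qbin] by
   [qbinS]. *)
have split2 (i : 'I_n) : x (n.+1 - bump 0 i)%N * ((1 - q ^+ bump 0 i) * qbin (bump 0 i)) =
    (1 - t * q ^+ n) * (x (n - i)%N * qbin i) - (t - t ^+ (n.+1 - i)) * (q ^+ i * qbin i).
  rewrite /bump /= add1n subSS qbinS.
  have h : 1 - q ^+ (n - i) != 0 by rewrite q_neq // subn_gt0.
  have -> : q ^+ n = q ^+ (n - i) * q ^+ i by rewrite -exprD subnK // ltnW.
  by rewrite subSn 1?ltnW // exprS; field.
rewrite [X in _ = _ + X](eq_bigr _ (fun i _ => split2 i)) sumrB -mulr_sumr.
rewrite [RHS]addrCA; congr (_ + _); rewrite mulr_sumr !big_ord_recr /= subSnn expr1.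
rewrite addrAC -sumrB; congr (_ + _); apply: eq_bigr => i _.
ring.
Qed.

Lemma psum_qbin n : psum n (fun la => \prod_(i <- la) x i : K^o) = qbin n.
Proof.
elim/ltn_ind: n => n IH; case: n IH => [|n] IH.
  by rewrite psum0 big_nil /qbin big_ord0.
apply: (mulfI (natK n)); rewrite qbin_newton.
apply: (etrans (@psum_newton K K^o natK n.+1 (fun la => \prod_(i <- la) x i) _)).
  by move=> la mu pm; apply: perm_big.
rewrite big_add1 big_mkord (reindex_inj rev_ord_inj) /=; apply: eq_bigr => j _.
have jn : (j < n.+1)%N by [].
rewrite subSS subKn // -subSn //.
rewrite -(IH j) // /psum mulr_sumr; apply: eq_bigr => la _.
by rewrite big_cons subSS; exact: mulrCA.
Qed.

End QBinomial.

(** * The terms of the logarithm compared with the limit coefficients *)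

Section Coefficients.
Variables (K : fieldType) (L : comAlgType K) (A : psalgebra L) (q : K).
Hypothesis q_neq : forall k, (0 < k)%N -> 1 - q ^+ k != 0.
Notation co := (coef A).

(** A union of two partitions consists of ones only if both do, and homogeneity fixes how many ones
    each factor supplies. *)
Lemma co_onesM a b f g :
  (forall m, 0%N \notin m -> co m f != 0 -> sumn m = a) ->
  (forall m, 0%N \notin m -> co m g != 0 -> sumn m = b) ->
  co (nseq (a + b) 1%N) (f * g) = co (nseq a 1%N) f * co (nseq b 1%N) g.
Proof.
move=> hf hg; have [s [us ps Ef]] := co_expand A f.
have [s' [us' ps' Eg]] := co_expand A g.
have z1 k : 0%N \notin nseq k 1%N by elim: k.
rewrite {1}Ef {1}Eg mulr_suml co_sum {2}Ef [co _ (\sum_(la <- s) _)]co_sum mulr_suml.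
apply: eq_big_seq => m1 m1s; have /andP[_ zm1] := allP ps _ m1s.
rewrite mulr_sumr co_sum {2}Eg [in RHS]co_sum mulr_sumr.
apply: eq_big_seq => m2 m2s; have /andP[_ zm2] := allP ps' _ m2s.
have zm : 0%N \notin m1 ++ m2 by rewrite mem_cat negb_or zm1.
rewrite -scalerAl -scalerAr -pmn_cat !coZ !co_pmn //.
have [->|/(hf _ zm1) s1] := eqVneq (co m1 f) 0; first by rewrite !mul0r.
have [->|/(hg _ zm2) s2] := eqVneq (co m2 g) 0; first by rewrite !(mul0r, mulr0).
have ones k (m : seq nat) : 0%N \notin m -> sumn m = k ->
    perm_eq (nseq k 1%N) m = all (pred1 1%N) m.
  move=> z sm; apply/idP/idP => [pm|al].
    by rewrite -(perm_all _ pm) all_pred1_nseq.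
  by move/all_pred1P: al sm => ->; rewrite sumn_nseq mul1n => ->.
rewrite (ones _ _ zm) ?(ones _ _ zm1) ?(ones _ _ zm2) // ?sumn_cat ?s1 ?s2 //.
by rewrite all_cat; case: (all _ m1); case: (all _ m2); rewrite !(mulr1, mulr0, mul0r) // mulrA.
Qed.

Variable v : nat -> K.

Lemma co_ones_hwp la : 0%N \notin la ->
  co (nseq (sumn la) 1%N) (hwp A v la) = \prod_(i <- la) (v 1%N ^+ i / i`!%:R).
Proof.
have z1 k : 0%N \notin nseq k 1%N by elim: k.
elim: la => [|k la IH] z.
  rewrite /= [hwp _ _ _]big_nil big_nil.
  have -> : 1 = psum_mon A [::] :> L by rewrite /psum_mon big_nil.
  by rewrite co_pmn.
move: z; rewrite in_cons negb_or eq_sym -lt0n => /andP[k0 zl].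
rewrite hwp_cons /= co_onesM ?IH // ?big_cons.
- rewrite co_hw // sumn_nseq mul1n eqxx; congr (_ / _ * _).
    by rewrite /wt big_nseq iter_mulr_1.
  by rewrite zee_ones.
- by move=> m zm; exact: hw_support.
- by move=> m zm /(hwp_support zl zm)[].
Qed.

Hypothesis v_def : forall k, v k = (1 - q ^+ k)^-1.

Definition qfact m : K := \prod_(j < m) (1 - q ^+ j.+1).
Notation rho := (hwp A v).

Lemma qfactS m : qfact m.+1 = qfact m * (1 - q ^+ m.+1).
Proof. exact: big_ord_recr. Qed.

(** Compared partition by partition. On the right stands the limit found by Gram-Schmidt: -1 is the
    value of d_1 at t = 1, and the factor (l-1)! prod (q;q)_(i-1) is what remains of Pi_la. *)
Lemma log_coefficients n : (0 < n)%N ->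
  ((q - 1) * n`!%:R) *: (\sum_(1 <= k < n.+1) ((-1) ^+ k.+1 / k%:R) *:
    ((\poly_(s < n.+1) (if s == 0%N then 0 else
       ((q - 1) ^- s / s`!%:R) *: (qfact s *: hw A v s))) ^+ k)`_n) =
  \sum_(la <- partitions n)
    (n`!%:R * (- 1%:R) ^+ n / v 1%N * co (nseq n 1%N) (rho la) *
     ((size la).-1`!%:R * \prod_(i <- la) qfact i.-1) /
     star_norm A v (fun i => - i%:R) la) *: rho la.
Proof.
move=> n0; rewrite log_psum //; last exact: (natr_neq0 A).
rewrite /psum scaler_sumr; apply: eq_big_seq => la laP.
have pl := is_part_of_mem laP; have /andP[_ zl] := pl.
have sn := sumn_of_mem laP.
pose X i : K := i%:R * ((q - 1) ^- i / i`!%:R) * qfact i.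
have -> : \prod_(i <- la) (i%:R *: (((q - 1) ^- i / i`!%:R) *: (qfact i *: hw A v i)))
   = (\prod_(i <- la) X i) *: rho la.
  rewrite /hwp -scaler_prod; apply: eq_bigr => i _; rewrite !scalerA /X.
  by congr (_ *: _); ring.
rewrite !scalerA; congr (_ *: _).
have onesE : co (nseq n 1%N) (rho la) = \prod_(i <- la) (v 1%N ^+ i / i`!%:R).
  by rewrite -sn co_ones_hwp.
rewrite /star_norm co_hwp_lead // onesE v_def expr1 invrK.
have z0 := zee_natr_neq0 A zl.
have gE : (\prod_(i <- la) (v i / i%:R)) * (\prod_(i <- la) (v i / i%:R)) *
   ((zee la)%:R * \prod_(i <- la) (- i%:R / v i)) =
   (zee la)%:R * \prod_(i <- la) (- (v i / i%:R)).
  rewrite mulrCA; congr (_ * _); rewrite -!big_split; apply: eq_big_seq => i il /=.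
  have i0 := neq0_part zl il.
  have v0 : v i != 0 by rewrite v_def invr_eq0 q_neq.
  have n0' : i%:R != 0 :> K by rewrite (natr_eq0 A) -lt0n.
  by field; rewrite v0 n0'.
rewrite gE.
(* An identity part by part: (q-1)^(-i) = (-1)^i (1-q)^(-i), and the last factor 1 - q^i of (q;q)_i
   is 1/v_i, which comes from the norm on the right. *)
have XE : (-1) ^+ (size la) * \prod_(i <- la) X i = (-1) ^+ n *
    (\prod_(i <- la) ((1 - q)^-1 ^+ i / i`!%:R)) * (\prod_(i <- la) qfact i.-1) /
    \prod_(i <- la) - (v i / i%:R).
  have -> : (-1) ^+ size la = \prod_(i <- la) -1 :> K.
    by elim: (la) => [|a l IHl]; rewrite ?big_nil // big_cons /= exprS IHl.
  have -> : (-1) ^+ n = \prod_(i <- la) (-1) ^+ i :> K by rewrite -sn sumnE expr_sum.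
  rewrite -prodfV -!big_split; apply: eq_big_seq => i il /=.
  have i0 := neq0_part zl il.
  have n0' : i%:R != 0 :> K by rewrite (natr_eq0 A) -lt0n.
  have f0 : i`!%:R != 0 :> K by rewrite (natr_eq0 A) -lt0n fact_gt0.
  have q0 := q_neq i0; have q1 := q_neq (isT : (0 < 1)%N); rewrite expr1 in q1.
  have Q1 : (1 - q) ^+ i != 0 by rewrite expf_neq0.
  have qE : qfact i = qfact i.-1 * (1 - q ^+ i).
    by rewrite -[in LHS](prednK i0) qfactS prednK.
  rewrite v_def /X qE -(opprB 1 q) [(- (1 - q)) ^+ i]exprNn exprVn.
  rewrite invfM (_ : (-1) ^- i = (-1) ^+ i); last by rewrite -exprVn invrN1.
  move: (i%:R : K) n0' (i`!%:R : K) f0 ((1 - q) ^+ i) Q1 (qfact _) ((-1) ^+ i : K).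
  by move=> a a0 b b0 c c0 d e; field; rewrite a0 b0 c0 q0 oppr_eq0 oner_eq0.
rewrite exprS mulrA.
have -> : (q - 1) * n`!%:R / (zee la)%:R * (-1 * (-1) ^+ size la) * (size la).-1`!%:R *
  \prod_(i <- la) X i = (1 - q) * n`!%:R / (zee la)%:R * (size la).-1`!%:R *
  ((-1) ^+ size la * \prod_(i <- la) X i) by ring.
rewrite XE invfM; ring.
Qed.

End Coefficients.

Lemma subr1Xn (K : fieldType) (x : K) n : 1 - x ^+ n = (1 - x) * \sum_(j < n) x ^+ j.
Proof. by rewrite -opprB subrX1 -mulNr opprB. Qed.

Lemma eq_positive_poly (R : nzRingType) n (f g : nat -> R) :
  (forall i, (0 < i)%N -> f i = g i) ->
  \poly_(i < n) (if i == 0%N then 0 else f i) = \poly_(i < n) (if i == 0%N then 0 else g i).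
Proof. by move=> fg; apply: eq_poly => -[|i] _ //=; exact: fg. Qed.

(** * The limit of the power sum expansion *)

(* The definitions with suffix R, like [logA], [picoef], [mscal] and [evc], repeat
   those of Defs over an arbitrary field: computing in Q(q,t) itself is slow. *)
Section LogDefinition.
Variables (K : fieldType) (L : comAlgType K) (q : K) (H : seq nat -> L).

Definition fps_logR (f : nat -> L) (n : nat) : L :=
  \sum_(1 <= k < n.+1) ((-1) ^+ k.+1 / k%:R : K) *:
    ((\poly_(s < n.+1) (if s == 0%N then 0 else f s)) ^+ k)`_n.

Definition rowR (s : nat) : L := H (if s == 0%N then [::] else [:: s]).

Definition logA (n : nat) : L :=
  ((q - 1) * n`!%:R) *: fps_logR (fun s => ((q - 1) ^- s / s`!%:R) *: rowR s) n.
End LogDefinition.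

Section PiCoefficient.
Variables (K : fieldType) (ev : evaluation K) (q t : K).
Hypothesis ev_q : ev q q.
Hypothesis ev_t : ev t 1.

Definition picoef (mu : seq nat) : K :=
  \prod_(i < size mu) \prod_(j < nth 0%N mu i | (i + j != 0)%N) (1 - q ^+ j * t ^+ i).

Definition picoef_red (mu : seq nat) : K :=
  \prod_(i < size mu) ((if i == 0 :> nat then 1 else \sum_(j < i) t ^+ j) *
     \prod_(j < (nth 0%N mu i).-1) (1 - q ^+ j.+1 * t ^+ i)).

(** The factors vanishing at t = 1 are the 1 - t^i of the first column above the corner; each yields
    one 1-t, and there are l(mu)-1 of them. *)
Lemma picoefE mu : is_part mu ->
  picoef mu = (1 - t) ^+ (size mu).-1 * picoef_red mu.
Proof.
move=> /andP[_ z].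
have -> : (1 - t) ^+ (size mu).-1 =
    \prod_(i < size mu) (if i == 0 :> nat then 1 else 1 - t).
  case: (size mu) => [|k]; first by rewrite big_ord0.
  by rewrite big_ord_recl mul1r big_const_ord iter_mulr_1.
rewrite -big_split; apply: eq_bigr => i _ /=.
have : (0 < nth 0%N mu i)%N by apply: neq0_part z _; rewrite mem_nth.
case: (nth 0%N mu i) => // k _; rewrite big_mkcond big_ord_recl /= addn0 expr0 mul1r.
rewrite [X in _ * X = _](eq_bigr (fun j : 'I_k => 1 - q ^+ j.+1 * t ^+ i)) => [|j _]; last first.
  by rewrite /bump /= add1n addnS.
by case: eqP => _ /=; rewrite ?mul1r // subr1Xn mulrA.
Qed.

(** At t = 1 the first column gives the product of the i with 0 < i < l(mu), and the rest of a row
    of length r gives (q;q)_(r-1). *)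
Lemma picoef_red_ev mu : is_part mu ->
  ev (picoef_red mu) ((size mu).-1`!%:R * \prod_(i <- mu) qfact q i.-1).
Proof.
move=> pm.
have -> : (size mu).-1`!%:R = \prod_(i < size mu) (if i == 0 :> nat then 1 else i%:R) :> K.
  case: (size mu) => [|k]; first by rewrite big_ord0.
  rewrite big_ord_recl mul1r /= fact_prod natr_prod big_add1 /= big_mkord.
  by apply: eq_bigr.
rewrite (big_nth 0%N) big_mkord -big_split.
have h (i : nat) k : ev (1 - q ^+ k * t ^+ i) (1 - q ^+ k).
  apply: evB; first exact: ev_1.
  rewrite -[X in ev _ X]mulr1 -(expr1n _ i).
  by apply: evM; exact: evX.
apply: ev_prod => i _ _; apply: evM; last by apply: ev_prod => j _ _; exact: h.
case: ifP => _; first exact: ev_1.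
have -> : i%:R = \sum_(j < i) 1 :> K by rewrite sumr_const card_ord.
apply: ev_sum => j _ _; rewrite -(expr1n _ j); exact: evX.
Qed.

End PiCoefficient.

Section Main.
Variables (K : fieldType) (L : comAlgType K) (A : psalgebra L) (ev : evaluation K).
Variables (q t : K) (iota : {rmorphism K -> K}).
Hypothesis q_neq : forall k, (0 < k)%N -> 1 - q ^+ k != 0.
Hypothesis t_neq : forall k, (0 < k)%N -> 1 - t ^+ k != 0.
Hypothesis t_neq0 : t != 0.
Hypothesis ev_q : ev q q.
Hypothesis ev_t : ev t 1.
Hypothesis iota_q : iota q = q.
Hypothesis iota_t : iota t = t^-1.
Notation co := (coef A).

(** [w] is the weight of the reproducing kernel, [u] the effect of X -> X/(1-1/t) on p_k, and [v]
    the transported weight, that of h_n[X/(1-q)]. *)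
Let w k := (1 - t ^+ k) / (1 - q ^+ k).
Let u k := (1 - t ^- k)^-1.
Let v k := (1 - q ^+ k)^-1.
Let eps := 1 - t.
Let d k := (1 - t ^- k) / eps.
Let e k : K := - k%:R.

Lemma tV_neq k : (0 < k)%N -> 1 - t ^- k != 0.
Proof.
move=> /t_neq; rewrite -(fmorph_eq0 iota) rmorphB rmorph1 rmorphXn /= iota_t.
by rewrite exprVn.
Qed.

Lemma eps_neq0 : eps != 0.
Proof. by have := t_neq (isT : (0 < 1)%N); rewrite expr1. Qed.

Lemma w_neq0 k : (0 < k)%N -> w k != 0.
Proof. by move=> k0; rewrite mulf_neq0 ?t_neq // invr_eq0 q_neq. Qed.

Lemma u_neq0 k : (0 < k)%N -> u k != 0.
Proof. by move=> k0; rewrite invr_eq0 tV_neq. Qed.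

Lemma v_neq0 k : (0 < k)%N -> v k != 0.
Proof. by move=> k0; rewrite invr_eq0 q_neq. Qed.

Lemma iota_w k : (0 < k)%N -> iota (w k) * u k = v k.
Proof.
move=> k0; rewrite /w /u /v rmorphM fmorphV !rmorphB !rmorph1 !rmorphXn /= iota_q iota_t.
by rewrite exprVn mulrAC mulfV ?mul1r ?tV_neq.
Qed.

Lemma v_const k : (0 < k)%N -> ev (v k) (v k).
Proof.
move=> k0; apply: evV; first exact: q_neq.
by apply: evB; [exact: ev_1|exact: evX].
Qed.

Lemma e_neq0 k : (0 < k)%N -> e k != 0.
Proof. by move=> k0; rewrite oppr_eq0 (natr_eq0 A) -lt0n. Qed.

Lemma d_ev k : (0 < k)%N -> ev (d k) (e k).
Proof.
move=> k0; have t0 := t_neq0; have E0 := eps_neq0.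
have -> : d k = - (t ^- k * \sum_(j < k) t ^+ j).
  have -> : d k = - (t ^- k * ((1 - t ^+ k) / eps)).
    by rewrite /d; have := expf_neq0 k t0; move: (t ^+ k) => x x0; field; rewrite E0 x0.
  by rewrite subr1Xn mulrAC mulfV ?mul1r.
apply: evN; have -> : k%:R = 1 ^- k * \sum_(j < k) 1 :> K.
  by rewrite expr1n invr1 mul1r sumr_const card_ord.
apply: evM.
  by apply: evV; [rewrite expr1n oner_neq0|exact: evX].
apply: ev_sum => j _ _; rewrite -(expr1n _ j); exact: evX.
Qed.

Lemma eps_ev : ev eps 0.
Proof. by rewrite -(subrr 1); apply: evB => //; exact: ev_1. Qed.

Variable phi : L -> L.
Hypothesis phiD : forall f g, phi (f + g) = phi f + phi g.
Hypothesis phiM : forall f g, phi (f * g) = phi f * phi g.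
Hypothesis phi1 : phi 1 = 1.
Hypothesis phiZ : forall c f, phi (c *: f) = iota c *: phi f.
Hypothesis phi_psum : forall k, (0 < k)%N -> phi (psum_gen A k) = u k *: psum_gen A k.

Variable sc : L -> L -> K.
Hypothesis sc_linear : forall f, linear_for *%R (sc f).
Hypothesis sc_pmn : forall f (la : seq nat), 0%N \notin la ->
  sc f (psum_mon A la) = co la f * (zee la)%:R / wt w la.

Variable P : seq nat -> L.
Hypothesis P_triangular : forall mu, is_part mu -> exists c : seq nat -> K,
  forall nu, is_part nu -> sc (hwp A w nu) (P mu) =
    if nu == mu then 1 else if dominated nu mu then c nu else 0.
Hypothesis P_orthogonal : forall la mu, is_part la -> is_part mu -> la != mu ->
  sc (P la) (P mu) = 0.

Variables (s : seq nat -> K) (H : seq nat -> L).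
Hypothesis s_neq0 : forall mu, is_part mu -> s mu != 0.
Hypothesis s_row : forall n, (0 < n)%N -> s [:: n] = iota (\prod_(j < n) (1 - t * q ^+ j)).
Hypothesis H_def : forall mu, is_part mu -> H mu = s mu *: phi (P mu).

Lemma sc_hw n : sc (hw A w n) (hw A w n) = qbin q t n.
Proof.
rewrite (sc_form sc_linear sc_pmn (n := n)); last first.
  by move=> la /andP[_ z] /negbTE ne; rewrite co_hw // ne.
rewrite -psum_qbin //; last exact: (natr_neq0 A).
apply: eq_big_seq => la laP; have /andP[_ z] := is_part_of_mem laP.
rewrite co_hw // (sumn_of_mem laP) eqxx -[in RHS]/(wt w la).
have w0 := wt_neq0 w_neq0 z; have z0 := zee_natr_neq0 A z.
transitivity ((zee la)%:R^-1 * wt w la) => //.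
by field; rewrite w0 z0.
Qed.

(** (n) is the top of the dominance order, so P_(n) is a multiple of [hw A w n]. Their pairing being
    1, the factor is (q;q)_n / (t;q)_n, and the factor (t;q)_n of the integral form removes the
    dependence on t. *)
Lemma H_row n : (0 < n)%N -> H [:: n] = qfact q n *: hw A v n.
Proof.
move=> n0; have pn : is_part [:: n] by rewrite /is_part inE eq_sym -lt0n.
have [a [E _ a0 aN]] := P_hwp_triangular w_neq0 sc_linear sc_pmn P_triangular P_orthogonal pn.
have nP : [:: n] \in partitions n by rewrite mem_partitions pn /= addn0.
have hwpE : hwp A w [:: n] = hw A w n by rewrite /hwp big_seq1.
have {}E : P [:: n] = a [:: n] *: hw A w n.
  rewrite E /= addn0 (bigD1_seq [:: n]) ?uniq_partitions //= hwpE.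
  rewrite big_seq_cond big1 ?addr0 // => la /andP[laP ne].
  suff nd : ~~ dominated [:: n] la by rewrite aN ?scale0r //= addn0.
  apply: contra ne => dom.
  have pl := is_part_of_mem laP.
  have := dominated_size pn pl dom; have := sumn_of_mem laP.
  case: (la) => [|b [|//]] /=; first by move=> E0; rewrite -E0 in n0.
  by rewrite addn0 => ->.
have [c /(_ _ pn)] := P_triangular pn; rewrite eqxx hwpE E (scZr sc_linear) sc_hw => a1.
have s0 := s_neq0 pn; rewrite s_row // fmorph_eq0 in s0.
rewrite H_def // E phiZ scalerA s_row // -rmorphM.
rewrite (phi_hw iota_w phiD phiM phi1 phiZ phi_psum).
congr (_ *: _).
have f0 : qfact q n != 0.
  by rewrite prodf_seq_neq0; apply/allP => i _; exact: q_neq.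
have -> : \prod_(j < n) (1 - t * q ^+ j) * a [:: n] = qfact q n.
  move: a1; rewrite /qbin big_split /= prodfV -/(qfact q n) mulrA [a _ * _]mulrC.
  by move/(canRL (mulfVK f0)); rewrite mul1r.
rewrite rmorph_prod; apply: eq_bigr => j _.
by rewrite rmorphB rmorph1 rmorphXn /= iota_q.
Qed.

Let kappa mu := s mu * iota (sc (P mu) (P mu)).
(** Rescaled to have coefficient 1 on the product indexed by mu, as Gram-Schmidt requires; the
    eigenvalue of [Pi] is the same. *)
Let Hm mu := (kappa mu)^-1 *: H mu.

Variable n : nat.
Hypothesis n_gt0 : (0 < n)%N.

Lemma Hm_orthogonal la mu : la \in partitions n -> mu \in partitions n -> la != mu ->
  star_form A v d eps n (Hm la) (Hm mu) = 0.
Proof.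
move=> laP muP ne.
have := H_orthogonal w_neq0 u_neq0 iota_w phiD phiM phi1 phiZ phi_psum sc_linear sc_pmn
  P_triangular P_orthogonal H_def (is_part_of_mem laP) (is_part_of_mem muP) ne.
rewrite (sumn_of_mem laP) => E.
rewrite /star_form /form (eq_big_seq (fun nu => ((kappa la)^-1 * (kappa mu)^-1) *
   (co nu (H la) * co nu (H mu) * ((zee nu)%:R / (wt u nu * wt v nu))))).
  by rewrite -mulr_sumr [X in _ * X]E mulr0.
move=> nu nuP; rewrite /Hm !coZ.
have /andP[_ z] := is_part_of_mem nuP.
have -> : star_weight v d eps nu = (zee nu)%:R / (wt u nu * wt v nu).
  rewrite /star_weight /wt -big_split -prodfV; congr (_ * _); apply: eq_big_seq => i il /=.
  rewrite /d [eps * _]mulrC divfK ?eps_neq0 // /u invfM invrK //.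
by move: (_ / (wt _ _ * _)) => x; ring.
Qed.

Lemma Hm_triangular mu : mu \in partitions n -> exists b : seq nat -> K,
  [/\ Hm mu = \sum_(la <- partitions n) b la *: hwp A v la, b mu = 1 &
      forall la, la \in partitions n -> ~~ dominated mu la -> b la = 0].
Proof.
move=> muP; have pm := is_part_of_mem muP.
have [b [E bE b0 bN]] := H_triangular w_neq0 iota_w phiD phiM phi1 phiZ phi_psum
  sc_linear sc_pmn P_triangular P_orthogonal s_neq0 H_def pm.
rewrite (sumn_of_mem muP) in E bN.
exists (fun la => (kappa mu)^-1 * b la); split.
- by rewrite /Hm E scaler_sumr; apply: eq_bigr => la _; rewrite scalerA.
- by rewrite bE mulVf //; rewrite bE in b0.
- by move=> la laP /bN ->//; rewrite mulr0.
Qed.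

Variable Pi : L -> L.
Hypothesis Pi_linear : linear Pi.
Hypothesis Pi_H : forall mu, is_part mu -> Pi (H mu) = picoef q t mu *: H mu.

Lemma Pi_power_sum_ev m : 0%N \notin m ->
  ev (co m (((1 - q) * (1 - t)) ^- n.-1 *: Pi (psum_gen A 1 ^+ n)))
     (co m (logA q H n)).
Proof.
move=> zm.
have PiHm la : la \in partitions n -> Pi (Hm la) = picoef q t la *: Hm la.
  move=> laP; have := Pi_linear (kappa la)^-1 (H la) 0.
  have Pi0 : Pi 0 = 0.
    have := Pi_linear (-1) 0 0; rewrite scaleN1r addNr => ->.
    by rewrite scaleN1r addNr.
  rewrite !addr0 Pi0 addr0 /Hm => ->.
  by rewrite Pi_H ?(is_part_of_mem laP) // !scalerA mulrC.
have := @Pi_ones_ev K L A ev v d e eps v_const v_neq0 d_ev e_neq0 eps_neq0 eps_ev n Hm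
  Hm_orthogonal Hm_triangular Pi (picoef q t) (picoef_red q t)
  (fun la => (size la).-1`!%:R * \prod_(i <- la) qfact q i.-1) Pi_linear PiHm
  (fun la laP => picoefE q t (is_part_of_mem laP))
  (fun la laP => picoef_red_ev ev_q ev_t (is_part_of_mem laP)) n_gt0 m zm.
have -> : v 1%N / eps = ((1 - q) * (1 - t))^-1 by rewrite /v expr1 invfM.
rewrite exprVn.
rewrite -(@log_coefficients K L A q q_neq v (fun k => erefl) n n_gt0).
move=> main; rewrite /logA /fps_logR (@eq_positive_poly _ _ _ (fun r =>
  ((q - 1) ^- r / r`!%:R) *: (qfact q r *: hw A v r))) // => r r0.
by rewrite /rowR gtn_eqF // H_row.
Qed.

End Main.

(** * The polynomial model of Lambda *)

Lemma mcoeff_U1Ml (M : conomType) (R : comRingType) (u m : M) (f : {malg R[M]}) :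
  (forall x y : M, mmul u x = mmul u y -> x = y) ->
  (<< u >> * f)@_(mmul u m) = f@_m.
Proof.
move=> inj; rewrite (mcoeffMlw (d1 := [fset u]%fset) (d2 := msupp f)) ?msuppU_le //.
rewrite big_seq_fset1 (eq_bigr (fun k => f@_k *+ (k == m))) => [|k _].
  case: (msuppP f m) => hm.
    rewrite (big_fsetD1 m) //= eqxx big1_fset ?addr0 // => k.
    by rewrite in_fsetD1 => /andP[/negbTE->].
  by rewrite big1_fset // => k km _; case: eqP => // E; rewrite -E km in hm.
rewrite mcoeffUU mul1r; congr (_ *+ _); congr nat_of_bool.
by apply/eqP/eqP => [/inj|->].
Qed.

Lemma mcoeff_U1Ml0 (M : conomType) (R : comRingType) (u m : M) (f : {malg R[M]}) :
  (forall x : M, mmul u x != m) -> (<< u >> * f)@_m = 0.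
Proof.
move=> h; rewrite (mcoeffMlw (d1 := [fset u]%fset) (d2 := msupp f)) ?msuppU_le //.
by rewrite big_seq_fset1 big1 // => k _; rewrite (negbTE (h k)).
Qed.

Lemma cmM_inj (I : choiceType) (u x y : {cmonom I}) : mmul u x = mmul u y -> x = y.
Proof.
move=> /eqP/cmP E; apply/eqP/cmP => i; have := E i; rewrite !cmM; lia.
Qed.

Lemma cmM_divK (I : choiceType) (u m : {cmonom I}) :
  (forall i, u i <= m i)%N -> mmul u (divcm m u) = m.
Proof. by move=> h; apply/eqP/cmP => i; rewrite cmM divcmE subnKC. Qed.

(** This is d/dp_(k+1), as the variable k stands for p_(k+1). Where that variable is absent from m,
    the truncated quotient is harmless because its coefficient [m k] is 0. *)
HB.lock Definition mder (R : comRingType) (k : nat) (f : {malg R[{cmonom nat}]}) :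
    {malg R[{cmonom nat}]} :=
  \sum_(m <- msupp f) (f@_m * (m k)%:R) *: << divcm m (ucm k) >>.

Section MalgPsalgebra.
Variable R : comRingType.
Local Notation L := {malg R[{cmonom nat}]}.

Lemma mcoeff_mder k (f : L) m : (mder k f)@_m = (m k).+1%:R * f@_(mmul (ucm k) m).
Proof.
rewrite mder.unlock raddf_sum /= (eq_bigr (fun n => ((m k).+1%:R * f@_n) *+
    (n == mmul (ucm k) m))) => [|n _]; last first.
  rewrite mcoeffZ mcoeffU1.
  case: (posnP (n k)) => [n0|nk].
    rewrite n0 mulr0 mul0r; case: eqP => [E|]; rewrite ?mulr0n //.
    by have := n0; rewrite E cmM cmU eqxx.
  have E : mmul (ucm k) (divcm n (ucm k)) = n.
    by apply: cmM_divK => i; rewrite cmU; case: eqP => // <-.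
  have -> : (n == mmul (ucm k) m) = (divcm n (ucm k) == m).
    by rewrite -{1}E; apply/eqP/eqP => [/cmM_inj|->].
  case: eqP => [<-|]; rewrite ?mulr0 ?mulr0n // divcmE cmU eqxx subn1 prednK //.
  by rewrite mulr1 mulrC.
case: (msuppP f (mmul (ucm k) m)) => hm.
  rewrite (big_fsetD1 (mmul (ucm k) m)) //= eqxx big1_fset ?addr0 // => n.
  by rewrite in_fsetD1 => /andP[/negbTE->].
by rewrite mulr0 big1_fset // => n nm; case: eqP => // E; rewrite -E nm in hm.
Qed.

Lemma mder_linear k : linear (mder k : L -> L).
Proof.
move=> c f g; apply/malgP => m; rewrite mcoeffD mcoeffZ !mcoeff_mder mcoeffD mcoeffZ.
by rewrite mulrDr mulrCA.
Qed.

Lemma mcoeff_linear m : linear_for *%R (fun f : L => f@_m).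
Proof. by move=> c f g; rewrite mcoeffD mcoeffZ. Qed.

Lemma mcoeff_pmon la mu : 0%N \notin la -> 0%N \notin mu ->
  (\prod_(i <- mu) ppow i : L)@_(pmon la) = (perm_eq la mu)%:R.
Proof.
move=> zl zm; rewrite ppow_prod mcoeffU1 eq_sym; congr (_%:R); congr nat_of_bool.
by apply/eqP/idP => [/(pmon_inj zl zm)//|/perm_pmon].
Qed.

Lemma malg_mon_ind (P : L -> Prop) :
  P 0 -> (forall f g, P f -> P g -> P (f + g)) ->
  (forall c la, 0%N \notin la -> P (c *: \prod_(i <- la) ppow i)) ->
  forall f, P f.
Proof.
move=> P0 PD PU f; rewrite [f]monalgE; apply: big_ind => // m _.
by rewrite malgUZ -[m in << m >>]pmon_mparts -ppow_prod; apply/PU/mparts_neq0.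
Qed.

Lemma mcoeff_mder_pmon k la (f : L) : (0 < k)%N -> 0%N \notin la ->
  (mder k.-1 f)@_(pmon la) = (count_mem k la).+1%:R * f@_(pmon (k :: la)).
Proof.
move=> k0 z; rewrite mcoeff_mder pmonE pmon_cons; congr (_.+1%:R * _).
apply: eq_in_count => -[|i] il /=; first by rewrite il in z.
by rewrite -[in RHS](prednK k0) eqSS.
Qed.
End MalgPsalgebra.

Definition malg_psalgebra (K : fieldType) (natK : forall n, n.+1%:R != 0 :> K) :
    psalgebra {malg K[{cmonom nat}]} :=
  PSAlgebra natK (fun la => @mcoeff_linear K (pmon la)) (@mcoeff_pmon K)
    (@malg_mon_ind K) (fun k => @mder_linear K k.-1) (@mcoeff_mder_pmon K).

(** * Diagonal scalar products on the polynomial model *)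

Section Scalar.
Variables (R : comRingType) (c : nat -> R).
Local Notation L := {malg R[{cmonom nat}]}.

Definition mscal (f g : L) : R :=
  \sum_(k <- msupp f) f@_k * g@_k * (zee (mparts k))%:R * \prod_(i <- mparts k) c i.

Lemma mscal_linear f : linear_for *%R (mscal f).
Proof.
move=> a g h; rewrite /mscal mulr_sumr -big_split; apply: eq_bigr => m _ /=.
by rewrite mcoeffD mcoeffZ; ring.
Qed.

Lemma mscal_pmon (f : L) (la : seq nat) : 0%N \notin la ->
  mscal f (\prod_(i <- la) ppow i) = f@_(pmon la) * (zee la)%:R * \prod_(i <- la) c i.
Proof.
move=> z; rewrite /mscal ppow_prod.
rewrite (eq_bigr (fun m => f@_m * (pmon la == m)%:R * (zee (mparts m))%:R *
   \prod_(i <- mparts m) c i)) => [|m _]; last by rewrite mcoeffU1.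
have pp := mparts_pmon z.
case: (msuppP f (pmon la)) => hm.
  rewrite (big_fsetD1 (pmon la)) //= eqxx mulr1 (perm_zee pp) (perm_big _ pp) /=.
  rewrite big1_fset ?addr0 // => m.
  by rewrite in_fsetD1 eq_sym => /andP[/negbTE-> _] _; rewrite mulr0 !mul0r.
rewrite !mul0r big1_fset // => m mf _; case: eqP => [E|]; last by rewrite mulr0 !mul0r.
by rewrite E mf in hm.
Qed.
End Scalar.

(** * Symmetric functions in finitely many variables *)

Section Realization.
Variables (R : comRingType) (N : nat).
Local Notation Y := {malg R[{cmonom 'I_N}]}.
Local Notation L := {malg R[{cmonom nat}]}.

Definition powm (I : choiceType) (u : {cmonom I}) k : {cmonom I} :=
  iter k (mmul u) mone.

Lemma powmE (I : choiceType) (u : {cmonom I}) k i : powm u k i = (k * u i)%N.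
Proof. by elim: k => [|k IH] /=; rewrite ?cm1 // cmM IH mulSn. Qed.

Lemma malgUX (I : choiceType) (u : {cmonom I}) k :
  << u >> ^+ k = << powm u k >> :> {malg R[{cmonom I}]}.
Proof.
elim: k => [|k IH]; first by rewrite expr0.
by rewrite exprS IH; exact: cmalgU1M.
Qed.

Definition monf (al : 'I_N -> nat) : {cmonom 'I_N} :=
  \big[mmul/mone]_(j < N) powm (ucm j) (al j).

Lemma monfE al i : monf al i = al i.
Proof.
have bigE (r : seq 'I_N) : (\big[mmul/mone]_(j <- r) powm (ucm j) (al j) : {cmonom 'I_N}) i =
    (\sum_(j <- r) al j * (j == i))%N.
  elim: r => [|a r IH]; first by rewrite !big_nil cm1.
  by rewrite !big_cons cmM IH powmE cmU.
rewrite bigE (bigD1 i) //= eqxx muln1 big1 ?addn0 // => j /negbTE->.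
by rewrite muln0.
Qed.

Lemma malg_monf al : \prod_(j < N) << ucm j >> ^+ al j = << monf al >> :> Y.
Proof.
rewrite /monf; elim: (index_enum _) => [|a r IH]; first by rewrite !big_nil.
by rewrite !big_cons IH malgUX; exact: cmalgU1M.
Qed.

Definition realizeR (f : L) : Y :=
  evalp (fun k => \sum_(i < N) << ucm i >> ^+ k) (in_alg Y) f.

Lemma realizeRD f g : realizeR (f + g) = realizeR f + realizeR g.
Proof. exact: rmorphD. Qed.

Lemma realizeRM f g : realizeR (f * g) = realizeR f * realizeR g.
Proof. exact: rmorphM. Qed.

Lemma realizeR1 : realizeR 1 = 1.
Proof. exact: rmorph1. Qed.

Lemma realizeRZ c f : realizeR (c *: f) = c *: realizeR f.
Proof. by rewrite /realizeR evalpZ mulr_algl. Qed.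

Lemma realizeR_ppow k : (0 < k)%N -> realizeR (ppow k) = \sum_(i < N) << ucm i >> ^+ k.
Proof.
move=> k0; have := @evalp_pmon Y (fun k => \sum_(i < N) << ucm i >> ^+ k) R (in_alg Y) [:: k].
rewrite inE eq_sym -lt0n => /(_ k0); rewrite big_seq1 => <-.
by rewrite /realizeR /ppow /pmon big_seq1.
Qed.

Definition vcoef (al : 'I_N -> nat) (f : L) : R := (realizeR f)@_(monf al).

Lemma vcoef_linear al : linear_for *%R (vcoef al).
Proof. by move=> c f g; rewrite /vcoef realizeRD realizeRZ mcoeffD mcoeffZ. Qed.

Lemma vcoef1 al : vcoef al 1 = [forall i, al i == 0%N]%:R.
Proof.
rewrite /vcoef realizeR1 mcoeff1; congr (_%:R); congr nat_of_bool.
apply/eqP/forallP => [E i|h]; first by rewrite -monfE E cm1.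
by apply/eqP/cmP => i; rewrite monfE cm1; exact/eqP.
Qed.

(** Multiplication by x_j^k shifts the exponent al_j by k. The kernel shows the same shift under
    d/dp_k, which is what identifies the two sides of [kernelE]. *)
Lemma vcoef_psum al k f : (0 < k)%N -> vcoef al (ppow k * f) = \sum_(j < N)
    if (k <= al j)%N then vcoef (fun i => if i == j then (al i - k)%N else al i) f else 0.
Proof.
move=> k0; rewrite /vcoef realizeRM realizeR_ppow // mulr_suml raddf_sum; apply: eq_bigr => j _ /=.
rewrite malgUX; case: ifP => kj.
  have -> : monf al = mmul (powm (ucm j) k)
      (monf (fun i => if i == j then (al i - k)%N else al i)).
    apply/eqP/cmP => i; rewrite cmM !monfE powmE cmU eq_sym.
    by case: eqP => [->|_]; rewrite ?muln1 ?muln0 ?subnKC.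
  by apply: mcoeff_U1Ml => x y; exact: cmM_inj.
apply: mcoeff_U1Ml0 => x; apply/eqP => /eqP/cmP/(_ j).
by rewrite cmM monfE powmE cmU eqxx => E; rewrite -E muln1 leq_addr in kj.
Qed.

End Realization.

Definition msymR (R : comRingType) (N : nat) (la : seq nat) : {malg R[{cmonom 'I_N}]} :=
  \sum_(e : {ffun 'I_N -> 'I_(sumn la).+1} |
      perm_eq [seq i <- [seq val (e j) | j <- enum 'I_N] | (0 < i)%N] la)
    \prod_(j < N) << ucm j >> ^+ e j.

(** With exactly l(nu) variables the exponent vector is nu itself, without zeros; it occurs in m_la
    only if nu is a rearrangement of la, hence equal to it. *)
Lemma mcoeff_msym (R : comRingType) (la nu : seq nat) : is_part la -> is_part nu ->
  (msymR R (size nu) la)@_(monf (fun j : 'I_(size nu) => nth 0%N nu j)) = (nu == la)%:R.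
Proof.
move=> pl pn; rewrite /msymR raddf_sum /=.
rewrite (eq_bigr (fun e : {ffun 'I_(size nu) -> 'I_(sumn la).+1} => (monf (fun j => val (e j)) ==
   monf (fun j : 'I_(size nu) => nth 0%N nu j))%:R)) => [|e _]; last first.
  by rewrite (malg_monf R (fun j => val (e j))) mcoeffU1.
have seqE (f : 'I_(size nu) -> nat) : (forall j, f j = nth 0%N nu j) ->
    [seq i <- [seq f j | j <- enum 'I_(size nu)] | (0 < i)%N] = nu.
  move=> fE; have -> : [seq f j | j <- enum 'I_(size nu)] = nu.
    rewrite (eq_map fE) -[RHS](mkseq_nth 0%N) /mkseq -val_enum_ord -map_comp.
    by apply: eq_map.
  apply/all_filterP/allP => i inu; have /andP[_ z] := pn.
  exact: neq0_part inu.
have monP (e : {ffun 'I_(size nu) -> 'I_(sumn la).+1}) :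
    monf (fun j => val (e j)) = monf (fun j : 'I_(size nu) => nth 0%N nu j) ->
    forall j, val (e j) = nth 0%N nu j.
  by move=> E j; rewrite -[LHS](monfE (fun j => val (e j))) E monfE.
have [E|ne] := eqVneq nu la; last first.
  rewrite big1 // => e pe; case: eqP => // /monP/seqE Ee.
  by case/eqP: ne; apply: perm_part => //; rewrite -Ee.
pose e0 : {ffun 'I_(size nu) -> 'I_(sumn la).+1} := [ffun j : 'I_(size nu) => inord (nth 0%N nu j)].
have e0E (j : 'I_(size nu)) : val (e0 j) = nth 0%N nu j.
  by rewrite ffunE /= inordK // ltnS -E mem_le_sumn // mem_nth.
rewrite (bigD1 e0) /=; last by rewrite (seqE _ e0E) E.
have -> : monf (fun j => val (e0 j)) = monf (fun j : 'I_(size nu) => nth 0%N nu j).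
  by apply/eqP/cmP => i; rewrite !monfE.
rewrite eqxx big1 ?addr0 // => e /andP[_ ne]; case: eqP => // /monP Ee.
case/eqP: ne; apply/ffunP => j; apply: val_inj => /=.
by rewrite [LHS]Ee [RHS]e0E.
Qed.

(** No linearity over scalars is asked of [psi]: a plethysm combined with t -> 1/t is only
    semilinear. *)
Lemma det_fixed (L : comRingType) (psi : L -> L) n (M : 'M[L]_n) :
  (forall f g, psi (f + g) = psi f + psi g) ->
  (forall f g, psi (f * g) = psi f * psi g) -> psi 1 = 1 ->
  (forall i j, psi (M i j) = M i j) -> psi (\det M) = \det M.
Proof.
move=> pD pM p1 pE.
have p0 : psi 0 = 0 by apply: (addrI (psi 0)); rewrite -pD !addr0.
have pN f : psi (- f) = - psi f by apply: (addrI (psi f)); rewrite -pD !subrr.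
rewrite /determinant (big_morph psi pD p0); apply: eq_bigr => s _.
rewrite pM (big_morph psi pM p1); congr (_ * _); last by apply: eq_bigr => i _; exact: pE.
by case: (perm.odd_perm s); rewrite ?expr1 ?expr0 ?pN p1.
Qed.

(** * Semilinear plethysms and Schur functions *)

Section Plethysm.
Variable K : fieldType.
Local Notation L := {malg K[{cmonom nat}]}.

Definition plethysm (iota : {rmorphism K -> K}) (u : nat -> K) (f : L) : L :=
  evalp (fun k => u k *: ppow k) (malgC \o iota : K -> L) f.

Section Iota.
Variables (iota : {rmorphism K -> K}) (u : nat -> K).
Local Notation phi := (plethysm iota u).

Lemma plethysmD f g : phi (f + g) = phi f + phi g.
Proof. exact: rmorphD. Qed.

Lemma plethysmM f g : phi (f * g) = phi f * phi g.
Proof. exact: rmorphM. Qed.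

Lemma plethysm1 : phi 1 = 1.
Proof. exact: rmorph1. Qed.

Lemma plethysmZ c f : phi (c *: f) = iota c *: phi f.
Proof. by rewrite /plethysm evalpZ; exact: cmul_malgC. Qed.

Lemma plethysm_ppow k : (0 < k)%N -> phi (ppow k) = u k *: ppow k.
Proof.
move=> k0; have := @evalp_pmon L (fun k => u k *: ppow k) K (malgC \o iota : K -> L) [:: k].
rewrite inE eq_sym -lt0n => /(_ k0); rewrite big_seq1 => <-.
by rewrite /plethysm /ppow /pmon big_seq1.
Qed.
End Iota.

Definition hR n : L := \sum_(la <- partitions n) ((zee la)%:R^-1 : K) *: \prod_(i <- la) ppow i.

Definition schurR (la : seq nat) : L :=
  \det (\matrix_(i < size la, j < size la)
    (if (i <= nth 0 la i + j)%N then hR (nth 0 la i + j - i)%N else 0)).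

(** The composite fixes every p_k, and the scalars of h_n are the rationals 1/z_la, fixed by any
    field morphism; so it fixes the Jacobi-Trudi determinant. With v_k = 1 - t^k and u_k = 1/(1 -
    t^(-k)) it undoes X -> X(1-t) while inverting t. *)
Lemma plethysm_schur (iota jota : {rmorphism K -> K}) (u v : nat -> K) la :
  (forall k, (0 < k)%N -> iota (v k) * u k = 1) ->
  plethysm iota u (plethysm jota v (schurR la)) = schurR la.
Proof.
move=> uv; set psi := fun f => plethysm iota u (plethysm jota v f).
have psiD f g : psi (f + g) = psi f + psi g by rewrite /psi !plethysmD.
have psiM f g : psi (f * g) = psi f * psi g by rewrite /psi !plethysmM.
have psi1 : psi 1 = 1 by rewrite /psi !plethysm1.
have psi0 : psi 0 = 0 by apply: (addrI (psi 0)); rewrite -psiD !addr0.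
rewrite /schurR -[LHS]/(psi _); apply: det_fixed => // i j; rewrite !mxE.
case: ifP => _ //; rewrite /hR (big_morph psi psiD psi0).
apply: eq_big_seq => mu /is_part_of_mem/andP[_ z].
rewrite {1}/psi !plethysmZ !fmorphV !rmorph_nat; congr (_ *: _).
rewrite -/(psi _) (big_morph psi psiM psi1); apply: eq_big_seq => k kmu.
have k0 := neq0_part z kmu.
rewrite /psi (plethysm_ppow jota v k0) plethysmZ (plethysm_ppow iota u k0) scalerA (uv _ k0).
exact: scale1r.
Qed.

Definition hcompR (n : nat) (f : L) : L :=
  \sum_(k <- msupp f | sumn (mparts k) == n) << f@_k *g k >>.

Definition degreeR (f : L) : nat := (\max_(k <- msupp f) sumn (mparts k))%N.

Lemma degreeU m : degreeR << m >> = sumn (mparts m).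
Proof. by rewrite /degreeR msuppU1 big_seq_fset1. Qed.

Lemma hcompU n m : hcompR n << m >> = if sumn (mparts m) == n then << m >> else 0.
Proof. by rewrite /hcompR msuppU1 big_mkcond big_seq_fset1 mcoeffUU. Qed.

End Plethysm.

(** * Macdonald polynomials over a field with evaluation *)

Section FractionEvaluation.
Variable F : fieldType.
Local Notation K := {fraction {poly F}}.

Definition evc (x y : K) : Prop := exists n d : {poly F},
  [/\ d.[1] != 0, x = tofrac n / tofrac d & y = tofrac (n.[1] / d.[1])%:P].

Lemma evcP x y : evc x y <-> exists2 c, ev1 x c & y = cstf c.
Proof.
split=> [[n [d [h1 h2 h3]]]|[c [n [d [h1 h2 ->]]] ->]]; last by exists n, d.
by exists (n.[1] / d.[1]) => //; exists n, d.
Qed.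

Lemma evcD x y a b : evc x a -> evc y b -> evc (x + y) (a + b).
Proof.
move=> /evcP[c hc ->] /evcP[c' hc' ->]; apply/evcP.
by exists (c + c'); [exact: ev1D|rewrite rmorphD].
Qed.

Lemma evcN x a : evc x a -> evc (- x) (- a).
Proof.
by move=> /evcP[c hc ->]; apply/evcP; exists (- c); [exact: ev1N|rewrite rmorphN].
Qed.

Lemma evcM x y a b : evc x a -> evc y b -> evc (x * y) (a * b).
Proof.
move=> /evcP[c hc ->] /evcP[c' hc' ->]; apply/evcP.
by exists (c * c'); [exact: ev1M|rewrite rmorphM].
Qed.

Lemma evcV x a : a != 0 -> evc x a -> evc x^-1 a^-1.
Proof.
move=> a0 /evcP[c hc E]; rewrite E fmorph_eq0 in a0; apply/evcP.
by exists c^-1; [exact: ev1V|rewrite E fmorphV].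
Qed.

Lemma evc_1 : evc 1 1.
Proof. by apply/evcP; exists 1; [exact: ev1_1|rewrite rmorph1]. Qed.

Lemma evc_const x a : evc x a -> evc a a.
Proof. by move=> /evcP[c _ ->]; apply/evcP; exists c => //; exact: ev1_cst. Qed.

Lemma evc_uniq x a b : evc x a -> evc x b -> a = b.
Proof. by move=> /evcP[c hc ->] /evcP[c' hc' ->]; rewrite (ev1_unique hc hc'). Qed.

Definition fraction_evaluation : evaluation K :=
  Evaluation evcD evcN evcM evcV evc_1 evc_const evc_uniq.

Lemma evc_cst c : evc (cstf c) (cstf c).
Proof. by apply/evcP; exists c => //; exact: ev1_cst. Qed.

Lemma evcX : evc (tofrac 'X) 1.
Proof.
apply/evcP; exists 1; last by rewrite rmorph1.
by have := ev1_tofrac ('X : {poly F}); rewrite hornerX.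
Qed.

Lemma natr_fraction : (forall n, n.+1%:R != 0 :> F) -> forall n, n.+1%:R != 0 :> K.
Proof. by move=> h n; rewrite -(rmorph_nat (@cstf F)) fmorph_eq0. Qed.

Lemma subr1_cstX_neq0 (c : F) k : (0 < k)%N -> 1 - cstf c * tofrac 'X ^+ k != 0.
Proof.
move=> k0; rewrite -tofracXn -tofracM -tofrac1 -tofracB tofrac_eq0.
apply/eqP => /polyP/(_ 0%N)/eqP.
by case: k k0 => // k _; rewrite coefB coef1 coefCM coefXn coef0 mulr0n mulr0 subr0 oner_eq0.
Qed.

Lemma subr1X_neq0 k : (0 < k)%N -> 1 - (tofrac 'X : K) ^+ k != 0.
Proof. by move/(subr1_cstX_neq0 1); rewrite rmorph1 mul1r. Qed.

End FractionEvaluation.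

Lemma plethysm_in_alg (K : fieldType) (v : nat -> K) (f : {malg K[{cmonom nat}]}) :
  evalp (fun k => v k *: ppow k) (in_alg {malg K[{cmonom nat}]}) f = plethysm idfun v f.
Proof.
apply: eq_bigr => m _; congr (_ * _) => /=.
by rewrite -mul_malgC mulr1.
Qed.

Section Realized.
Variables (K : fieldType) (natK : forall n, n.+1%:R != 0 :> K).
Local Notation L := {malg K[{cmonom nat}]}.
Local Notation A := (malg_psalgebra natK).
Variables (w c : nat -> K).
Hypothesis w_neq0 : forall k, (0 < k)%N -> w k != 0.
Hypothesis cE : forall k, c k = (w k)^-1.

Lemma mscal_pmn (f : L) (la : seq nat) : 0%N \notin la ->
  mscal c f (psum_mon A la) = coef A la f * (zee la)%:R / wt w la.
Proof.
move=> z; rewrite [LHS](mscal_pmon c f z); congr (_ * _).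
by rewrite /wt -prodfV; apply: eq_bigr => i _; exact: cE.
Qed.

(** [kernelE] at the exponent vector nu in l(nu) variables; for a symmetric polynomial this
    coefficient of x^nu is that of m_nu. *)
Lemma mscal_hwp (f : L) (nu : seq nat) :
  mscal c (hwp A w nu) f = vcoef (fun j : 'I_(size nu) => nth 0%N nu j) f.
Proof.
rewrite (kernelE (A := A) w_neq0 (mscal_linear c) mscal_pmn
  (@vcoef_linear _ _) (@vcoef1 _ _) (@vcoef_psum _ _)).
by rewrite /hwp (big_nth 0%N) big_mkord.
Qed.

Lemma realized_triangular (p : L) mu (a : seq nat -> K) : is_part mu ->
  (forall N, realizeR N p = msymR K N mu +
     \sum_(la <- partitions (sumn mu) | (la != mu) && dominated la mu) a la *: msymR K N la) ->
  forall nu, is_part nu ->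
    mscal c (hwp A w nu) p = if nu == mu then 1 else if dominated nu mu then a nu else 0.
Proof.
move=> pm E nu pn; rewrite mscal_hwp /vcoef E mcoeffD (mcoeff_msym K pm pn) raddf_sum /=.
have Ea la : la \in partitions (sumn mu) -> (a la *: msymR K (size nu) la)@_
    (monf (fun j : 'I_(size nu) => nth 0%N nu j)) = a la * (nu == la)%:R.
  move=> laP; rewrite mcoeffZ; congr (_ * _); apply: mcoeff_msym => //.
  exact: is_part_of_mem laP.
rewrite big_seq_cond (eq_bigr (fun la => a la * (nu == la)%:R)); last first.
  by move=> la /andP[laP _]; exact: Ea.
rewrite -big_seq_cond.
have [->|ne] := eqVneq nu mu.
  by rewrite big1 ?addr0 // => la /andP[/negbTE]; rewrite eq_sym => ->; rewrite mulr0.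
rewrite add0r; case: ifP => dom.
  have nuP : nu \in partitions (sumn mu) by rewrite mem_partitions pn (dominated_sumn dom) /=.
  rewrite big_mkcond (bigD1_seq nu) ?uniq_partitions //= ne dom eqxx mulr1 big1 ?addr0 //.
  by move=> la /negbTE; rewrite eq_sym => ->; rewrite mulr0 if_same.
rewrite big1 // => la /andP[_ d]; case: eqP => [E'|]; last by rewrite mulr0.
by rewrite E' d in dom.
Qed.

End Realized.

Section PowerSumMain.
Variables (K : fieldType) (natK : forall n, n.+1%:R != 0 :> K) (ev : evaluation K).
Local Notation L := {malg K[{cmonom nat}]}.
Local Notation A := (malg_psalgebra natK).
Variables (q t : K) (iota : {rmorphism K -> K}).
Hypothesis qt_neq0 : forall a b, 1 - q ^+ a * t ^+ b.+1 != 0.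
Hypothesis q_neq : forall k, (0 < k)%N -> 1 - q ^+ k != 0.
Hypothesis t_neq0 : t != 0.
Hypothesis ev_q : ev q q.
Hypothesis ev_t : ev t 1.
Hypothesis iota_q : iota q = q.
Hypothesis iota_t : iota t = t^-1.

Definition cJR (mu : seq nat) : K :=
  \prod_(i < size mu) \prod_(j < nth 0%N mu i) (1 - q ^+ arm mu i j * t ^+ (leg mu i j).+1).

Lemma cJR_neq0 mu : cJR mu != 0.
Proof.
rewrite prodf_seq_neq0; apply/allP => i _; rewrite prodf_seq_neq0.
by apply/allP => j _; exact: qt_neq0.
Qed.

Lemma cJR_row n : cJR [:: n] = \prod_(j < n) (1 - t * q ^+ j).
Proof.
rewrite /cJR big_ord_recl big_ord0 mulr1 (reindex_inj rev_ord_inj) /=.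
apply: eq_bigr => j _; have jn := ltn_ord j.
have -> : arm [:: n] 0 (n - j.+1) = j by rewrite /arm /=; lia.
have -> : leg [:: n] 0 (n - j.+1) = 0%N by rewrite /leg /=; case: (_ < _)%N.
by rewrite expr1 mulrC.
Qed.

Variables (P : seq nat -> L) (Kc : seq nat -> seq nat -> K).
Hypothesis P_tri : forall mu, is_part mu -> exists c : seq nat -> K, forall N,
  realizeR N (P mu) = msymR K N mu +
    \sum_(la <- partitions (sumn mu) | (la != mu) && dominated la mu) c la *: msymR K N la.
Hypothesis P_orth : forall la mu, is_part la -> is_part mu -> la != mu ->
  mscal (fun i => (1 - q ^+ i) / (1 - t ^+ i)) (P la) (P mu) = 0.
Hypothesis J_expand : forall mu, is_part mu ->
  cJR mu *: P mu = \sum_(la <- partitions (sumn mu))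
    Kc la mu *: evalp (fun k => (1 - t ^+ k) *: ppow k) (in_alg L) (schurR K la).

Definition HR (mu : seq nat) : L :=
  \sum_(la <- partitions (sumn mu)) (iota (Kc la mu) * t ^+ nstat mu) *: schurR K la.

Let w k := (1 - t ^+ k) / (1 - q ^+ k).
Let u k := (1 - t ^- k)^-1.
Let phi := plethysm iota u.
Let s mu := t ^+ nstat mu * iota (cJR mu).

Lemma t_neq k : (0 < k)%N -> 1 - t ^+ k != 0.
Proof. by case: k => // k _; have := qt_neq0 0 k; rewrite expr0 mul1r. Qed.

Lemma wE_neq0 k : (0 < k)%N -> w k != 0.
Proof. exact: (w_neq0 q_neq t_neq). Qed.

Lemma tV_neq0 k : (0 < k)%N -> 1 - t ^- k != 0.
Proof. exact: (tV_neq t_neq iota_t). Qed.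

(** Apply [phi] to the expansion defining the Kostka coefficients: s_la[X(1-t)] becomes s_la, and t
    becomes 1/t in the coefficients. *)
Lemma HR_def mu : is_part mu -> HR mu = s mu *: phi (P mu).
Proof.
move=> pm; rewrite /s -scalerA -plethysmZ J_expand //.
rewrite (phi_sum (@plethysmD _ _ u) (@plethysmZ _ _ u)) scaler_sumr.
apply: eq_bigr => la _; rewrite plethysmZ scalerA mulrC; congr (_ *: _).
rewrite plethysm_in_alg plethysm_schur // => k k0.
rewrite /u rmorphB rmorph1 rmorphXn /= iota_t exprVn mulfV //; exact: tV_neq0.
Qed.

Lemma s_neq0 mu : is_part mu -> s mu != 0.
Proof. by move=> _; rewrite mulf_neq0 ?expf_neq0 ?t_neq0 // fmorph_eq0 cJR_neq0. Qed.

Lemma s_row n : (0 < n)%N -> s [:: n] = iota (\prod_(j < n) (1 - t * q ^+ j)).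
Proof.
by move=> _; rewrite /s cJR_row /nstat big_ord_recl big_ord0 mul0n addn0 expr0 mul1r.
Qed.

Let sc := mscal (fun i => (1 - q ^+ i) / (1 - t ^+ i)).

Lemma cwE k : (1 - q ^+ k) / (1 - t ^+ k) = (w k)^-1.
Proof. by rewrite /w invf_div. Qed.

Lemma P_triangular mu : is_part mu -> exists c : seq nat -> K, forall nu, is_part nu ->
  sc (hwp A w nu) (P mu) = if nu == mu then 1 else if dominated nu mu then c nu else 0.
Proof.
move=> pm; have [c E] := P_tri pm; exists c.
exact: (realized_triangular natK wE_neq0 cwE pm E).
Qed.

(** The one-row formula for n = 1: (1-q) h_1[X/(1-q)] = p_1. *)
Lemma HR_one : HR [:: 1%N] = ppow 1.
Proof.
have := @H_row K L A q t iota q_neq t_neq iota_q iota_t phi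
  (@plethysmD _ _ _) (@plethysmM _ _ _) (@plethysm1 _ _ _) (@plethysmZ _ _ _)
  (@plethysm_ppow _ _ _) sc (mscal_linear _)
  (mscal_pmn natK cwE) P P_triangular P_orth s HR
  s_neq0 s_row HR_def 1 isT.
move=> ->; rewrite /qfact big_ord_recl big_ord0 mulr1 expr1.
have := hw1 A (fun k => (1 - q ^+ k)^-1) => ->.
have := q_neq (isT : (0 < 1)%N); rewrite expr1 => h.
by rewrite scalerA mulfV // scale1r.
Qed.

Variable Pi : L -> L.
Hypothesis Pi_linear : linear Pi.
Hypothesis Pi_H : forall mu, is_part mu -> Pi (HR mu) = picoef q t mu *: HR mu.

Lemma malg_main n m : (0 < n)%N ->
  ev ((((1 - q) * (1 - t)) ^- n.-1 *: Pi (ppow 1 ^+ n))@_m)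
      ((logA q HR n)@_m).
Proof.
move=> n0; rewrite -[m]pmon_mparts.
exact: (@Pi_power_sum_ev K L A ev q t iota q_neq t_neq
  t_neq0 ev_q ev_t iota_q iota_t phi
  (@plethysmD _ _ _) (@plethysmM _ _ _) (@plethysm1 _ _ _) (@plethysmZ _ _ _)
  (@plethysm_ppow _ _ _) sc (mscal_linear _)
  (mscal_pmn natK cwE) P P_triangular P_orth s HR
  s_neq0 s_row HR_def n n0 Pi Pi_linear Pi_H (mparts m) (mparts_neq0 m)).
Qed.

End PowerSumMain.

(** Models the double sum over homogeneous components in the Theta operator when both arguments are
    homogeneous, of degrees a and b. *)
Lemma sum_pick2 (V : nmodType) (G : nat -> nat -> V -> V -> V) a b x y :
  (forall n m F, G n m 0 F = 0) -> (forall n m f, G n m f 0 = 0) ->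
  \sum_(n < a.+1) \sum_(m < b.+1)
     G n m (if a == n then x else 0) (if b == m then y else 0) = G a b x y.
Proof.
move=> Gl Gr; rewrite (bigD1 ord_max) //= (bigD1 ord_max) //= !eqxx.
rewrite [X in _ + X + _]big1 ?addr0 => [|j nj]; last first.
  by rewrite ifN ?Gr // eq_sym.
rewrite big1 ?addr0 // => i ni; rewrite big1 // => j _.
by rewrite ifN ?Gl // eq_sym.
Qed.

(** * Theta operators *)

Section ThetaMalg.
Variables (K : fieldType).
Local Notation L := {malg K[{cmonom nat}]}.

Definition eR (n : nat) : L :=
  \sum_(la <- partitions n)
    ((-1) ^+ (n - size la) / (zee la)%:R : K) *: \prod_(i <- la) ppow i.

Lemma eR1 : eR 1 = ppow 1.
Proof.
rewrite /eR (perm_big [:: [:: 1%N]]) /=; last first.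
  apply: uniq_perm => // [|la]; first exact: uniq_partitions.
  rewrite inE; apply/idP/eqP => [laP|->]; last by rewrite mem_partitions.
  have /andP[_ z] := is_part_of_mem laP; have s := sumn_of_mem laP.
  have := size_le_sumn z; rewrite s; case: la z s {laP} => [|a [|//]] //= _.
  by rewrite addn0 => ->.
rewrite big_seq1 big_seq1 (_ : zee [:: 1%N] = 1%N); last by rewrite zee_cons /zee big_nil.
by rewrite divr1 scale1r.
Qed.

Variables (Pi PiV : L -> L) (u : nat -> K).
Hypothesis Pi0 : Pi 0 = 0.
Hypothesis PiV0 : PiV 0 = 0.

Definition Theta_homR (n m : nat) (f F : L) : L :=
  if m == 0%N then (if n == 0%N then f * F else 0)
  else Pi (evalp (fun k => u k *: ppow k) (in_alg L) f * PiV F).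

Definition ThetaR (f F : L) : L :=
  \sum_(n < (degreeR f).+1) \sum_(m < (degreeR F).+1)
    Theta_homR n m (hcompR n f) (hcompR m F).

Lemma Theta_homR0l n m F : Theta_homR n m 0 F = 0.
Proof.
rewrite /Theta_homR; case: ifP => _; first by case: ifP; rewrite ?mul0r.
have -> : evalp (fun k => u k *: ppow k) (in_alg L) 0 = 0 :> L by exact: rmorph0.
by rewrite mul0r.
Qed.

Lemma Theta_homR0r n m f : Theta_homR n m f 0 = 0.
Proof.
rewrite /Theta_homR; case: ifP => _; first by case: ifP; rewrite ?mulr0.
by rewrite PiV0 mulr0.
Qed.

Lemma Theta_sumU (m1 m2 : {cmonom nat}) d1 d2 :
  d1 = sumn (mparts m1) -> d2 = sumn (mparts m2) ->
  \sum_(n < d1.+1) \sum_(m < d2.+1) Theta_homR n m (hcompR n << m1 >>) (hcompR m << m2 >>) =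
  Theta_homR (sumn (mparts m1)) (sumn (mparts m2)) << m1 >> << m2 >>.
Proof.
move=> -> ->; apply: etrans (sum_pick2 _ _ _ _ Theta_homR0l Theta_homR0r).
apply: eq_bigr => i _; apply: eq_bigr => j _.
exact: (f_equal2 (Theta_homR i j) (hcompU K i m1) (hcompU K j m2)).
Qed.

Lemma ThetaRU (m1 m2 : {cmonom nat}) a b f F :
  f = << m1 >> -> F = << m2 >> -> sumn (mparts m1) = a -> sumn (mparts m2) = b ->
  ThetaR f F = Theta_homR a b f F.
Proof. by move=> -> -> <- <-; exact: (Theta_sumU (degreeU K m1) (degreeU K m2)). Qed.

(** As e_1 = p_1, both arguments are power sum monomials, hence homogeneous, and the definition
    collapses to one application of [Pi]. The factor [u 1] will be 1/M. *)
Lemma ThetaR_ones k : PiV (ppow 1) = ppow 1 ->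
  ThetaR (\prod_(i <- nseq k 1%N) eR i) (eR 1) = Pi (u 1%N ^+ k *: ppow 1 ^+ k.+1).
Proof.
move=> PiV1; rewrite big_nseq iter_mulr_1 eR1.
have z j : 0%N \notin nseq j 1%N by elim: j.
have E j : ppow 1 ^+ j = << pmon (nseq j 1%N) >> :> L.
  by rewrite -ppow_prod big_nseq iter_mulr_1.
have s j : sumn (mparts (pmon (nseq j 1%N))) = j.
  by rewrite (perm_sumn (mparts_pmon (z j))) sumn_nseq mul1n.
have E1 := E 1%N; rewrite expr1 in E1.
rewrite (ThetaRU (E k) E1 (s k) (s 1%N)) /Theta_homR /= PiV1; apply: (congr1 Pi).
rewrite plethysm_in_alg.
have -> : plethysm idfun u (ppow 1 ^+ k) = (u 1%N *: ppow 1) ^+ k.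
  elim: (k) => [|j IH]; first exact: plethysm1.
  by rewrite !exprS plethysmM IH plethysm_ppow.
by rewrite exprZn -scalerAl -exprSr.
Qed.

End ThetaMalg.

(** * Specialization to Q(q,t) *)

Lemma natr_Qq_neq0 n : n.+1%:R != 0 :> Qq.
Proof. by apply: natr_fraction => k; rewrite Num.Theory.pnatr_eq0. Qed.

Definition qX : Qq := tofrac 'X.
(* Conversion between terms over Q(q,t) and instances of the lemmas over an
   abstract field is fast only once [reverse_coercion] has been unfolded. *)
Ltac unfold_qt := cbv delta [reverse_coercion q_ constt cstf t_ qX] beta.

Lemma realizeE N f : realize N f = realizeR N f.
Proof. by unfold_qt. Qed.

Lemma msymE N la : msym N la = msymR Qqt N la.
Proof. by unfold_qt. Qed.

Lemma scal_qtE f g : scal_qt f g = mscal (fun i => (1 - cstf qX ^+ i) / (1 - tofrac 'X ^+ i)) f g.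
Proof. by rewrite /scal_qt /mscal; unfold_qt. Qed.

Lemma Pi_coefE la : Pi_coef la = picoef (cstf qX) (tofrac 'X) la.
Proof. by rewrite /Pi_coef /picoef; unfold_qt. Qed.

Lemma HtildeE K mu : Htilde K mu = HR (tofrac 'X) (@inversion Qq) K mu.
Proof. by rewrite /Htilde /HR; unfold_qt; reflexivity. Qed.

Lemma eval_coefE x y : eval_coef_t1 x y = evc x y.
Proof. by rewrite /eval_coef_t1 /evc; unfold_qt. Qed.

Lemma A_E K n : A_ (Htilde K) n = logA (cstf qX) (HR (tofrac 'X) (@inversion Qq) K) n.
Proof.
rewrite /A_ /fps_log /R_ /logA /fps_logR /rowR.
unfold_qt.
reflexivity.
Qed.

Lemma subr1_qt_neq0 a b : 1 - cstf qX ^+ a * tofrac 'X ^+ b.+1 != 0.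
Proof. by rewrite -rmorphXn; exact: subr1_cstX_neq0. Qed.

Lemma subr1_q_neq0 k : (0 < k)%N -> 1 - cstf qX ^+ k != 0.
Proof.
move=> k0; rewrite -rmorphXn -(rmorph1 (@cstf Qq)) -rmorphB fmorph_eq0.
exact: subr1X_neq0.
Qed.

Section Final.
Variables (K : seq nat -> seq nat -> Qqt) (P : seq nat -> Lambda).
Hypothesis hP : is_macdonaldP P.
Hypothesis hJ : forall mu, is_part mu ->
      cJ mu *: P mu =
        \sum_(la <- partitions (sumn mu)) K la mu *: pleth_1t (schur la).
Variables (Pi : {linear Lambda -> Lambda}) (hPi : is_Pi (Htilde K) Pi).

Lemma Pi_linearP : linear Pi.
Proof. exact: linearP. Qed.

Lemma macdonaldP_triangular mu : is_part mu -> exists c : seq nat -> Qqt, forall N,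
  realizeR N (P mu) = msymR Qqt N mu +
    \sum_(la <- partitions (sumn mu) | (la != mu) && dominated la mu) c la *: msymR Qqt N la.
Proof.
case: hP => Ptri _ /Ptri[c E]; exists c => N; move: (E N).
rewrite realizeE msymE.
unfold_qt.
exact.
Qed.

Lemma macdonaldP_orthogonal la mu : is_part la -> is_part mu -> la != mu ->
  mscal (fun i => (1 - cstf qX ^+ i) / (1 - tofrac 'X ^+ i)) (P la) (P mu) = 0.
Proof.
case: hP => _ Porth pl pm ne; have := Porth la mu pl pm ne.
rewrite scal_qtE.
unfold_qt.
exact.
Qed.

Lemma integral_form_expand mu : is_part mu ->
  cJR (cstf qX) (tofrac 'X) mu *: P mu = \sum_(la <- partitions (sumn mu))
    K la mu *: evalp (fun k => (1 - tofrac 'X ^+ k) *: ppow k) (in_alg Lambda) (schurR Qqt la).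
Proof.
move=> pm; move: (hJ pm).
unfold_qt.
exact.
Qed.

Lemma Pi_Htilde mu : is_part mu ->
  Pi (HR (tofrac 'X) (@inversion Qq) K mu) =
  picoef (cstf qX) (tofrac 'X) mu *: HR (tofrac 'X) (@inversion Qq) K mu.
Proof.
move=> pm; move: (hPi pm).
rewrite HtildeE Pi_coefE.
unfold_qt.
exact.
Qed.

Lemma Htilde_one : Htilde K [:: 1%N] = pow 1.
Proof.
rewrite HtildeE.
have := @HR_one _ (natr_fraction natr_Qq_neq0) (cstf qX) (tofrac 'X) (@inversion Qq)
  subr1_qt_neq0 subr1_q_neq0 (tofracX_neq0 _) (inversion_cst _) (inversionX _) P K
  macdonaldP_triangular macdonaldP_orthogonal integral_form_expand.
unfold_qt.
exact.
Qed.

Lemma Pi_pow_ev n m : (0 < n)%N ->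
  eval_coef_t1 ((((1 - q_) * (1 - t_)) ^- n.-1 *: Pi (pow 1 ^+ n))@_m) ((A_ (Htilde K) n)@_m).
Proof.
move=> n0; rewrite eval_coefE A_E.
have := @malg_main _ (natr_fraction natr_Qq_neq0) (fraction_evaluation Qq) (cstf qX)
  (tofrac 'X) (@inversion Qq) subr1_qt_neq0 subr1_q_neq0 (tofracX_neq0 _) (evc_cst _) (evcX _)
  (inversion_cst _) (inversionX _) P K macdonaldP_triangular macdonaldP_orthogonal
  integral_form_expand Pi Pi_linearP Pi_Htilde n m n0.
unfold_qt.
exact.
Qed.

End Final.

Lemma ThetaE (Pi PiV : Lambda -> Lambda) k :
  Theta Pi PiV (e_part (nseq k 1%N)) (e_ 1) =
  ThetaR Pi PiV (fun k => ((1 - cstf qX ^+ k) * (1 - tofrac 'X ^+ k))^-1)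
     (\prod_(i <- nseq k 1%N) eR Qqt i) (eR Qqt 1).
Proof.
rewrite /Theta /ThetaR /e_part /Theta_hom /Theta_homR /pleth_divM /psubst.
unfold_qt.
reflexivity.
Qed.

Lemma Theta_ones (Pi PiV : Lambda -> Lambda) k :
  Pi 0 = 0 -> PiV 0 = 0 -> PiV (pow 1) = pow 1 ->
  Theta Pi PiV (e_part (nseq k 1%N)) (e_ 1) = Pi (((1 - q_) * (1 - t_)) ^- k *: pow 1 ^+ k.+1).
Proof.
move=> Pi0 PiV0 PiV1; apply: (etrans (ThetaE Pi PiV k)).
pose u k : Qqt := ((1 - cstf qX ^+ k) * (1 - tofrac 'X ^+ k))^-1.
apply: (etrans (ThetaR_ones u Pi0 PiV0 k PiV1)); rewrite /u.
rewrite !expr1 exprVn.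
unfold_qt.
reflexivity.
Qed.

Lemma Pi_coef_one : Pi_coef [:: 1%N] = 1.
Proof. by rewrite /Pi_coef big_ord1 /= big_mkcond big_ord1. Qed.

Theorem proposition4p1
    (K : seq nat -> seq nat -> Qqt) (hK : is_qtKostka K)
    (Pi : {linear Lambda -> Lambda}) (PiV : Lambda -> Lambda)
    (hPi : is_Pi (Htilde K) Pi)
    (PiK : cancel Pi PiV) (PiVK : cancel PiV Pi)
    (n : nat) (hn : (0 < n)%N) :
  eval_t1 (Theta Pi PiV (e_part (nseq n.-1 1%N)) (e_ 1)) (A_ (Htilde K) n).
Proof.
case: hK => P hP hJ m.
have Pi0 : Pi 0 = 0 by exact: linear0.
have PiV0 : PiV 0 = 0 by rewrite -Pi0 PiK.
(* H_(1) = p_1 and Pi_(1) is an empty product, so [Pi] and its inverse both fix p_1. *)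
have Pi1 : Pi (pow 1) = pow 1.
  have := hPi [:: 1%N] isT; rewrite (Htilde_one hP hJ) => ->.
  by rewrite Pi_coef_one scale1r.
have PiV1 : PiV (pow 1) = pow 1 by rewrite -{1}Pi1 PiK.
rewrite (Theta_ones _ Pi0 PiV0 PiV1) prednK //.
have -> c f : Pi (c *: f) = c *: Pi f by exact: linearZ.
exact: (Pi_pow_ev hP hJ hPi).
Qed.
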